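(* Let $(M,g,J)$ be a 4-dimensional conformally Kähler Riemannian manifold, oriented so that its fundamental 2-form is anti-self-dual. Work locally. Let $\mathcal{J}$ be a $\mathrm{GL}(n,\mathbb{C})$-valued function satisfying the generalized Yang equation $\nabla^{A'}(r\mathcal{J}^{-1}\tilde\nabla_{A'}\mathcal{J})=0$, expressed in block form as $$\mathcal{J}=\begin{pmatrix}\mathsf{A}^{-1}-\tilde{\mathsf{B}}\tilde{\mathsf{A}}\mathsf{B}&-\tilde{\mathsf{B}}\tilde{\mathsf{A}}\\ \tilde{\mathsf{A}}\mathsf{B}&\tilde{\mathsf{A}}\end{pmatrix},$$ and let $\mathcal{J}'$ be a matrix obtained from $\mathcal{J}$ by the Bäcklund transformation defined in the context. Then $\mathcal{J}'$ satisfies the generalized Yang equation $$\nabla^{A'}\big(r\,\mathcal{J}'^{-1}\tilde\nabla_{A'}\mathcal{J}'\big)=0$$ if and only if the geometry is conformally half-flat, i.e. $\Psi_{ABCD}\equiv0$, where $\Psi_{ABCD}$ is the anti-self-dual Weyl spinor of $g$.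
   Context: All constructions are local. $(M,g)$ is an oriented 4-dimensional Riemannian manifold with an integrable orthogonal complex structure $J$; $\kappa(\cdot,\cdot)=g(J\cdot,\cdot)$, and the orientation is such that $*\kappa=-\kappa$. Conformally Kähler means that there is locally a (positive) scalar field $\phi$ with $\mathrm{d}(\phi^2\kappa)=0$. Spinors: abstract indices in Penrose–Rindler conventions ($\psi_B=\psi^A\epsilon_{AB}$, $\psi^A=\epsilon^{AB}\psi_B$, similarly for primed indices; $g_{ab}=\epsilon_{AB}\epsilon_{A'B'}$); unprimed symmetric 2-spinors correspond to anti-self-dual 2-forms and primed ones to self-dual 2-forms. $\nabla_{AA'}$ is the Levi-Civita connection extended to spinors. $\dagger$ is Euclidean spinor conjugation, $(a,b)\mapsto(-\bar b,\bar a)$ in components. Let $o^A$ be a spinor field representing $J$, meaning that with $\iota^A=o^{\dagger A}$ and $\chi=o_A\iota^A$ one has $J^a{}_b=i\chi^{-1}(o^A\iota_B+\iota^Ao_B)\delta^{A'}_{B'}$, and with scaling chosen so that $o^A\nabla_{AA'}o_B=0$ (locally possible in the conformally Kähler case). Put $r=\chi^{-1}\phi$, $\nabla_{A'}=\iota^A\nabla_{AA'}$, $\tilde\nabla_{A'}=o^A\nabla_{AA'}$. The generalized Yang equation for $\mathcal{J}$ is equivalent to $A_{AA'}=-\chi^{-1}\mathcal{J}^{-1}\iota_Ao^B\nabla_{BA'}\mathcal{J}$ being the gauge potential of a self-dual Yang–Mills field ($F=\mathrm{d}A+A\wedge A$, $*F=F$). Bäcklund transformation: in the block form of $\mathcal{J}$,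 $\mathsf{A}$ is an invertible $k\times k$ matrix, $\tilde{\mathsf{A}}$ an invertible $\tilde k\times\tilde k$ matrix, $k+\tilde k=n$, $\mathsf{B}$ is $\tilde k\times k$ and $\tilde{\mathsf{B}}$ is $k\times\tilde k$. When $\mathcal{J}$ satisfies the generalized Yang equation there exist locally matrix-valued functions $\mathsf{B}'$ ($k\times\tilde k$) and $\tilde{\mathsf{B}}'$ ($\tilde k\times k$) with $$r\mathsf{A}(\tilde\nabla_{A'}\tilde{\mathsf{B}})\tilde{\mathsf{A}}=\nabla_{A'}\mathsf{B}',\qquad r\tilde{\mathsf{A}}(\nabla_{A'}\mathsf{B})\mathsf{A}=\tilde\nabla_{A'}\tilde{\mathsf{B}}',$$ not unique: any choice is allowed. Set $\mathsf{A}'=r^{-1}\tilde{\mathsf{A}}^{-1}$ ($\tilde k\times\tilde k$) and $\tilde{\mathsf{A}}'=r^{-1}\mathsf{A}^{-1}$ ($k\times k$). Then $$\mathcal{J}'=\begin{pmatrix}\mathsf{A}'^{-1}-\tilde{\mathsf{B}}'\tilde{\mathsf{A}}'\mathsf{B}'&-\tilde{\mathsf{B}}'\tilde{\mathsf{A}}'\\ \tilde{\mathsf{A}}'\mathsf{B}'&\tilde{\mathsf{A}}'\end{pmatrix}.$$ *)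

(* Defs.v *)
From HB Require Import structures.
From mathcomp Require Import all_boot all_order all_fingroup all_algebra.
From mathcomp Require Import complex.
From mathcomp Require Import all_classical all_reals all_analysis.

Set Implicit Arguments.
Unset Strict Implicit.
Unset Printing Implicit Defensive.

Import Order.TTheory GRing.Theory Num.Theory.
Import numFieldNormedType.Exports.

Local Open Scope classical_set_scope.
Local Open Scope ring_scope.

(* The geometry is local, so everything lives on an open subset U of R^4, the
   domain of an oriented chart.  Fields are total functions on R^4; only their
   restrictions to U matter. *)

Section Calculus.
Variable R : realType.
Notation pt := 'rV[R]_4.
Notation C := (R[i]).

Definition partial (i : 'I_4) (f : pt -> R) : pt -> R :=
  fun x => 'D_(delta_mx 0 i) f x.

Definition cpartial (i : 'I_4) (f : pt -> C) : pt -> C :=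
  fun x => (partial i (fun y => complex.Re (f y)) x
            +i* partial i (fun y => complex.Im (f y)) x)%C.

(* On an open U this is C^oo: all iterated partial derivatives are
   differentiable, hence continuous, on U. *)
Definition smooth (U : set pt) (f : pt -> R) : Prop :=
  forall (s : seq 'I_4) (x : pt), U x -> differentiable (foldr partial f s) x.

Definition csmooth (U : set pt) (f : pt -> C) : Prop :=
  smooth U (fun y => complex.Re (f y)) /\ smooth U (fun y => complex.Im (f y)).

Definition mxsmooth (U : set pt) m n (F : pt -> 'M[R]_(m, n)) : Prop :=
  forall i j, smooth U (fun y => F y i j).

Definition cmxsmooth (U : set pt) m n (F : pt -> 'M[C]_(m, n)) : Prop :=
  forall i j, csmooth U (fun y => F y i j).

Definition mxcpartial (i : 'I_4) m n (F : pt -> 'M[C]_(m, n)) :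
    pt -> 'M[C]_(m, n) :=
  fun x => \matrix_(p, q) cpartial i (fun y => F y p q) x.

End Calculus.

Section RiemannianGeometry.
Variable R : realType.
Notation pt := 'rV[R]_4.
Notation C := (R[i]).

Definition riemannian_metric (U : set pt) (g : pt -> 'M[R]_4) : Prop :=
  [/\ mxsmooth U g,
      forall x, U x -> (g x)^T = g x &
      forall x, U x -> forall v : 'rV[R]_4, v != 0 ->
        0 < (v *m g x *m v^T) 0 0].

(* Gamma^k_{ij} of the Levi-Civita connection *)
Definition christoffel (g : pt -> 'M[R]_4) (k i j : 'I_4) : pt -> R :=
  fun x => 2^-1 * \sum_l invmx (g x) k l *
    (partial i (fun y => g y j l) x + partial j (fun y => g y i l) x
     - partial l (fun y => g y i j) x).

(* R_{abc}^d, with (nabla_a nabla_b - nabla_b nabla_a) V^d = R_{abc}^d V^c *)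
Definition riemann_up (g : pt -> 'M[R]_4) (a b c d : 'I_4) : pt -> R :=
  fun x => partial a (christoffel g d b c) x - partial b (christoffel g d a c) x
    + \sum_f (christoffel g d a f x * christoffel g f b c x
              - christoffel g d b f x * christoffel g f a c x).

(* R_{abcd} *)
Definition riemann (g : pt -> 'M[R]_4) (a b c d : 'I_4) : pt -> R :=
  fun x => \sum_f riemann_up g a b c f x * g x f d.

Definition levi_civita_symbol (i j k l : 'I_4) : R :=
  \det (\matrix_(p < 4, q < 4) (tnth [tuple i; j; k; l] p == q)%:R).

(* ( *w )_{ij} = 1/2 e_{ijkl} g^{km} g^{ln} w_{mn}, where
   e_{ijkl} = sqrt(det g) [ijkl] is the volume form of the oriented chart. *)
Definition hodge (g : pt -> 'M[R]_4) (x : pt) (w : 'M[C]_4) : 'M[C]_4 :=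
  \matrix_(i, j) \sum_k \sum_l \sum_m \sum_n
    (2^-1 * Num.sqrt (\det (g x)) * levi_civita_symbol i j k l
      * invmx (g x) k m * invmx (g x) l n)%:C%C * w m n.

(* (J x) i j is J^i_j.  Vanishing Nijenhuis tensor. *)
Definition integrable_at (J : pt -> 'M[R]_4) (x : pt) : Prop :=
  forall i j k : 'I_4,
    \sum_l (J x l i * partial l (fun y => J y k j) x
            - J x l j * partial l (fun y => J y k i) x
            - J x k l * (partial i (fun y => J y l j) x
                         - partial j (fun y => J y l i) x)) = 0.

Definition orthogonal_complex_structure (U : set pt) (g J : pt -> 'M[R]_4) :
    Prop :=
  [/\ mxsmooth U J,
      forall x, U x -> J x *m J x = - 1%:M,
      forall x, U x -> (J x)^T *m g x *m J x = g x &
      forall x, U x -> integrable_at J x].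

(* kappa(X, Y) = g (J X, Y), as kappa_{ij} = g_{kj} J^k_i *)
Definition fundamental_form (g J : pt -> 'M[R]_4) : pt -> 'M[R]_4 :=
  fun x => (J x)^T *m g x.

Definition closed_two_form (U : set pt) (w : pt -> 'M[R]_4) : Prop :=
  forall x, U x -> forall i j k : 'I_4,
    partial i (fun y => w y j k) x + partial j (fun y => w y k i) x
    + partial k (fun y => w y i j) x = 0.

(* (g, J) is conformally Kaehler on U, with d (phi^2 kappa) = 0, and U is
   oriented so that kappa is anti-self-dual. *)
Definition conformally_kahler (U : set pt) (g J : pt -> 'M[R]_4)
    (phi : pt -> R) : Prop :=
  [/\ riemannian_metric U g,
      orthogonal_complex_structure U g J,
      forall x, U x ->
        hodge g x (map_mx (real_complex R) (fundamental_form g J x))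
        = - map_mx (real_complex R) (fundamental_form g J x),
      smooth U phi /\ (forall x, U x -> 0 < phi x) &
      closed_two_form U (fun y => phi y ^+ 2 *: fundamental_form g J y)].

End RiemannianGeometry.

Section Spinors.
Variable R : realType.
Notation pt := 'rV[R]_4.
Notation C := (R[i]).
Notation cfield := (pt -> C).

(* eps_{AB} and eps^{AB}, likewise for primed indices: eps_{01} = eps^{01} = 1.
   psi_B = psi^A eps_{AB} and psi^A = eps^{AB} psi_B. *)
Definition eps (A B : 'I_2) : C := ((A < B)%N)%:R - ((B < A)%N)%:R.

(* A spin frame is encoded by the complex vector fields e_{AA'}; the column
   e A A' x lists their coordinate components.  Spinor fields are given by
   their components in this frame. *)
Definition frame := 'I_2 -> 'I_2 -> pt -> 'cV[C]_4.

Definition gdot (g : pt -> 'M[R]_4) (x : pt) (X Y : 'cV[C]_4) : C :=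
  (X^T *m map_mx (real_complex R) (g x) *m Y) 0 0.

(* coframe dual to e: theta^{AA'}(e_{BB'}) is 1 if A = B and A' = B', else 0 *)
Definition coframe (g : pt -> 'M[R]_4) (e : frame) (A A' : 'I_2) (x : pt) :
    'rV[C]_4 :=
  \sum_B \sum_B' (eps A B * eps A' B') *:
    ((e B B' x)^T *m map_mx (real_complex R) (g x)).

(* the 2-form psi_{AB} eps_{A'B'} *)
Definition unprimed_form (g : pt -> 'M[R]_4) (e : frame) (psi : 'M[C]_2)
    (x : pt) : 'M[C]_4 :=
  \sum_A \sum_A' \sum_B \sum_B' (psi A B * eps A' B') *:
    ((coframe g e A A' x)^T *m coframe g e B B' x).

(* g_{ab} = eps_{AB} eps_{A'B'}; the conjugate of e_{AA'} is
   eps^{AB} eps^{A'B'} e_{BB'}, i.e. real vectors are those fixed by the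
   conjugation (a, b) |-> (- b^*, a^* ) on both indices; unprimed symmetric
   spinors are anti-self-dual 2-forms. *)
Definition spin_frame (U : set pt) (g : pt -> 'M[R]_4) (e : frame) : Prop :=
  [/\ forall A A', cmxsmooth U (e A A'),
      forall x, U x -> forall A A' B B',
        gdot g x (e A A' x) (e B B' x) = eps A B * eps A' B',
      forall x, U x -> forall A A',
        map_mx Num.conj (e A A' x)
        = \sum_B \sum_B' (eps A B * eps A' B') *: e B B' x &
      forall x, U x -> forall psi : 'M[C]_2, psi^T = psi ->
        hodge g x (unprimed_form g e psi x) = - unprimed_form g e psi x].

(* e_{AA'}(f) *)
Definition dirder (e : frame) (A A' : 'I_2) (f : cfield) : cfield :=
  fun x => \sum_i e A A' x i 0 * cpartial i f x.

Definition mxdirder (e : frame) (A A' : 'I_2) m n (F : pt -> 'M[C]_(m, n)) :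
    pt -> 'M[C]_(m, n) :=
  fun x => \sum_i e A A' x i 0 *: mxcpartial i F x.

(* Levi-Civita derivative of e_{BB'} along e_{AA'} *)
Definition nabla_frame (g : pt -> 'M[R]_4) (e : frame) (A A' B B' : 'I_2)
    (x : pt) : 'cV[C]_4 :=
  \col_k \sum_i e A A' x i 0 *
    (cpartial i (fun y => e B B' y k 0) x
     + \sum_j (christoffel g k i j x)%:C%C * e B B' x j 0).

(* Since g (nabla_{AA'} e_{BB'}, e_{CC'})
     = gamma_{AA'BC} eps_{B'C'} + gamma'_{AA'B'C'} eps_{BC}
   with gamma, gamma' symmetric in their last two indices, the two parts of the
   connection are obtained by contraction. *)
Definition gamma (g : pt -> 'M[R]_4) (e : frame) (A A' B D : 'I_2) : cfield :=
  fun x => 2^-1 * \sum_B' \sum_D' eps B' D' *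
    gdot g x (nabla_frame g e A A' B B' x) (e D D' x).

Definition gamma' (g : pt -> 'M[R]_4) (e : frame) (A A' B' D' : 'I_2) :
    cfield :=
  fun x => 2^-1 * \sum_B \sum_D eps B D *
    gdot g x (nabla_frame g e A A' B B' x) (e D D' x).

(* nabla_{AA'} psi_B = e_{AA'}(psi_B) - gamma_{AA'B}^D psi_D, where
   gamma_{AA'B}^D = eps^{DE} gamma_{AA'BE} *)
Definition nabla_unprimed (g : pt -> 'M[R]_4) (e : frame) (A A' : 'I_2)
    (psi : 'I_2 -> cfield) (B : 'I_2) : cfield :=
  fun x => dirder e A A' (psi B) x
    - \sum_D \sum_E eps D E * gamma g e A A' B E x * psi D x.

(* nabla_{AA'} W_{B'} for a matrix-valued spinor field W_{B'} *)
Definition nabla_primed (g : pt -> 'M[R]_4) (e : frame) (A A' : 'I_2) m n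
    (W : 'I_2 -> pt -> 'M[C]_(m, n)) (B' : 'I_2) : pt -> 'M[C]_(m, n) :=
  fun x => mxdirder e A A' (W B') x
    - \sum_D' \sum_E' (eps D' E' * gamma' g e A A' B' E' x) *: W D' x.

(* X_{ABCD} = 1/4 R_{AA'BB'CC'DD'} eps^{A'B'} eps^{C'D'} *)
Definition curvature_spinor (g : pt -> 'M[R]_4) (e : frame)
    (A B D E : 'I_2) : cfield :=
  fun x => 4^-1 * \sum_A' \sum_B' \sum_D' \sum_E' eps A' B' * eps D' E' *
    \sum_i \sum_j \sum_k \sum_l (riemann g i j k l x)%:C%C
      * e A A' x i 0 * e B B' x j 0 * e D D' x k 0 * e E E' x l 0.

(* The anti-self-dual Weyl spinor Psi_{ABCD} = X_{(ABCD)} of Penrose and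
   Rindler; the Ricci part of R_{abcd} does not contribute to X_{(ABCD)}. *)
Definition weyl_spinor (g : pt -> 'M[R]_4) (e : frame) (A B D E : 'I_2) :
    cfield :=
  fun x => let a := tnth [tuple A; B; D; E] in
    24^-1 * \sum_(s : 'S_4)
      curvature_spinor g e (a (s 0)) (a (s 1)) (a (s 2%:R)) (a (s 3%:R)) x.

Definition conformally_half_flat (U : set pt) (g : pt -> 'M[R]_4)
    (e : frame) : Prop :=
  forall x, U x -> forall A B D E, weyl_spinor g e A B D E x = 0.

(* psi_B = psi^A eps_{AB} *)
Definition lower (psi : 'I_2 -> cfield) (B : 'I_2) : cfield :=
  fun x => \sum_A psi A x * eps A B.

(* (a, b) |-> (- b^*, a^* ) on components with upper index *)
Definition dagger (psi : 'I_2 -> cfield) (A : 'I_2) : cfield :=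
  fun x => if A == 0 then - (psi 1 x)^* else (psi 0 x)^*.

(* iota^A and chi = o_A iota^A, for o given by its components o^A *)
Definition iota_of (o : 'I_2 -> cfield) : 'I_2 -> cfield := dagger o.

Definition chi_of (o : 'I_2 -> cfield) : cfield :=
  fun x => \sum_A lower o A x * iota_of o A x.

(* J e_{BB'} = J^{AA'}_{BB'} e_{AA'}, where
   J^{AA'}_{BB'} = i chi^{-1} (o^A iota_B + iota^A o_B) delta^{A'}_{B'} *)
Definition represents (U : set pt) (e : frame) (J : pt -> 'M[R]_4)
    (o : 'I_2 -> cfield) : Prop :=
  forall x, U x -> forall B B' : 'I_2,
    map_mx (real_complex R) (J x) *m e B B' x
    = \sum_A ('i%C / chi_of o x *
        (o A x * lower (iota_of o) B x + iota_of o A x * lower o B x))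
      *: e A B' x.

(* o^A nabla_{AA'} o_B = 0 *)
Definition parallel_scaling (U : set pt) (g : pt -> 'M[R]_4) (e : frame)
    (o : 'I_2 -> cfield) : Prop :=
  forall x, U x -> forall A' B : 'I_2,
    \sum_A o A x * nabla_unprimed g e A A' (lower o) B x = 0.

Definition adapted_spinor (U : set pt) (g J : pt -> 'M[R]_4) (e : frame)
    (o : 'I_2 -> cfield) : Prop :=
  [/\ forall A, csmooth U (o A), represents U e J o &
      parallel_scaling U g e o].

Definition r_of (phi : pt -> R) (o : 'I_2 -> cfield) : cfield :=
  fun x => (chi_of o x)^-1 * (phi x)%:C%C.

(* nabla_{A'} = iota^A nabla_{AA'} and nablat_{A'} = o^A nabla_{AA'} on
   matrices of scalar fields *)
Definition nabla (e : frame) (o : 'I_2 -> cfield) (A' : 'I_2) m n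
    (F : pt -> 'M[C]_(m, n)) : pt -> 'M[C]_(m, n) :=
  fun x => \sum_A iota_of o A x *: mxdirder e A A' F x.

Definition nablat (e : frame) (o : 'I_2 -> cfield) (A' : 'I_2) m n
    (F : pt -> 'M[C]_(m, n)) : pt -> 'M[C]_(m, n) :=
  fun x => \sum_A o A x *: mxdirder e A A' F x.

(* nabla^{A'} W_{A'} = eps^{A'B'} iota^A nabla_{AB'} W_{A'} *)
Definition nabla_div (g : pt -> 'M[R]_4) (e : frame) (o : 'I_2 -> cfield) m n
    (W : 'I_2 -> pt -> 'M[C]_(m, n)) : pt -> 'M[C]_(m, n) :=
  fun x => \sum_A' \sum_B' eps A' B' *:
    \sum_A iota_of o A x *: nabla_primed g e A B' W A' x.

(* nabla^{A'} (r J^{-1} nablat_{A'} J) = 0 *)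
Definition generalized_yang (U : set pt) (g : pt -> 'M[R]_4) (e : frame)
    (phi : pt -> R) (o : 'I_2 -> cfield) n (J : pt -> 'M[C]_n) : Prop :=
  forall x, U x ->
    nabla_div g e o
      (fun A' y => r_of phi o y *: (invmx (J y) *m nablat e o A' J y)) x = 0.

End Spinors.

Section Backlund.
Variable R : realType.
Notation pt := 'rV[R]_4.
Notation C := (R[i]).

Definition GL_valued (U : set pt) n (J : pt -> 'M[C]_n) : Prop :=
  cmxsmooth U J /\ (forall x, U x -> J x \in unitmx).

Definition yang_block k kt (A : 'M[C]_k) (At : 'M[C]_kt) (B : 'M[C]_(kt, k))
    (Bt : 'M[C]_(k, kt)) : 'M[C]_(k + kt) :=
  block_mx (invmx A - Bt *m At *m B) (- (Bt *m At)) (At *m B) At.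

Definition block_form (U : set pt) k kt (J : pt -> 'M[C]_(k + kt))
    (A : pt -> 'M[C]_k) (At : pt -> 'M[C]_kt) (B : pt -> 'M[C]_(kt, k))
    (Bt : pt -> 'M[C]_(k, kt)) : Prop :=
  [/\ GL_valued U A, GL_valued U At, cmxsmooth U B, cmxsmooth U Bt &
      forall x, U x -> J x = yang_block (A x) (At x) (B x) (Bt x)].

(* Jp is obtained from the matrix with blocks A, At, B, Bt by the Baecklund
   transformation, for some admissible choice of the potentials B', Bt'. *)
Definition backlund (U : set pt) (e : frame R) (phi : pt -> R)
    (o : 'I_2 -> pt -> C) k kt
    (A : pt -> 'M[C]_k) (At : pt -> 'M[C]_kt) (B : pt -> 'M[C]_(kt, k))
    (Bt : pt -> 'M[C]_(k, kt)) (Jp : pt -> 'M[C]_(kt + k)) : Prop :=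
  let r := r_of phi o in
  exists (B' : pt -> 'M[C]_(k, kt)) (Bt' : pt -> 'M[C]_(kt, k)),
    [/\ cmxsmooth U B', cmxsmooth U Bt',
        forall x, U x -> forall A' : 'I_2,
          r x *: (A x *m nablat e o A' Bt x *m At x) = nabla e o A' B' x,
        forall x, U x -> forall A' : 'I_2,
          r x *: (At x *m nabla e o A' B x *m A x) = nablat e o A' Bt' x &
        forall x, U x ->
          Jp x = yang_block ((r x)^-1 *: invmx (At x)) ((r x)^-1 *: invmx (A x))
                            (B' x) (Bt' x)].

End Backlund.

(* Main.v *)
Require Import Defs.
From HB Require Import structures.
From mathcomp Require Import all_boot all_order all_fingroup all_algebra.
From mathcomp Require Import complex ring.
From mathcomp Require Import all_classical all_reals all_analysis.

Set Implicit Arguments.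
Unset Strict Implicit.
Unset Printing Implicit Defensive.
Import Order.TTheory GRing.Theory Num.Theory.
Import numFieldNormedType.Exports.
Local Open Scope classical_set_scope.
Local Open Scope ring_scope.

(* Put X_A' = o^A e_AA' and Y_A' = iota^A e_AA', a null frame with
   g(X_A', Y_B') = chi eps_A'B'.  The scaling of o, its complex conjugate and
   d(phi^2 kappa) = 0 determine the Levi-Civita connection in this frame up to
   its part H_A'B' on primed spinors:
     nabla_v X_A' = a(v) X_A' + mu(v) Y_A' + H(v) X,
     nabla_v Y_A' = lambda(v) X_A' + b(v) Y_A' + H(v) Y,
   where a, mu vanish on X, b, lambda vanish on Y, and the remaining values are
   logarithmic derivatives of chi and phi.  Hence the X_A' and the Y_A' span
   involutive distributions, and for every function f
     nabla^A' (r nablat_A' f) + nablat^A' (r nabla_A' f) = 0.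
   The curvature computed from these coefficients has Psi(o,o,iota,iota) as its
   only possibly nonzero Weyl component, and this is a nonvanishing multiple of
   s = nabla^A' nablat_A' r.

   Conjugating r J^-1 nablat J by the lower unitriangular factor of the block
   form of J turns the generalized Yang equation into four equations
   E11 = E12 = E21 = E22 = 0.  For the transformed matrix the off-diagonal ones
   hold automatically, while E11' = E22 + s and E22' = E11 - s.  So J' is a
   solution exactly when s = 0.

   The calculus is carried out in the commutative ring of smooth functions on
   the domain, with its four commuting derivations. *)

(** * Levi-Civita connection over a differential ring *)

(** The diagonal blocks of [J'] explain the shift by [s]: the upper one carries [A'^-1 = r At], the
    lower one [At' = r^-1 A^-1], so their logarithmic derivatives, multiplied by [r], acquire [dr]
    and [-dr] times the identity, and the divergence of [dr] is [s]. Apart from this, the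
    transformation exchanges the diagonal blocks and turns the off-diagonal entries of the
    conjugated equation into gradients along [Y]. Such gradients are divergence-free because the
    zeroth-order coefficients of the divergence are also the structure functions of the bracket of
    [Y0] and [Y1]. The same [r] governs the curvature: with [r = phi / chi], the values of [a] and
    [b] are derivatives of log [chi], those of [mu] and [lambda] derivatives of log [phi], up to
    sign, and the curvature differentiates them once more. The algebra runs over an arbitrary
    commutative ring, where elements need not be invertible; hence one half and all inverses are
    named elements with a defining equation, which [ring] can also use as a rewriting rule. Analysis
    enters through the Leibniz rule, the symmetry of mixed partials and the closure of smooth
    functions under the operations used. *)

Section Connection.
Variables (S : comNzRingType) (d : 'I_4 -> {additive S -> S}).
Hypothesis dM : forall i x y, d i (x * y) = d i x * y + x * d i y.
Hypothesis dC : forall i j x, d i (d j x) = d j (d i x).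
Variables (half : S) (g gi : 'M[S]_4).
Hypotheses (half2 : half + half = 1) (g_sym : g^T = g) (ggi : g *m gi = 1%:M).

Definition der (u : 'cV[S]_4) (f : S) : S := \sum_i u i 0 * d i f.
Definition ip (u v : 'cV[S]_4) : S := (u^T *m g *m v) 0 0.
Definition chr (k i j : 'I_4) : S :=
  half * \sum_l gi k l * (d i (g j l) + d j (g i l) - d l (g i j)).
Definition chrm (i : 'I_4) : 'M[S]_4 := \matrix_(k, j) chr k i j.
Definition nabi i (w : 'cV[S]_4) : 'cV[S]_4 := map_mx (d i) w + chrm i *m w.
Definition nab (u w : 'cV[S]_4) : 'cV[S]_4 := \sum_i u i 0 *: nabi i w.
(** The Lie bracket, written through the connection so that frame computations need connection
    coefficients only; absence of torsion makes it the true commutator ([brkE], [der_brk]). *)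
Definition brk (u v : 'cV[S]_4) : 'cV[S]_4 := nab u v - nab v u.
Definition curv (u v w : 'cV[S]_4) : 'cV[S]_4 :=
  nab u (nab v w) - nab v (nab u w) - nab (brk u v) w.
Definition rm (a b c e : 'I_4) : S :=
  d a (chr e b c) - d b (chr e a c)
  + \sum_f (chr e a f * chr f b c - chr e b f * chr f a c).

Lemma map_derM m n p i (F : 'M[S]_(m, n)) (G : 'M[S]_(n, p)) :
  map_mx (d i) (F *m G) = map_mx (d i) F *m G + F *m map_mx (d i) G.
Proof.
apply/matrixP => a b; rewrite !mxE raddf_sum -big_split /=.
by apply: eq_bigr => c _; rewrite dM !mxE.
Qed.

Lemma map_derZ m n i (a : S) (F : 'M[S]_(m, n)) :
  map_mx (d i) (a *: F) = d i a *: F + a *: map_mx (d i) F.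
Proof. by apply/matrixP => p q; rewrite !mxE dM. Qed.

Lemma derD u f h : der u (f + h) = der u f + der u h.
Proof. by rewrite -big_split; apply: eq_bigr => i _; rewrite raddfD mulrDr. Qed.

Lemma derN u f : der u (- f) = - der u f.
Proof. by rewrite -sumrN; apply: eq_bigr => i _; rewrite raddfN mulrN. Qed.

Lemma derM u f h : der u (f * h) = der u f * h + f * der u h.
Proof.
rewrite /der mulr_suml mulr_sumr -big_split; apply: eq_bigr => i _ /=.
by rewrite dM; ring.
Qed.

Lemma derDl u v f : der (u + v) f = der u f + der v f.
Proof. by rewrite -big_split; apply: eq_bigr => i _; rewrite mxE mulrDl. Qed.

Lemma derZl a u f : der (a *: u) f = a * der u f.
Proof. by rewrite mulr_sumr; apply: eq_bigr => i _; rewrite mxE mulrA. Qed.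

Lemma ipDl u v w : ip (u + v) w = ip u w + ip v w.
Proof. by rewrite /ip linearD /= !mulmxDl mxE. Qed.
Lemma ipDr u v w : ip w (u + v) = ip w u + ip w v.
Proof. by rewrite /ip mulmxDr mxE. Qed.
Lemma ipZl a u w : ip (a *: u) w = a * ip u w.
Proof. by rewrite /ip linearZ /= -!scalemxAl mxE. Qed.
Lemma ipZr a u w : ip w (a *: u) = a * ip w u.
Proof. by rewrite /ip -!scalemxAr mxE. Qed.
Lemma ipC u v : ip u v = ip v u.
Proof. by rewrite /ip -[in LHS]g_sym -[v in LHS]trmxK -!trmx_mul mxE mulmxA. Qed.

Lemma nabDr u v w : nab u (v + w) = nab u v + nab u w.
Proof.
rewrite -big_split; apply: eq_bigr => i _ /=.
by rewrite /nabi map_mxD mulmxDr addrACA scalerDr.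
Qed.

Lemma nabZr u a w : nab u (a *: w) = der u a *: w + a *: nab u w.
Proof.
rewrite /der /nab scaler_suml scaler_sumr -big_split; apply: eq_bigr => i _ /=.
rewrite /nabi map_derZ -scalemxAr !scalerDr !scalerA addrA.
by rewrite [a * _]mulrC.
Qed.

Lemma nabDl u v w : nab (u + v) w = nab u w + nab v w.
Proof. by rewrite -big_split; apply: eq_bigr => i _; rewrite mxE scalerDl. Qed.
Lemma nabZl a u w : nab (a *: u) w = a *: nab u w.
Proof. by rewrite scaler_sumr; apply: eq_bigr => i _; rewrite mxE scalerA. Qed.

(** With the upper index lowered, [gi] disappears and Christoffel symbols of the first kind
    remain. *)
Lemma g_chrm i : g *m chrm i
  = half *: \matrix_(j, k) (d i (g k j) + d k (g i j) - d j (g i k)).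
Proof.
rewrite -[RHS]mul1mx -ggi -mulmxA; congr (_ *m _).
apply/matrixP => a b; rewrite !mxE /chr mulr_sumr.
by apply: eq_bigr => l _; rewrite !mxE; ring.
Qed.

Lemma gE i j : g i j = g j i. Proof. by rewrite -{1}g_sym mxE. Qed.

(** Metric compatibility: adding a first-kind symbol to its transpose cancels the antisymmetric part
    and doubles the derivative of [g]. *)
Lemma dg i : map_mx (d i) g = (chrm i)^T *m g + g *m chrm i.
Proof.
rewrite -{2}g_sym -trmx_mul g_chrm linearZ /= -scalerDr.
apply/matrixP => a b; rewrite !mxE (gE b a) (gE i a) (gE i b).
rewrite -[LHS]mul1r -half2; ring.
Qed.

Lemma chr_sym k i j : chr k i j = chr k j i.
Proof.
rewrite /chr; congr (_ * _); apply: eq_bigr => l _.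
by rewrite (gE i j) [d i _ + _]addrC.
Qed.

Lemma der_ip u v w : der u (ip v w) = ip (nab u v) w + ip v (nab u w).
Proof.
have hi i : d i (ip v w) = ip (nabi i v) w + ip v (nabi i w).
  have -> : d i (ip v w) = map_mx (d i) (v^T *m g *m w) 0 0 by rewrite mxE.
  rewrite !map_derM dg -map_trmx /ip /nabi [(map_mx _ _ + _)^T]linearD /= trmx_mul.
  rewrite !(mulmxDl, mulmxDr) !mulmxA !mxE; ring.
rewrite /der; under eq_bigr => i _ do rewrite hi mulrDr -ipZl -ipZr.
rewrite big_split /=; congr (_ + _).
  by rewrite /ip /nab linear_sum /= !mulmx_suml summxE.
by rewrite /ip /nab mulmx_sumr summxE.
Qed.

Lemma derE u m n (F : 'M[S]_(m, n)) :
  map_mx (der u) F = \sum_i u i 0 *: map_mx (d i) F.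
Proof.
by apply/matrixP => a b; rewrite mxE summxE; apply: eq_bigr => i _; rewrite !mxE.
Qed.

Lemma brkE u v : brk u v = map_mx (der u) v - map_mx (der v) u.
Proof.
have h u' v' : nab u' v' = map_mx (der u') v'
    + \col_k \sum_i \sum_j chr k i j * u' i 0 * v' j 0.
  rewrite derE; apply/matrixP => k z; rewrite ord1 !(mxE, summxE) -big_split.
  apply: eq_bigr => i _ /=; rewrite !mxE mulrDr; congr (_ + _).
  by rewrite mulr_sumr; apply: eq_bigr => j _; rewrite !mxE; ring.
rewrite /brk !h opprD addrACA -[RHS]addr0; congr (_ + _).
apply/eqP; rewrite subr_eq0; apply/eqP; apply/matrixP => k z; rewrite !mxE.
rewrite exchange_big; apply: eq_bigr => i _; apply: eq_bigr => j _ /=.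
by rewrite chr_sym; ring.
Qed.

(** The second-order parts of both compositions agree because the coordinate derivations commute. *)
Lemma der_brk u v f : der (brk u v) f = der u (der v f) - der v (der u f).
Proof.
have h u' v' : der u' (der v' f) =
    der (map_mx (der u') v') f + \sum_i \sum_j u' i 0 * v' j 0 * d i (d j f).
  rewrite {2 3}/der /der; under eq_bigr => i _ do rewrite raddf_sum mulr_sumr.
  have -> : \sum_i (map_mx (fun f0 => \sum_j u' j 0 * d j f0) v') i 0 * d i f
     = \sum_i \sum_j u' i 0 * d i (v' j 0) * d j f.
    rewrite [RHS]exchange_big; apply: eq_bigr => i _ /=.
    by rewrite mxE mulr_suml.
  rewrite -big_split; apply: eq_bigr => i _; rewrite -big_split.
  by apply: eq_bigr => j _ /=; rewrite dM; ring.
have derBl u' v' : der (u' - v') f = der u' f - der v' f.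
  by rewrite -[- v']scaleN1r derDl derZl mulN1r.
rewrite brkE derBl !h.
rewrite [X in _ = _ - (_ + X)](_ : _ =
  \sum_i \sum_j u i 0 * v j 0 * d i (d j f)); first by ring.
rewrite exchange_big; apply: eq_bigr => i _; apply: eq_bigr => j _ /=.
by rewrite dC; ring.
Qed.

Lemma nabi_curv i j w : nabi i (nabi j w) - nabi j (nabi i w)
  = (\matrix_(e, c) rm i j c e) *m w.
Proof.
rewrite /nabi !map_mxD !map_derM !mulmxDr !mulmxA.
rewrite (_ : map_mx (d i) (map_mx (d j) w) = map_mx (d j) (map_mx (d i) w)); last first.
  by apply/matrixP => a b; rewrite !mxE dC.
rewrite (_ : (\matrix_(e, c) _) = map_mx (d i) (chrm j) - map_mx (d j) (chrm i)
   + (chrm i *m chrm j - chrm j *m chrm i)); last first.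
  apply/matrixP => a b; rewrite !mxE /rm -sumrB; congr (_ + _).
  by apply: eq_bigr => f _; rewrite !mxE.
rewrite !mulmxDl !mulNmx -!mulmxA; apply/matrixP => a b; rewrite !mxE; ring.
Qed.

(** The derivatives of [u] and [v] produced by the iterated connection are exactly those of the
    bracket term, so only coordinate commutators, that is the Riemann tensor, survive. *)
Lemma curvE u v w : curv u v w = \sum_i \sum_j (u i 0 * v j 0) *:
  ((\matrix_(e, c) rm i j c e) *m w).
Proof.
have nab_sum u' (F : 'I_4 -> 'cV[S]_4) : nab u' (\sum_i F i) = \sum_i nab u' (F i).
  have n0 : nab u' 0 = 0 by apply: (addrI (nab u' 0)); rewrite -nabDr !addr0.
  by apply: (big_morph (nab u')) => // ??; rewrite nabDr.
have h u' v' : nab u' (nab v' w) = nab (map_mx (der u') v') w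
    + \sum_i \sum_j (u' i 0 * v' j 0) *: nabi i (nabi j w).
  rewrite [nab v' w]/nab nab_sum [X in _ + X]exchange_big [nab (map_mx _ _) w]/nab -big_split.
  apply: eq_bigr => j _ /=. rewrite nabZr mxE; congr (_ + _).
  by rewrite /nab scaler_sumr; apply: eq_bigr => i _; rewrite scalerA mulrC.
have nabBl u' v' : nab (u' - v') w = nab u' w - nab v' w.
  by rewrite -[- v']scaleN1r nabDl nabZl scaleN1r.
rewrite /curv brkE nabBl !h.
transitivity ((\sum_i \sum_j (u i 0 * v j 0) *: nabi i (nabi j w))
  - (\sum_i \sum_j (v i 0 * u j 0) *: nabi i (nabi j w))).
  by apply/matrixP => a b; rewrite !mxE; ring.
rewrite [X in _ - X]exchange_big -sumrB; apply: eq_bigr => i _.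
rewrite -sumrB; apply: eq_bigr => j _.
by rewrite -nabi_curv scalerBr [v _ _ * _]mulrC.
Qed.

Lemma ip_curv u v w z : ip (curv u v w) z =
  \sum_i \sum_j \sum_k \sum_l (\sum_f rm i j k f * g f l)
    * u i 0 * v j 0 * w k 0 * z l 0.
Proof.
rewrite curvE.
have ip_sum (F : 'I_4 -> 'cV[S]_4) : ip (\sum_i F i) z = \sum_i ip (F i) z.
  by rewrite /ip linear_sum /= !mulmx_suml summxE.
rewrite ip_sum; apply: eq_bigr => i _; rewrite ip_sum; apply: eq_bigr => j _.
rewrite ipZl /ip trmx_mul -!mulmxA mxE mulr_sumr; apply: eq_bigr => k _.
rewrite mulmxA !mxE !mulr_sumr; apply: eq_bigr => l _.
rewrite !mxE mulr_suml !mulr_sumr !mulr_suml; apply: eq_bigr => f _.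
rewrite !mxE; ring.
Qed.

End Connection.

(** * The null frame of a complex structure *)

Section AdaptedFrame.
Variables (S : comNzRingType) (V : lmodType S).
Variables (D : V -> S -> S) (N : V -> V -> V) (ip : V -> V -> S) (half : S).
Hypotheses (half2 : half + half = 1)
  (DD : forall u f h, D u (f + h) = D u f + D u h)
  (DM : forall u f h, D u (f * h) = D u f * h + f * D u h)
  (DDl : forall u v f, D (u + v) f = D u f + D v f)
  (DZl : forall a u f, D (a *: u) f = a * D u f)
  (ipDl : forall u v w, ip (u + v) w = ip u w + ip v w)
  (ipZl : forall a u w, ip (a *: u) w = a * ip u w)
  (ipC : forall u v, ip u v = ip v u)
  (NDr : forall u v w, N u (v + w) = N u v + N u w)
  (NZr : forall u a w, N u (a *: w) = D u a *: w + a *: N u w)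
  (NDl : forall u v w, N (u + v) w = N u w + N v w)
  (NZl : forall a u w, N (a *: u) w = a *: N u w)
  (D_ip : forall u v w, D u (ip v w) = ip (N u v) w + ip v (N u w)).
Let brk u v := N u v - N v u.
Hypothesis D_brk : forall u v f, D (brk u v) f = D u (D v f) - D v (D u f).

Let R u v w := N u (N v w) - N v (N u w) - N (brk u v) w.

Lemma D0 u : D u 0 = 0.
Proof. by apply: (addrI (D u 0)); rewrite -DD !addr0. Qed.
Lemma D1 u : D u 1 = 0.
Proof. by apply: (addrI (D u 1)); rewrite addr0 -[in RHS](mul1r 1) DM; ring. Qed.
Lemma DN u f : D u (- f) = - D u f.
Proof. by apply: (addrI (D u f)); rewrite -DD !subrr D0. Qed.
Lemma Dinv u f fi : f * fi = 1 -> D u fi = - fi * fi * D u f.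
Proof.
move=> h; have : D u f * fi + f * D u fi = 0 by rewrite -DM h D1.
move/(congr1 (fun t => fi * t)); rewrite mulr0 mulrDr mulrA => e.
have -> : D u fi = f * fi * D u fi by rewrite h mul1r.
transitivity (- (fi * D u f * fi) + (fi * D u f * fi + fi * (f * D u fi))).
  by ring.
by rewrite e; ring.
Qed.

Lemma DNl u f : D (- u) f = - D u f.
Proof. by rewrite -scaleN1r DZl mulN1r. Qed.
Lemma pairDr w u v : ip w (u + v) = ip w u + ip w v.
Proof. by rewrite ipC ipDl !(ipC w). Qed.
Lemma pairZr a u w : ip w (a *: u) = a * ip w u.
Proof. by rewrite ipC ipZl (ipC w). Qed.
Lemma ipNl u w : ip (- u) w = - ip u w.
Proof. by rewrite -scaleN1r ipZl mulN1r. Qed.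
Lemma pairNr w u : ip w (- u) = - ip w u.
Proof. by rewrite ipC ipNl (ipC w). Qed.
Lemma NN u w : N u (- w) = - N u w.
Proof.
have e0 : N u 0 = 0 by apply: (addrI (N u 0)); rewrite -NDr !addr0.
by apply: (addrI (N u w)); rewrite -NDr !subrr e0.
Qed.
Lemma NNl u w : N (- u) w = - N u w.
Proof. by rewrite -scaleN1r NZl scaleN1r. Qed.

Lemma R_antisym u v w : R v u w = - R u v w.
Proof.
have e : brk v u = - brk u v by rewrite /brk opprB.
by rewrite /R e NNl opprK !opprB addrC.
Qed.

(** Apply the commutator identity [D_brk] to the scalar [ip w z] and expand it by metric
    compatibility. *)
Lemma R_skew u v w z : ip (R u v w) z = - ip w (R u v z).
Proof.
have := D_brk u v (ip w z); rewrite !D_ip !DD !D_ip /R !(ipDl, pairDr, ipNl, pairNr).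
move=> /eqP; rewrite -subr_eq0 => /eqP h.
apply/eqP; rewrite -subr_eq0 opprK; apply/eqP; rewrite -[RHS]oppr0 -h; ring.
Qed.

Variables (X0 X1 Y0 Y1 : V) (chi chii : S).
Hypotheses (chiV : chi * chii = 1)
  (x00 : ip X0 X0 = 0) (x01 : ip X0 X1 = 0) (x11 : ip X1 X1 = 0)
  (y00 : ip Y0 Y0 = 0) (y01 : ip Y0 Y1 = 0) (y11 : ip Y1 Y1 = 0)
  (xy00 : ip X0 Y0 = 0) (xy11 : ip X1 Y1 = 0)
  (xy01 : ip X0 Y1 = chi) (xy10 : ip X1 Y0 = - chi)
  (nondeg : forall w, ip w X0 = 0 -> ip w X1 = 0 -> ip w Y0 = 0 ->
     ip w Y1 = 0 -> w = 0).

(** The coefficients are read off by pairing with the frame, whose nonzero products are [chi] and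
    [- chi]. The pairings of [N v X0] with [Y1] and of [N v X1] with [Y0] mix [a] and [h01], which
    are separated by difference and sum; hence [half]. *)
Definition co_a v := chii * half * (ip (N v X0) Y1 - ip (N v X1) Y0).
Definition co_b v := chii * half * (ip (N v Y1) X0 - ip (N v Y0) X1).
Definition co_mu v := - chii * ip (N v X0) X1.
Definition co_lam v := chii * ip (N v Y0) Y1.
Definition co_h00 v := chii * ip (N v X0) Y0.
Definition co_h11 v := chii * ip (N v X1) Y1.
Definition co_h01 v := chii * half * (ip (N v X0) Y1 + ip (N v X1) Y0).

Let gram := (x00, x01, x11, y00, y01, y11, xy00, xy11, xy01, xy10,
  (ipC X1 X0, ipC Y1 Y0, ipC Y0 X0, ipC Y1 X1, ipC Y1 X0, ipC Y0 X1)).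

Lemma halfE x : x = half * x + half * x.
Proof. by rewrite -mulrDl half2 mul1r. Qed.

Lemma D_chi v : D v chi = ip (N v X0) Y1 + ip (N v Y1) X0.
Proof. by rewrite -xy01 D_ip (ipC X0). Qed.
Lemma D_chiN v : - D v chi = ip (N v X1) Y0 + ip (N v Y0) X1.
Proof. by rewrite -DN -xy10 D_ip (ipC X1). Qed.

Lemma co_ab v : co_a v + co_b v = chii * D v chi.
Proof.
have h := D_chi v; have h' := D_chiN v; rewrite /co_a /co_b [RHS]halfE {1}h.
rewrite -[D v chi in RHS]opprK h'; ring.
Qed.

Lemma null_nab v w : ip w w = 0 -> ip (N v w) w = 0.
Proof.
move=> h; have := D_ip v w w; rewrite h D0 (ipC w) => e.
by rewrite [LHS]halfE -mulrDr -e mulr0.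
Qed.

Lemma orth_nab v w z : ip w z = 0 -> ip (N v z) w = - ip (N v w) z.
Proof.
move=> h; have := D_ip v w z; rewrite h D0 (ipC w) => e.
by apply/eqP; rewrite -addr_eq0 addrC -e.
Qed.

Lemma frame_ext w z : ip w X0 = ip z X0 -> ip w X1 = ip z X1 ->
  ip w Y0 = ip z Y0 -> ip w Y1 = ip z Y1 -> w = z.
Proof.
move=> h1 h2 h3 h4; apply/eqP; rewrite -subr_eq0; apply/eqP.
by apply: nondeg; rewrite ipDl ipNl ?h1 ?h2 ?h3 ?h4 subrr.
Qed.

Lemma N_Y1_X0 v : ip (N v Y1) X0 = D v chi - ip (N v X0) Y1.
Proof. by rewrite D_chi addrC addKr. Qed.
Lemma N_X1_Y0 v : ip (N v X1) Y0 = - D v chi - ip (N v Y0) X1.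
Proof. by rewrite D_chiN addrK. Qed.

Let orth v := (orth_nab v xy00, orth_nab v xy11, orth_nab v x01,
  orth_nab v y01, N_Y1_X0 v, N_X1_Y0 v).

Ltac frame_comp v := rewrite /co_a /co_b /co_mu /co_lam /co_h01 /co_h00 /co_h11;
  apply: frame_ext; rewrite !(ipDl, ipNl, ipZl) ?gram ?null_nab // ?orth;
  try (by ring: chiV); rewrite [LHS]halfE; ring: chiV.

Lemma N_X0 v : N v X0 = co_a v *: X0 + co_mu v *: Y0
  + co_h01 v *: X0 - co_h00 v *: X1.
Proof. by frame_comp v. Qed.

Lemma N_X1 v : N v X1 = co_a v *: X1 + co_mu v *: Y1
  + co_h11 v *: X0 - co_h01 v *: X1.
Proof. by frame_comp v. Qed.

Lemma N_Y0 v : N v Y0 = co_lam v *: X0 + co_b v *: Y0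
  + co_h01 v *: Y0 - co_h00 v *: Y1.
Proof. by frame_comp v. Qed.

Lemma N_Y1 v : N v Y1 = co_lam v *: X1 + co_b v *: Y1
  + co_h11 v *: Y0 - co_h01 v *: Y1.
Proof. by frame_comp v. Qed.

Let NF v := (N_X0 v, N_X1 v, N_Y0 v, N_Y1 v).
Let lin := (NDr, NN, NZr, ipDl, ipNl, ipZl).

(** Skew contraction over the primed indices removes the primed part [H] of the connection. What
    remains here and in the next three lemmas is the curvature [d w + w w] of the unprimed
    connection matrix with entries [a], [mu], [lambda], [b]. *)
Lemma K_aE u v : half * (ip (R u v X0) Y1 - ip (R u v X1) Y0) =
  chi * (D u (co_a v) - D v (co_a u) + co_mu v * co_lam u
     - co_mu u * co_lam v - co_a (brk u v)).
Proof.
rewrite /R !NF !lin !NF !lin !gram.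
rewrite [RHS]halfE; ring.
Qed.
Lemma K_muE u v : half * (ip (R u v X0) X1 - ip (R u v X1) X0) =
  - chi * (D u (co_mu v) - D v (co_mu u) + co_a v * co_mu u - co_a u * co_mu v
     + co_mu v * co_b u - co_mu u * co_b v - co_mu (brk u v)).
Proof.
rewrite /R !NF !lin !NF !lin !gram.
rewrite [RHS]halfE; ring.
Qed.
Lemma K_lamE u v : half * (ip (R u v Y0) Y1 - ip (R u v Y1) Y0) =
  chi * (D u (co_lam v) - D v (co_lam u) + co_lam v * co_a u - co_lam u * co_a v
     + co_b v * co_lam u - co_b u * co_lam v - co_lam (brk u v)).
Proof.
rewrite /R !NF !lin !NF !lin !gram.
rewrite [RHS]halfE; ring.
Qed.
Lemma K_bE u v : half * (ip (R u v Y0) X1 - ip (R u v Y1) X0) =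
  - chi * (D u (co_b v) - D v (co_b u) + co_lam v * co_mu u
     - co_lam u * co_mu v - co_b (brk u v)).
Proof.
rewrite /R !NF !lin !NF !lin !gram.
rewrite [RHS]halfE; ring.
Qed.

Lemma co_aD u v : co_a (u + v) = co_a u + co_a v.
Proof. by rewrite /co_a !NDl !ipDl; ring. Qed.
Lemma co_aZ a u : co_a (a *: u) = a * co_a u.
Proof. by rewrite /co_a !NZl !ipZl; ring. Qed.
Lemma co_aN u : co_a (- u) = - co_a u.
Proof. by rewrite -scaleN1r co_aZ mulN1r. Qed.
Lemma co_bD u v : co_b (u + v) = co_b u + co_b v.
Proof. by rewrite /co_b !NDl !ipDl; ring. Qed.
Lemma co_bZ a u : co_b (a *: u) = a * co_b u.
Proof. by rewrite /co_b !NZl !ipZl; ring. Qed.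
Lemma co_bN u : co_b (- u) = - co_b u.
Proof. by rewrite -scaleN1r co_bZ mulN1r. Qed.
Lemma co_muD u v : co_mu (u + v) = co_mu u + co_mu v.
Proof. by rewrite /co_mu !NDl !ipDl; ring. Qed.
Lemma co_muZ a u : co_mu (a *: u) = a * co_mu u.
Proof. by rewrite /co_mu !NZl !ipZl; ring. Qed.
Lemma co_muN u : co_mu (- u) = - co_mu u.
Proof. by rewrite -scaleN1r co_muZ mulN1r. Qed.
Lemma co_lamD u v : co_lam (u + v) = co_lam u + co_lam v.
Proof. by rewrite /co_lam !NDl !ipDl; ring. Qed.
Lemma co_lamZ a u : co_lam (a *: u) = a * co_lam u.
Proof. by rewrite /co_lam !NZl !ipZl; ring. Qed.
Lemma co_lamN u : co_lam (- u) = - co_lam u.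
Proof. by rewrite -scaleN1r co_lamZ mulN1r. Qed.

Let colin := (co_aD, co_bD, co_muD, co_lamD, (co_aN, co_bN, co_muN, co_lamN),
  (co_aZ, co_bZ, co_muZ, co_lamZ)).
Let Dlin := (DDl, DNl, DZl).

(** * Complex conjugation exchanges the two distributions *)

Section Conjugation.
Variables (cs : S -> S) (cj : V -> V).
Hypotheses (csB : forall a b, cs (a - b) = cs a - cs b)
  (csM : forall a b, cs (a * b) = cs a * cs b)
  (cs_ip : forall u v, cs (ip u v) = ip (cj u) (cj v))
  (cj_N : forall u v, cj (N u v) = N (cj u) (cj v))
  (cjX0 : cj X0 = Y1) (cjX1 : cj X1 = - Y0) (cjY0 : cj Y0 = - X1) (cjY1 : cj Y1 = X0)
  (cs_chii : cs chii = chii) (cs_half : cs half = half).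

Lemma cs0 : cs 0 = 0.
Proof. by rewrite -{1}(subrr 0) csB subrr. Qed.

Lemma cs_a v : cs (co_a v) = co_b (cj v).
Proof.
rewrite /co_a /co_b !(csB, csM) !cs_ip !cj_N cs_chii cs_half.
by rewrite cjX0 cjX1 cjY0 cjY1 NN ipNl pairNr opprK.
Qed.

Lemma cs_mu v : cs (co_mu v) = - co_lam (cj v).
Proof.
rewrite /co_mu /co_lam !mulNr -[- _]add0r csB cs0 add0r csM cs_ip cj_N cs_chii.
by rewrite cjX0 cjX1 pairNr (orth_nab _ y01); ring.
Qed.

(** The connection is real and conjugation maps the [X] to the [Y] up to order and sign, so it
    carries [a] to [b] and [mu] to [- lambda]: the scaling of [o] also constrains the derivatives of
    [iota]. *)
Lemma conj_scaling : co_a X0 = 0 -> co_a X1 = 0 -> co_mu X0 = 0 -> co_mu X1 = 0 ->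
  [/\ co_b Y0 = 0, co_b Y1 = 0, co_lam Y0 = 0 & co_lam Y1 = 0].
Proof.
move=> a0 a1 m0 m1; have := (cs_a X0, cs_a X1, (cs_mu X0, cs_mu X1)).
rewrite a0 a1 m0 m1 cs0 cjX0 cjX1 co_bN co_lamN => -[[h1 h2] [h3 h4]]; split=> //.
- by rewrite -[LHS]opprK -h2 oppr0.
- by rewrite -[LHS]opprK -h4.
- by rewrite -[LHS]opprK -h3 oppr0.
Qed.

End Conjugation.

(** * Comparison of the null frame with the given spin frame *)

Section SpinFrame.
Variables (e00 e01 e10 e11 : V) (o0 o1 i0 i1 : S).
Hypotheses (X0E : X0 = o0 *: e00 + o1 *: e10) (X1E : X1 = o0 *: e01 + o1 *: e11)
  (Y0E : Y0 = i0 *: e00 + i1 *: e10) (Y1E : Y1 = i0 *: e01 + i1 *: e11).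
Hypotheses (g00_00 : ip e00 e00 = 0) (g00_01 : ip e00 e01 = 0)
  (g00_10 : ip e00 e10 = 0) (g00_11 : ip e00 e11 = 1) (g01_01 : ip e01 e01 = 0)
  (g01_10 : ip e01 e10 = - 1) (g01_11 : ip e01 e11 = 0) (g10_10 : ip e10 e10 = 0)
  (g10_11 : ip e10 e11 = 0) (g11_11 : ip e11 e11 = 0).

Let gE := (g00_00, g00_01, g00_10, g00_11, g01_01, g01_10, g01_11, g10_10, g10_11,
  g11_11, (ipC e01 e00, ipC e10 e00, ipC e11 e00, ipC e10 e01, ipC e11 e01, ipC e11 e10)).

Lemma chi_spin : chi = o0 * i1 - o1 * i0.
Proof. by rewrite -xy01 X0E Y1E !(ipDl, pairDr, ipZl, pairZr) !gE; ring. Qed.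

Let orthe u := (orth_nab u g00_01, orth_nab u g00_10, orth_nab u g01_11, orth_nab u g10_11).
Let nullE u := (null_nab u g00_00, null_nab u g01_01, null_nab u g10_10, null_nab u g11_11).

Lemma orth_nab_11_00 u : ip (N u e11) e00 = - ip (N u e00) e11.
Proof.
have := D_ip u e00 e11; rewrite g00_11 D1 (ipC e00) => e.
by apply/eqP; rewrite -addr_eq0 addrC -e.
Qed.
Lemma orth_nab_10_01 u : ip (N u e10) e01 = - ip (N u e01) e10.
Proof.
have := D_ip u e01 e10; rewrite g01_10 DN D1 oppr0 (ipC e01) => e.
by apply/eqP; rewrite -addr_eq0 addrC -e.
Qed.
Let oE u := (orthe u, nullE u, orth_nab_11_00 u, orth_nab_10_01 u).
Let ipE := (ipDl, pairDr, ipZl, pairZr, ipNl, pairNr).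

Ltac spin_calc := rewrite ?X0E ?X1E ?Y0E ?Y1E !NDr !NZr !ipE ?oE ?gE.

(** Passing from [e] to [X], [Y] changes the basis in the unprimed index only, so the primed
    connection coefficients are the same in both frames. Multiplying by [chi * chii], with [chi]
    expanded as a determinant, makes this a polynomial identity. *)
Lemma h00_spin u : half * (ip (N u e00) e10 - ip (N u e10) e00) = co_h00 u.
Proof.
rewrite -[LHS]mul1r -chiV {1}chi_spin /co_h00 [RHS]halfE; spin_calc; ring.
Qed.
Lemma h11_spin u : half * (ip (N u e01) e11 - ip (N u e11) e01) = co_h11 u.
Proof.
rewrite -[LHS]mul1r -chiV {1}chi_spin /co_h11 [RHS]halfE; spin_calc; ring.
Qed.
Lemma h01_spin u : half * (ip (N u e00) e11 - ip (N u e10) e01) = co_h01 u.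
Proof.
rewrite -[LHS]mul1r -chiV {1}chi_spin /co_h01; spin_calc; ring.
Qed.
Lemma h10_spin u : half * (ip (N u e01) e10 - ip (N u e11) e00) = co_h01 u.
Proof. by rewrite -h01_spin oE orth_nab_10_01; ring. Qed.

Let ga (ea0 ea1 eb0 eb1 : V) u := half * (ip (N u ea0) eb1 - ip (N u ea1) eb0).

(** The two hypotheses are the components of the derivative of [o_B] along [u]; [a] is their
    contraction with [iota] and [mu] that with [o], up to the factors [chii] and [- chii]. *)
Lemma spin_parallel u :
  - D u o1 + ga e00 e01 e10 e11 u * o1 + ga e00 e01 e00 e01 u * o0 = 0 ->
  D u o0 + ga e10 e11 e10 e11 u * o1 + ga e10 e11 e00 e01 u * o0 = 0 ->
  co_a u = 0 /\ co_mu u = 0.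
Proof.
move=> h0 h1; split.
  transitivity (chii * (i1 * 0 + i0 * 0)); last by ring.
  rewrite -{1}h1 -h0 /ga /co_a -mulrA; congr (chii * _); spin_calc.
  by rewrite [D u o0 in RHS]halfE [D u o1 in RHS]halfE; ring.
rewrite /co_mu; transitivity (- chii * (o1 * 0 + o0 * 0)); last by ring.
rewrite -{1}h1 -h0 /ga; congr (- chii * _); rewrite [LHS]halfE; spin_calc.
by rewrite [D u o0 in RHS]halfE [D u o1 in RHS]halfE; ring.
Qed.

End SpinFrame.

(** * Consequences of the closedness of the rescaled fundamental form *)

Section Kaehler.
Variables (kf : V -> V -> S) (I phi phii : S).
Hypotheses (I2 : I * I = - 1) (DI : forall u, D u I = 0) (phiV : phi * phii = 1)
  (kfC : forall v w, kf v w = - kf w v)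
  (kX0 : forall w, kf X0 w = - (I * phi * phi * ip X0 w))
  (kX1 : forall w, kf X1 w = - (I * phi * phi * ip X1 w))
  (kY0 : forall w, kf Y0 w = I * phi * phi * ip Y0 w)
  (kY1 : forall w, kf Y1 w = I * phi * phi * ip Y1 w)
  (kclosed : forall u v w, D u (kf v w) + D v (kf w u) + D w (kf u v)
    - kf (brk u v) w - kf (brk v w) u - kf (brk w u) v = 0)
  (aX0 : co_a X0 = 0) (aX1 : co_a X1 = 0)
  (muX0 : co_mu X0 = 0) (muX1 : co_mu X1 = 0)
  (bY0 : co_b Y0 = 0) (bY1 : co_b Y1 = 0)
  (lamY0 : co_lam Y0 = 0) (lamY1 : co_lam Y1 = 0).

Lemma D_chi_co v : D v chi = chi * (co_a v + co_b v).
Proof. by rewrite co_ab mulrA chiV mul1r. Qed.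
Let kE := (aX0, aX1, muX0, muX1, (bY0, bY1, lamY0, lamY1)).

Lemma half_cancel (a : S) : a + a = 0 -> a = 0.
Proof. by move=> h; rewrite [a]halfE -mulrDr h mulr0. Qed.

Lemma closed_cancel (m t : S) : I * chi * phi * (phi * m + t) = 0 -> m = - phii * t.
Proof.
move=> h; have e : chii * phii * phii * I * (I * chi * phi * (phi * m + t)) = 0.
  by rewrite h mulr0.
by apply/eqP; rewrite -subr_eq0 -[_ - _]opprK -oppr0 -e; apply/eqP; ring: I2 chiV phiV.
Qed.

Ltac closed_calc u v w :=
  apply: closed_cancel; apply: half_cancel; rewrite -[RHS](kclosed u v w);
  rewrite !(kfC (brk _ _)) ?kX0 ?kX1 ?kY0 ?kY1 /brk !NF ?kE
   ?(ipDl, pairDr, ipZl, pairZr, ipNl, pairNr) ?gram ?(DN, DM) ?DI ?D0 ?DN ?D_chi_co ?kE.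

(** The fundamental form pairs [X] with [Y] only, so its exterior derivative is informative on
    triples with two vectors from one distribution. There the derivatives of [chi] cancel against
    the bracket terms, and twice an equation between [mu] and the derivative of [phi] is left. *)
Lemma kaehler_mu : co_mu Y0 = - phii * D X0 phi /\ co_mu Y1 = - phii * D X1 phi.
Proof.
split; [closed_calc X0 X1 Y0|closed_calc X0 X1 Y1]; ring.
Qed.
Lemma kaehler_lam : co_lam X0 = - phii * D Y0 phi /\ co_lam X1 = - phii * D Y1 phi.
Proof.
split; [closed_calc Y0 Y1 X0|closed_calc Y0 Y1 X1]; ring.
Qed.

End Kaehler.

Variables (phi phii : S).
Hypotheses (phiV : phi * phii = 1)
  (aX0 : co_a X0 = 0) (aX1 : co_a X1 = 0)
  (muX0 : co_mu X0 = 0) (muX1 : co_mu X1 = 0)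
  (bY0 : co_b Y0 = 0) (bY1 : co_b Y1 = 0)
  (lamY0 : co_lam Y0 = 0) (lamY1 : co_lam Y1 = 0)
  (muY0 : co_mu Y0 = - phii * D X0 phi) (muY1 : co_mu Y1 = - phii * D X1 phi)
  (lamX0 : co_lam X0 = - phii * D Y0 phi) (lamX1 : co_lam X1 = - phii * D Y1 phi).

Lemma co_b_X0 : co_b X0 = chii * D X0 chi.
Proof. by rewrite -co_ab aX0 add0r. Qed.
Lemma co_b_X1 : co_b X1 = chii * D X1 chi.
Proof. by rewrite -co_ab aX1 add0r. Qed.
Lemma co_a_Y0 : co_a Y0 = chii * D Y0 chi.
Proof. by rewrite -co_ab bY0 addr0. Qed.
Lemma co_a_Y1 : co_a Y1 = chii * D Y1 chi.
Proof. by rewrite -co_ab bY1 addr0. Qed.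

Let coE := (aX0, aX1, muX0, muX1, (bY0, bY1, lamY0, lamY1),
  (muY0, muY1, lamX0, lamX1), (co_b_X0, co_b_X1, co_a_Y0, co_a_Y1)).

(** These coefficients serve twice: they are the zeroth-order terms of the spinor divergence along
    [Y] ([divc0], [divc1]) or [X] ([divd0], [divd1]), and the structure functions of the bracket of
    [Y0] and [Y1], or of [X0] and [X1]. *)
Definition divc0 := co_h11 Y0 - co_h01 Y1.
Definition divc1 := co_h00 Y1 - co_h01 Y0.
Definition divd0 := co_h11 X0 - co_h01 X1.
Definition divd1 := co_h00 X1 - co_h01 X0.

Lemma D_comm u v f : D u (D v f) = D v (D u f) + D (brk u v) f.
Proof. by rewrite D_brk addrC subrK. Qed.

Lemma D_X01 f : D X0 (D X1 f) - D X1 (D X0 f) = divd0 * D X0 f + divd1 * D X1 f.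
Proof.
by rewrite D_comm /brk !NF coE !Dlin !coE /divd0 /divd1; ring.
Qed.
Lemma D_Y01 f : D Y0 (D Y1 f) - D Y1 (D Y0 f) = divc0 * D Y0 f + divc1 * D Y1 f.
Proof.
by rewrite D_comm /brk !NF coE !Dlin !coE /divc0 /divc1; ring.
Qed.

Let r := chii * phi.

(** Second-order terms reduce to brackets of [X] with [Y]. Their [chi] and [phi] contributions are
    cancelled by the derivatives of the weight, which is what singles out [r = phi / chi]. *)
Lemma div_exchange f :
  D Y1 (r * D X0 f) - D Y0 (r * D X1 f) + divc0 * (r * D X0 f) + divc1 * (r * D X1 f)
  + (D X1 (r * D Y0 f) - D X0 (r * D Y1 f)
  + divd0 * (r * D Y0 f) + divd1 * (r * D Y1 f)) = 0.
Proof.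
rewrite /r !DM !(Dinv _ chiV) (D_comm X0) (D_comm X1) /brk !NF !Dlin !coE.
rewrite /divc0 /divc1 /divd0 /divd1.
ring: chiV phiV.
Qed.

(** A pair lists the two vectors with primed index 0 and 1 belonging to one unprimed spinor; both
    primed pairs of the Riemann tensor are contracted with epsilon. This is four times the curvature
    spinor [X_ABCD]. *)
Definition curv_spinor (P Q T W : V * V) : S :=
  ip (R P.1 Q.2 T.1) W.2 - ip (R P.1 Q.2 T.2) W.1
  - ip (R P.2 Q.1 T.1) W.2 + ip (R P.2 Q.1 T.2) W.1.

Let X := (X0, X1).
Let Y := (Y0, Y1).
Notation XC := curv_spinor.

Lemma curv_spinorC P Q T W : XC Q P T W = XC P Q T W.
Proof. rewrite /XC !(R_antisym P.2) !(R_antisym P.1) !ipNl; ring. Qed.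
Lemma curv_spinorC' P Q T W : XC P Q W T = XC P Q T W.
Proof.
rewrite /XC (R_skew _ _ W.1) (R_skew _ _ W.2) (R_skew P.2 _ W.1) (R_skew P.2 _ W.2).
rewrite !(ipC W.1) !(ipC W.2); ring.
Qed.

Lemma half_curv_spinor P Q T W : half * XC P Q T W =
  half * (ip (R P.1 Q.2 T.1) W.2 - ip (R P.1 Q.2 T.2) W.1)
  - half * (ip (R P.2 Q.1 T.1) W.2 - ip (R P.2 Q.1 T.2) W.1).
Proof. rewrite /XC; ring. Qed.

Lemma half_inj x y : half * x = half * y -> x = y.
Proof. by move=> h; rewrite [x]halfE [y]halfE h. Qed.

Let KE := (K_aE, K_muE, K_lamE, K_bE).

Ltac curv_calc :=
  rewrite !half_curv_spinor /X /Y /= ?KE ?coE;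
  rewrite /brk !NF ?coE ?colin ?coE.

(** Both curvature arguments lie in [X], where [a] and [mu] vanish, and their bracket stays in [X].
    The next three components vanish alike, with [b] and [lambda] for [Y]. *)
Lemma curv_oooo : XC X X X X = 0.
Proof. apply: half_inj; curv_calc. rewrite ?D0 ; ring. Qed.
Lemma curv_oooi : XC X X X Y = 0.
Proof. apply: half_inj; curv_calc. rewrite ?D0; ring. Qed.
Lemma curv_iiii : XC Y Y Y Y = 0.
Proof. apply: half_inj; curv_calc. rewrite ?D0; ring. Qed.
Lemma curv_iiio : XC Y Y Y X = 0.
Proof. apply: half_inj; curv_calc. rewrite ?D0; ring. Qed.
(** Along [Y], [mu] is minus the [X]-gradient of log [phi], so the component is a skew second
    derivative of log [phi] corrected by the bracket of [X0] and [X1], which is zero. For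
    [curv_oiii] the roles of [X] and [Y] are exchanged. *)
Lemma curv_oioo : XC X Y X X = 0.
Proof.
apply: half_inj; curv_calc.
rewrite ?D0 !(DM, DN) !(Dinv _ phiV) (D_comm X0) /brk !NF !Dlin !coE; ring: chiV phiV.
Qed.
Lemma curv_oiii : XC X Y Y Y = 0.
Proof.
apply: half_inj; curv_calc.
rewrite ?D0 !(DM, DN) !(Dinv _ phiV) (D_comm Y0) /brk !NF !Dlin !coE; ring: chiV phiV.
Qed.

(* The logarithmic derivatives of [chi] and [phi] combine into second
   derivatives of [r = phi / chi]. *)
Lemma curv_ooii : XC X X Y Y + XC Y Y X X + 4%:R * XC X Y X Y =
  - 8%:R * (chi * chi * phii) *
  (D Y1 (D X0 r) - D Y0 (D X1 r) + divc0 * D X0 r + divc1 * D X1 r).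
Proof.
have e x y z : half * (x + y + 4%:R * z) = half * x + half * y + 4%:R * (half * z).
  by ring.
have e' w z : half * (- 8%:R * w * z) = - 4%:R * (half + half) * w * z by ring.
apply: half_inj; rewrite e e' half2; curv_calc.
rewrite /r !(DM, DN, DD) !(Dinv _ phiV, Dinv _ chiV) !(DM, DN, DD) !(Dinv _ phiV, Dinv _ chiV).
rewrite /r /divc0 /divc1.
rewrite ?(D_comm X0 Y0) ?(D_comm X0 Y1) ?(D_comm X1 Y0) ?(D_comm X1 Y1) ?(D_comm X1 X0)
  ?(D_comm Y1 Y0).
rewrite /brk !NF !Dlin !coE !D0.
ring: chiV phiV.
Qed.

Let addr3 (a b c a' b' c' : V) :
  a + a' - (b + b') - (c + c') = a - b - c + (a' - b' - c').
Proof. by rewrite [RHS]addrACA -opprD [a - b + _]addrACA -opprD. Qed.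

Lemma RDl u u' v w : R (u + u') v w = R u v w + R u' v w.
Proof.
have e : brk (u + u') v = brk u v + brk u' v.
  by rewrite /brk NDl NDr opprD addrACA.
by rewrite /R e !NDl !NDr addr3.
Qed.
Lemma RZl a u v w : R (a *: u) v w = a *: R u v w.
Proof.
have e : brk (a *: u) v = a *: brk u v - D v a *: u.
  by rewrite /brk NZl NZr scalerBr opprD addrA addrAC.
have id (p q s t : V) : p - (t + q) - (s - t) = p - q - s.
  by rewrite opprB -!addrA opprD [- t - q]addrC -addrA addKr.
by rewrite /R e NDl NNl !NZl NZr id !scalerBr.
Qed.
Lemma RDr u v w w' : R u v (w + w') = R u v w + R u v w'.
Proof. by rewrite /R !NDr addr3. Qed.
(** Mixed first-order terms cancel in pairs, and the second derivatives of [a] form a commutator,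
    which [D_brk] absorbs into the bracket term. *)
Lemma RZr a u v w : R u v (a *: w) = a *: R u v w.
Proof.
have id (P P' q s A B C : V) :
    P + q + (s + A) - (P' + s + (q + B)) - (P - P' + C) = A - B - C.
  have kA (x y z : V) : x + z - (y + z) = x - y.
    by rewrite opprD addrACA subrr addr0.
  have -> : P + q + (s + A) = P + A + (q + s) by rewrite [s + A]addrC addrACA.
  have -> : P' + s + (q + B) = P' + B + (q + s).
    by rewrite [q + B]addrC addrACA [s + q]addrC.
  have kA' (x y z : V) : z + x - (z + y) = x - y by rewrite opprD addrACA subrr add0r.
  by rewrite kA opprD addrACA kA'.
by rewrite /R !NZr !NDr !NZr D_brk scalerBl id !scalerBr.
Qed.

Lemma ipR1 a b u u' v w z : ip (R (a *: u + b *: u') v w) z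
  = a * ip (R u v w) z + b * ip (R u' v w) z.
Proof. by rewrite RDl !RZl ipDl !ipZl. Qed.
Lemma ipR3 a b u v w w' z : ip (R u v (a *: w + b *: w')) z
  = a * ip (R u v w) z + b * ip (R u v w') z.
Proof. by rewrite RDr !RZr ipDl !ipZl. Qed.

Definition lin_comb (a b : S) (P Q : V * V) : V * V :=
  (a *: P.1 + b *: Q.1, a *: P.2 + b *: Q.2).

(* Six times the symmetrization, as [XC] is symmetric in its first and in its
   last pair of arguments. *)
Definition sym_spinor (P Q T W : V * V) : S :=
  XC P Q T W + XC P T Q W + XC P W Q T + XC Q T P W + XC Q W P T + XC T W P Q.

Lemma sym_spinor12 P Q T W : sym_spinor Q P T W = sym_spinor P Q T W.
Proof. rewrite /sym_spinor (curv_spinorC P Q) (curv_spinorC' T W Q P); ring. Qed.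
Lemma sym_spinor23 P Q T W : sym_spinor P T Q W = sym_spinor P Q T W.
Proof. rewrite /sym_spinor (curv_spinorC Q T) (curv_spinorC' P W T Q); ring. Qed.
Lemma sym_spinor34 P Q T W : sym_spinor P Q W T = sym_spinor P Q T W.
Proof. rewrite /sym_spinor (curv_spinorC T W) (curv_spinorC' P Q W T); ring. Qed.

(** In all six terms the first argument stands in slot one or three of [XC], so linearity of [R] in
    its first and third vectors settles it. *)
Lemma sym_spinor_lin a b P P' Q T W : sym_spinor (lin_comb a b P P') Q T W
  = a * sym_spinor P Q T W + b * sym_spinor P' Q T W.
Proof.
have e1 Q1 Q2 Q3 : XC (lin_comb a b P P') Q1 Q2 Q3
    = a * XC P Q1 Q2 Q3 + b * XC P' Q1 Q2 Q3.
  by rewrite /XC /= !ipR1; ring.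
have e2 Q1 Q2 Q3 : XC Q1 Q2 (lin_comb a b P P') Q3
    = a * XC Q1 Q2 P Q3 + b * XC Q1 Q2 P' Q3.
  by rewrite /XC /= !ipR3; ring.
by rewrite /sym_spinor !e1 !e2; ring.
Qed.

(** The arguments are replaced one at a time, each moved to the first slot by symmetry. This makes
    the vanishing of the Weyl spinor independent of the spinor basis. *)
Lemma sym_spinor_span (B B' : 'I_2 -> V * V) :
  (forall i, exists a b, B' i = lin_comb a b (B 0) (B 1)) ->
  (forall i j k l, sym_spinor (B i) (B j) (B k) (B l) = 0) ->
  forall i j k l, sym_spinor (B' i) (B' j) (B' k) (B' l) = 0.
Proof.
move=> hB h.
have step Q T W : (forall i, sym_spinor (B i) Q T W = 0) ->
    forall i, sym_spinor (B' i) Q T W = 0.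
  by move=> h0 i; have [a [b ->]] := hB i; rewrite sym_spinor_lin !h0 !mulr0 addr0.
have h1 i j k l : sym_spinor (B' i) (B j) (B k) (B l) = 0 by exact: step.
have h2 i j k l : sym_spinor (B' i) (B' j) (B k) (B l) = 0.
  by apply: step => m; rewrite sym_spinor12.
have h3 i j k l : sym_spinor (B' i) (B' j) (B' k) (B l) = 0.
  by apply: step => m; rewrite sym_spinor12 sym_spinor23 sym_spinor12.
move=> i j k l; apply: step => m.
by rewrite sym_spinor12 sym_spinor23 sym_spinor34.
Qed.

Definition box_r := D Y1 (D X0 r) - D Y0 (D X1 r) + divc0 * D X0 r + divc1 * D X1 r.

Lemma sym_spinor_XY : (forall P Q T W, P = X \/ P = Y -> Q = X \/ Q = Y ->
    T = X \/ T = Y -> W = X \/ W = Y -> sym_spinor P Q T W = 0) <-> box_r = 0.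
Proof.
have e : sym_spinor X X Y Y = - 8%:R * (chi * chi * phii) * box_r.
  by rewrite -curv_ooii /sym_spinor; ring.
split=> [h|h].
  have : sym_spinor X X Y Y = 0 by apply: h; [left|left|right|right].
  rewrite e => {e} e.
  have e' t : - 8%:R * (chi * chi * phii) * t = 0 -> t = 0.
    (* Three halvings account for the factor 8, and [- chii * chii * phi] inverts the remaining
       factor up to sign. *)
    move=> ht; apply: half_cancel; apply: half_cancel; apply: half_cancel.
    rewrite -[RHS](mulr0 (- chii * chii * phi)) -ht; ring: chiV phiV.
  exact: e'.
have oe := (curv_oooo, curv_oooi, curv_iiii, curv_iiio, curv_oioo, curv_oiii).
have e0 : sym_spinor X X Y Y = 0 by rewrite e h mulr0.
move: e0 => {e h}; move: oe; rewrite /sym_spinor => oe e0.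
have c1 := (curv_spinorC' X X X Y, curv_spinorC' Y Y Y X, curv_spinorC X Y).
have c2 := (curv_spinorC' X Y X Y).
move=> P Q T W [] -> [] -> [] -> [] ->; rewrite ?c1 ?c2 ?oe ?addr0 //; rewrite -e0 ?c1 ?c2; ring.
Qed.

End AdaptedFrame.

(* Matrix products become atoms, so that the linear identities between them can
   be checked entrywise by [ring]. *)
Ltac mxlin :=
  repeat match goal with |- context [?A *m ?B] =>
    let P := fresh "P" in set P := A *m B; clearbody P end;
  apply/matrixP => ? ?; rewrite ?mxE; ring.

(** * Derivations of a commutative ring acting entrywise on matrices *)

Section Derivation.
Variable S : comNzRingType.

Definition derivation (dl : S -> S) : Prop :=
  (forall x y, dl (x + y) = dl x + dl y) /\
  (forall x y, dl (x * y) = dl x * y + x * dl y).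

Variables (dl : S -> S) (dlP : derivation dl).

Lemma dl0 : dl 0 = 0.
Proof. by apply: (addrI (dl 0)); rewrite -dlP.1 !addr0. Qed.

Lemma dlN x : dl (- x) = - dl x.
Proof. by apply: (addrI (dl x)); rewrite -dlP.1 !subrr dl0. Qed.

Lemma mapdD m n (F G : 'M[S]_(m, n)) :
  map_mx dl (F + G) = map_mx dl F + map_mx dl G.
Proof. by apply/matrixP => i j; rewrite !mxE dlP.1. Qed.

Lemma mapdN m n (F : 'M[S]_(m, n)) : map_mx dl (- F) = - map_mx dl F.
Proof. by apply/matrixP => i j; rewrite !mxE dlN. Qed.

Lemma mapdZ m n a (F : 'M[S]_(m, n)) :
  map_mx dl (a *: F) = dl a *: F + a *: map_mx dl F.
Proof. by apply/matrixP => i j; rewrite !mxE dlP.2. Qed.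

Lemma mapdM m n p (F : 'M[S]_(m, n)) (G : 'M[S]_(n, p)) :
  map_mx dl (F *m G) = map_mx dl F *m G + F *m map_mx dl G.
Proof.
apply/matrixP => i j; rewrite !mxE (big_morph dl dlP.1 dl0) -big_split /=.
by apply: eq_bigr => k _; rewrite dlP.2 !mxE.
Qed.

Lemma mapd1 n : map_mx dl (1%:M : 'M[S]_n) = 0.
Proof.
apply: (addrI (map_mx dl 1%:M)).
by rewrite -{3}[1%:M]mulmx1 mapdM mulmx1 mul1mx addr0.
Qed.

Lemma mapdV n (F Fi : 'M[S]_n) : Fi *m F = 1%:M -> F *m Fi = 1%:M ->
  map_mx dl Fi = - (Fi *m map_mx dl F *m Fi).
Proof.
move=> h h'; have := mapd1 n; rewrite -h' mapdM => /(congr1 (mulmx Fi)).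
rewrite mulmxDr mulmx0 !mulmxA h mul1mx => e.
by apply/eqP; rewrite -addr_eq0 addrC e.
Qed.

Lemma dlV a ai : a * ai = 1 -> dl ai = - (ai * ai * dl a).
Proof.
have d1 : dl 1 = 0.
  by apply: (addrI (dl 1)); rewrite addr0 -[in RHS](mul1r 1) dlP.2; ring.
move=> h; have : dl a * ai + a * dl ai = 0 by rewrite -dlP.2 h d1.
move/(congr1 (fun t => ai * t)); rewrite mulr0 => e.
have -> : dl ai = a * ai * dl ai by rewrite h mul1r.
by apply/eqP; rewrite -subr_eq0 -e; apply/eqP; ring.
Qed.

End Derivation.

(** * The generalized Yang equation in block form *)

Section Yang.
Variables (S : comNzRingType) (x0 x1 y0 y1 : S -> S) (c0 c1 d0 d1 r ri : S).
Hypotheses (x0P : derivation x0) (x1P : derivation x1)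
  (y0P : derivation y0) (y1P : derivation y1).
Hypotheses (rV : r * ri = 1)
  (comm_x : forall f, x0 (x1 f) - x1 (x0 f) = d0 * x0 f + d1 * x1 f)
  (comm_y : forall f, y0 (y1 f) - y1 (y0 f) = c0 * y0 f + c1 * y1 f)
  (exch : forall f,
    y1 (r * x0 f) - y0 (r * x1 f) + c0 * (r * x0 f) + c1 * (r * x1 f)
    + (x1 (r * y0 f) - x0 (r * y1 f) + d0 * (r * y0 f) + d1 * (r * y1 f)) = 0).

Notation "F ^x0" := (map_mx x0 F) (at level 2, format "F ^x0").
Notation "F ^x1" := (map_mx x1 F) (at level 2, format "F ^x1").
Notation "F ^y0" := (map_mx y0 F) (at level 2, format "F ^y0").
Notation "F ^y1" := (map_mx y1 F) (at level 2, format "F ^y1").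

(** The divergence of a primed spinor [W] along [iota], written in the null frame; [xdiv] is its
    analogue along [o]. *)
Definition ydiv m n (W0 W1 : 'M[S]_(m, n)) :=
  W0^y1 - W1^y0 + c0 *: W0 + c1 *: W1.
Definition xdiv m n (W0 W1 : 'M[S]_(m, n)) :=
  W0^x1 - W1^x0 + d0 *: W0 + d1 *: W1.
Definition wedge m n p (P0 P1 : 'M[S]_(m, n)) (Q0 Q1 : 'M[S]_(n, p)) :=
  P0 *m Q1 - P1 *m Q0.

Lemma ydiv_y m n (F : 'M[S]_(m, n)) : ydiv F^y0 F^y1 = 0.
Proof.
apply/matrixP => i j; rewrite !mxE -addrA -comm_y; ring.
Qed.

Lemma xdiv_x m n (F : 'M[S]_(m, n)) : xdiv F^x0 F^x1 = 0.
Proof.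
apply/matrixP => i j; rewrite !mxE -addrA -comm_x; ring.
Qed.

Lemma ydiv_exch m n (F : 'M[S]_(m, n)) :
  ydiv (r *: F^x0) (r *: F^x1) = - xdiv (r *: F^y0) (r *: F^y1).
Proof.
by apply/eqP; rewrite -addr_eq0; apply/eqP/matrixP => i j; rewrite !mxE exch.
Qed.

Let dE := (mapdD x0P, mapdD x1P, mapdD y0P, mapdD y1P,
  (mapdN x0P, mapdN x1P, mapdN y0P, mapdN y1P),
  (mapdM x0P, mapdM x1P, mapdM y0P, mapdM y1P),
  (mapdZ x0P, mapdZ x1P, mapdZ y0P, mapdZ y1P)).

Lemma ydivMl m n p (B : 'M[S]_(m, n)) (W0 W1 : 'M[S]_(n, p)) :
  ydiv (B *m W0) (B *m W1) = B *m ydiv W0 W1 - wedge B^y0 B^y1 W0 W1.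
Proof.
rewrite /ydiv /wedge !dE !(mulmxDl, mulmxDr, mulNmx, mulmxN) -!scalemxAr; mxlin.
Qed.

Lemma ydivMr m n p (B : 'M[S]_(n, p)) (W0 W1 : 'M[S]_(m, n)) :
  ydiv (W0 *m B) (W1 *m B) = ydiv W0 W1 *m B + wedge W0 W1 B^y0 B^y1.
Proof.
rewrite /ydiv /wedge !dE !(mulmxDl, mulmxDr, mulNmx, mulmxN) -!scalemxAl; mxlin.
Qed.

Lemma ydivD m n (V0 V1 W0 W1 : 'M[S]_(m, n)) :
  ydiv (V0 + W0) (V1 + W1) = ydiv V0 V1 + ydiv W0 W1.
Proof. rewrite /ydiv !dE; mxlin. Qed.

Lemma ydivN m n (W0 W1 : 'M[S]_(m, n)) : ydiv (- W0) (- W1) = - ydiv W0 W1.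
Proof. rewrite /ydiv !dE; mxlin. Qed.

Lemma ydiv_block k l m n (P0 P1 : 'M[S]_(k, m)) (Q0 Q1 : 'M[S]_(k, n))
    (V0 V1 : 'M[S]_(l, m)) (W0 W1 : 'M[S]_(l, n)) :
  ydiv (block_mx P0 Q0 V0 W0) (block_mx P1 Q1 V1 W1)
  = block_mx (ydiv P0 P1) (ydiv Q0 Q1) (ydiv V0 V1) (ydiv W0 W1).
Proof.
by rewrite /ydiv !map_block_mx !scale_block_mx opp_block_mx !add_block_mx.
Qed.

Section Blocks.
Variables (k l : nat).
Variables (A Ai : 'M[S]_k) (At Ati : 'M[S]_l) (B : 'M[S]_(l, k)) (Bt : 'M[S]_(k, l)).
Hypotheses (AAi : A *m Ai = 1%:M) (AiA : Ai *m A = 1%:M)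
  (AAti : At *m Ati = 1%:M) (AtiA : Ati *m At = 1%:M).

(** The product of an upper unitriangular factor with block [- Bt], the diagonal of [Ai] and [At],
    and a lower unitriangular factor with block [B]. The inverse [Ai] is an argument because the
    ring provides no inversion. *)
Definition yblock : 'M[S]_(k + l) :=
  block_mx (Ai - Bt *m At *m B) (- (Bt *m At)) (At *m B) At.

(** The left factor is the product of the three inverted factors in reverse order. *)
Lemma yblock_invl : block_mx A (A *m Bt) (- (B *m A)) (Ati - B *m A *m Bt) *m yblock
  = 1%:M.
Proof.
rewrite /yblock mulmx_block scalar_mx_block.
congr block_mx; rewrite !(mulmxDl, mulmxDr, mulNmx, mulmxN) !mulmxA.
- by rewrite AAi; mxlin.
- by mxlin.
- by rewrite -[B *m A *m Ai]mulmxA AAi mulmx1 AtiA mul1mx; mxlin.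
- by rewrite AtiA; mxlin.
Qed.

(** The blocks of [r J^-1 dJ] after conjugation by the lower factor: the diagonal factor yields
    [M11] and [M22], the upper one [M12], the lower one [M21]. *)
Definition M11 (x : S -> S) := r *: (A *m map_mx x Ai).
Definition M12 (x : S -> S) := - (r *: (A *m map_mx x Bt *m At)).
Definition M21 (x : S -> S) := r *: map_mx x B.
Definition M22 (x : S -> S) := r *: (Ati *m map_mx x At).

(** The wedge terms arise when the divergence passes the conjugating lower factor, whose only
    nonconstant block is [B]. *)
Definition E11 := ydiv (M11 x0) (M11 x1) + wedge (M12 x0) (M12 x1) B^y0 B^y1.
Definition E12 := ydiv (M12 x0) (M12 x1).
Definition E22 := ydiv (M22 x0) (M22 x1) + wedge B^y0 B^y1 (M12 x0) (M12 x1).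
Definition E21 := ydiv (M21 x0) (M21 x1) + wedge (M22 x0) (M22 x1) B^y0 B^y1
  + wedge B^y0 B^y1 (M11 x0) (M11 x1).

(* With [L] the lower unitriangular factor of [yblock], this is [L^-1 M L]. *)
Definition Mconj (x : S -> S) : 'M[S]_(k + l) :=
  block_mx (M11 x + M12 x *m B) (M12 x)
    (M21 x + M22 x *m B - B *m (M11 x + M12 x *m B)) (M22 x - B *m M12 x).

Lemma yblock_Mconj x : derivation x ->
  yblock *m Mconj x = r *: map_mx x yblock.
Proof.
move=> xP; rewrite /yblock /Mconj map_block_mx mulmx_block scale_block_mx.
rewrite !(mapdD xP, mapdN xP, mapdM xP) /M11 /M12 /M21 /M22.
congr block_mx; rewrite !(mulmxDl, mulmxDr, mulNmx, mulmxN, scalerDr)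
  -?(scalemxAl, scalemxAr) !mulmxA ?AiA ?AAti ?mul1mx.
- rewrite -?(scalemxAl, scalemxAr) ?mulmxA -[Bt *m At *m Ati]mulmxA AAti mulmx1.
  rewrite ?AiA ?mul1mx; mxlin.
- rewrite -[Bt *m At *m Ati]mulmxA AAti mulmx1; mxlin.
- rewrite -?(scalemxAl, scalemxAr) ?mulmxA ?AAti ?mul1mx; mxlin.
- mxlin.
Qed.

Lemma ydiv_Mconj : ydiv (Mconj x0) (Mconj x1) =
  block_mx (E11 + E12 *m B) E12
    (E21 + E22 *m B - B *m (E11 + E12 *m B)) (E22 - B *m E12).
Proof.
rewrite /E11 /E12 /E22 /E21 /Mconj.
move: (M11 x0) (M11 x1) (M12 x0) (M12 x1) (M21 x0) (M21 x1) (M22 x0) (M22 x1).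
move=> m11 m11' m12 m12' m21 m21' m22 m22'.
rewrite ydiv_block !(ydivD, ydivN, ydivMl, ydivMr) /wedge.
congr block_mx; rewrite ?(mulmxDl, mulmxDr, mulNmx, mulmxN) ?mulmxA;
  repeat match goal with |- context [ydiv ?P ?Q] =>
    let W := fresh "W" in set W := ydiv P Q; clearbody W end; mxlin.
Qed.

(** The divergence is the block matrix of the [E] conjugated by an invertible lower triangular
    matrix, so the equations can be solved starting from [E12]. *)
Lemma yangP (Ji : 'M[S]_(k + l)) : Ji *m yblock = 1%:M ->
  ydiv (r *: (Ji *m yblock^x0)) (r *: (Ji *m yblock^x1)) = 0 <->
  [/\ E11 = 0, E12 = 0, E21 = 0 & E22 = 0].
Proof.
move=> h.
have e x : derivation x -> r *: (Ji *m map_mx x yblock) = Mconj x.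
  by move=> /yblock_Mconj e; rewrite scalemxAr -e mulmxA h mul1mx.
rewrite !e // ydiv_Mconj -[0]block_mx0; split.
  case/eq_block_mx => e1 e2 e3 e4; move: e1 e3 e4; rewrite e2.
  rewrite mul0mx mulmx0 addr0 subr0 => -> e3 e4; move: e3; rewrite e4.
  by rewrite !mul0mx mulmx0 subr0 addr0 => ->.
by case=> -> -> -> ->; rewrite !mul0mx !addr0 !mulmx0 !subr0.
Qed.

End Blocks.

(** * The block equations after the Bäcklund transformation *)

Section Baecklund.
Variables (k l : nat).
Variables (A Ai : 'M[S]_k) (At Ati : 'M[S]_l) (B B1t : 'M[S]_(l, k))
  (Bt B1 : 'M[S]_(k, l)).
Hypotheses (AAi : A *m Ai = 1%:M) (AiA : Ai *m A = 1%:M)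
  (AAti : At *m Ati = 1%:M) (AtiA : Ati *m At = 1%:M).
Hypotheses (B1y0 : r *: (A *m Bt^x0 *m At) = B1^y0)
  (B1y1 : r *: (A *m Bt^x1 *m At) = B1^y1)
  (B1tx0 : r *: (At *m B^y0 *m A) = B1t^x0)
  (B1tx1 : r *: (At *m B^y1 *m A) = B1t^x1).

Let A' := ri *: Ati.
Let Ai' := r *: At.
Let At' := ri *: Ai.
Let Ati' := r *: A.

Lemma riV : ri * r = 1. Proof. by rewrite mulrC. Qed.

Lemma bk_inv : [/\ A' *m Ai' = 1%:M, Ai' *m A' = 1%:M,
  At' *m Ati' = 1%:M & Ati' *m At' = 1%:M].
Proof.
rewrite /A' /Ai' /At' /Ati'.
by split; rewrite -scalemxAl -scalemxAr scalerA ?rV ?riV scale1r.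
Qed.

(** The new first block inherits the second logarithmic derivative, and differentiating the factor
    [r] of [Ai'] adds the scalar matrix of [x r]. In [bk_M22] the factor is [ri], whence the
    opposite sign. *)
Lemma bk_M11 x : derivation x -> M11 A' Ai' x = (x r)%:M + M22 At Ati x.
Proof.
move=> xP; rewrite /M11 /M22 /A' /Ai' -scalemxAl scalerA rV scale1r (mapdZ xP).
by rewrite mulmxDr -!scalemxAr AtiA scalemx1.
Qed.

Lemma bk_M22 x : derivation x -> M22 At' Ati' x = - (x r)%:M + M11 A Ai x.
Proof.
move=> xP; rewrite /M11 /M22 /At' /Ati' (mapdZ xP) (dlV xP rV).
rewrite -scalemxAl mulmxDr -!scalemxAr AAi !scalerDr !scalerA scalemx1.
congr (_ + _); first by rewrite -raddfN; congr (_%:M); ring: rV.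
by rewrite -[r * r * ri]mulrA rV mulr1.
Qed.

(** The definition of the potential is made for this: all factors [r], [At] and [A] cancel, leaving
    a pure gradient along [Y], which is divergence-free by [ydiv_y]. *)
Lemma bk_M12 (x y : S -> S) : r *: (At *m map_mx y B *m A) = map_mx x B1t ->
  M12 A' At' B1t x = - map_mx y B.
Proof.
move=> h; rewrite /M12 -h /A' /At' -!(scalemxAl, scalemxAr) !scalerA.
rewrite !mulmxA AtiA mul1mx -mulmxA AAi mulmx1.
by rewrite (_ : _ * _ = 1) ?scale1r //; ring: rV.
Qed.

Hypothesis hE : [/\ E11 A Ai At B Bt = 0, E12 A At Bt = 0,
  E21 A Ai At Ati B = 0 & E22 A At Ati B Bt = 0].

Definition box := y1 (x0 r) - y0 (x1 r) + c0 * x0 r + c1 * x1 r.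

Lemma ydiv_scalar n a b : ydiv (@scalar_mx S n a) (@scalar_mx S n b)
  = (y1 a - y0 b + c0 * a + c1 * b)%:M.
Proof.
have e y c : derivation y -> map_mx y (@scalar_mx S n c) = (y c)%:M.
  move=> yP; apply/matrixP => i j; rewrite !mxE.
  by case: eqP; rewrite ?mulr1n ?mulr0n ?(dl0 yP).
by rewrite /ydiv !e // !scale_scalar_mx -raddfB -!raddfD.
Qed.

Lemma bk_E12 : E12 A' At' B1t = 0.
Proof. by rewrite /E12 (bk_M12 B1tx0) (bk_M12 B1tx1) ydivN ydiv_y oppr0. Qed.

Lemma M12_y : M12 A At Bt x0 = - B1^y0 /\ M12 A At Bt x1 = - B1^y1.
Proof. by rewrite /M12 B1y0 B1y1. Qed.

(** Since [M12] is minus the [Y]-gradient of [B1] and the new [M12] minus that of [B], the wedge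
    term equals the one in [E22]. The scalar part of [bk_M11] contributes [box]. *)
Lemma bk_E11 : E11 A' Ai' At' B1 B1t = box%:M.
Proof.
rewrite /E11 !bk_M11 // (bk_M12 B1tx0) (bk_M12 B1tx1) ydivD ydiv_scalar -addrA.
case: hE => _ _ _; rewrite /E22 (M12_y).1 (M12_y).2 => e.
rewrite -[RHS]addr0 -e; congr (_ + (_ + _)).
by rewrite /wedge !mulNmx !mulmxN.
Qed.

Lemma bk_E22 : E22 A' At' Ati' B1 B1t = (- box)%:M.
Proof.
rewrite /E22 !bk_M22 // (bk_M12 B1tx0) (bk_M12 B1tx1) ydivD ydivN ydiv_scalar.
case: hE => + _ _ _; rewrite /E11 (M12_y).1 (M12_y).2 => e.
rewrite -addrA raddfN -[RHS]addr0 -e; congr (_ + (_ + _)).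
by rewrite /wedge !mulNmx !mulmxN.
Qed.

(** The exchange identity turns the [Y]-divergence of the [X]-gradient of [B1] into an
    [X]-divergence of its [Y]-gradient, which the potential equation expresses by the [X]-gradient
    of [Bt]. The latter is divergence-free, and differentiating [r], [A] and [At] gives precisely
    the opposite of the wedge terms. *)
Lemma bk_E21 : E21 A' Ai' At' Ati' B1 = 0.
Proof.
rewrite /E21 /M21 ydiv_exch !bk_M11 // !bk_M22 //.
rewrite /M11 /M22 (mapdV x0P AiA AAi) (mapdV x1P AiA AAi).
have hx := xdiv_x Bt.
have e : xdiv (r *: B1^y0) (r *: B1^y1) = (r * r) *: (A *m xdiv Bt^x0 Bt^x1 *m At)
   + wedge (- (x0 r)%:M - r *: (A^x0 *m Ai)) (- (x1 r)%:M - r *: (A^x1 *m Ai)) B1^y0 B1^y1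
   + wedge B1^y0 B1^y1 ((x0 r)%:M + r *: (Ati *m At^x0)) ((x1 r)%:M + r *: (Ati *m At^x1)).
  have cA m (P : 'M[S]_(m, k)) : P *m Ai *m A = P by rewrite -mulmxA AiA mulmx1.
  have cAt m (P : 'M[S]_(m, l)) : P *m At *m Ati = P.
    by rewrite -mulmxA AAti mulmx1.
  rewrite -B1y0 -B1y1 /xdiv /wedge !dE.
  rewrite !(mulmxDl, mulmxDr, mulNmx, mulmxN, scalerDr, scalerN) -!scalemxAl -!scalemxAr.
  rewrite -?scalemxAl !mulmxA !cA !cAt !mul_scalar_mx !mul_mx_scalar -?scalemxAl; mxlin.
rewrite e hx mulmx0 mul0mx scaler0 add0r.
have eA x : A *m - (Ai *m map_mx x A *m Ai) = - (map_mx x A *m Ai).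
  by rewrite mulmxN !mulmxA AAi mul1mx.
rewrite !eA !scalerN /wedge; mxlin.
Qed.

Lemma backlund_yang (Ji' : 'M[S]_(l + k)) : (0 < l + k)%N ->
  let J' := yblock Ai' At' B1 B1t in Ji' *m J' = 1%:M ->
  ydiv (r *: (Ji' *m J'^x0)) (r *: (Ji' *m J'^x1)) = 0 <-> box = 0.
Proof.
move=> lk J' hJ; have [h1 h2 h3 h4] := bk_inv.
rewrite (yangP h2 h3 hJ) bk_E11 bk_E12 bk_E21 bk_E22; split.
  (* A scalar matrix determines its scalar only if it is nonempty: the first block is read if
     [l > 0], otherwise the last one, where [k > 0]. *)
  case=> + _ _; case: l lk => [|l'] lk; last by move/matrixP/(_ 0 0); rewrite !mxE.
  case: k lk => [//|k'] _ _ /matrixP/(_ 0 0).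
  by rewrite !mxE => /eqP; rewrite oppr_eq0 => /eqP.
by move=> ->; rewrite oppr0 !raddf0.
Qed.

End Baecklund.
End Yang.

(** * Smooth functions *)

Section MixedPartials.
Variables (R : realType) (V : normedModType R).

Lemma derive_line (f : V -> R) (c v : V) (s : R) :
  (derivable (fun t : R => f (t *: v + c)) s 1 <-> derivable f (s *: v + c) v) /\
  'D_1 (fun t : R => f (t *: v + c)) s = 'D_v f (s *: v + c).
Proof.
have e : (fun h => h^-1 *: (((fun t : R => f (t *: v + c)) \o shift s) (h *: 1)
      - f (s *: v + c)))
    = (fun h => h^-1 *: ((f \o shift (s *: v + c)) (h *: v) - f (s *: v + c))).
  by apply/funext => h /=; rewrite scalerDl addrA [h *: 1]mulr1.
by rewrite /derivable /derive e.
Qed.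

Lemma derive_shift (f : V -> R) (a x v : V) :
  'D_v (fun y => f (y + a)) x = 'D_v f (x + a).
Proof.
have e : (fun h => h^-1 *: (((fun y => f (y + a)) \o shift x) (h *: v) - f (x + a)))
    = (fun h => h^-1 *: ((f \o shift (x + a)) (h *: v) - f (x + a))).
  by apply/funext => h /=; rewrite addrA.
by rewrite /derive e.
Qed.

Lemma mvt_line (f : V -> R) (c v : V) (h : R) : 0 < h ->
  (forall s, 0 <= s <= h -> differentiable f (s *: v + c)) ->
  exists2 s, 0 <= s <= h & f (h *: v + c) - f c = h * 'D_v f (s *: v + c).
Proof.
move=> h0 df.
have dd s : 0 <= s <= h -> derivable (fun t : R => f (t *: v + c)) s 1.
  by move=> /df ds; apply/(derive_line f c v s).1/diff_derivable.
have [||s sh e] := @MVT _ (fun t : R => f (t *: v + c))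
    (fun s => 'D_v f (s *: v + c)) 0 h h0.
- move=> s /[!in_itv]/= /andP[/ltW s0 /ltW sh]; rewrite -(derive_line f c v s).2.
  by apply: derivableP; apply: dd; rewrite s0.
- apply: derivable_within_continuous => s /[!in_itv]/= sh; exact: dd.
exists s; first by move: sh; rewrite in_itv /= => /andP[/ltW -> /ltW ->].
by move: e; rewrite scale0r add0r subr0 mulrC.
Qed.

(** The second difference is the increment along [v] of the difference [F] in direction [w]; one
    mean value theorem is applied in each direction. *)
Lemma mvt_square (f : V -> R) (x v w : V) (h : R) : 0 < h ->
  (forall s t, 0 <= s <= h -> 0 <= t <= h ->
    differentiable f (s *: v + t *: w + x) /\
    differentiable ('D_v f) (s *: v + t *: w + x)) ->
  exists s t, [/\ 0 <= s <= h, 0 <= t <= h &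
   f (h *: v + h *: w + x) - f (h *: v + x) - f (h *: w + x) + f x
     = h * h * 'D_w ('D_v f) (s *: v + t *: w + x)].
Proof.
move=> h0 df; pose F y := f (y + h *: w) - f y.
have hh : 0 <= h <= h by rewrite lexx ltW.
have h00 : 0 <= (0 : R) <= h by rewrite lexx ltW.
have shw s : 0 <= s <= h -> differentiable f (s *: v + x + h *: w) /\
    differentiable f (s *: v + x).
  move=> sh; rewrite addrAC; split; first exact: (df s h sh hh).1.
  by have := (df s 0 sh h00).1; rewrite scale0r addr0.
have dshift s : 0 <= s <= h ->
    differentiable (fun y => f (y + h *: w)) (s *: v + x).
  move=> sh; apply: (@differentiable_comp _ _ _ _ (fun y => y + h *: w) f); last exact: (shw s sh).1.
  exact: (differentiableD (f := id) (g := cst (h *: w))).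
have [s sh|s sh e] := @mvt_line F x v h h0.
  by apply: differentiableB; [exact: dshift|exact: (shw s sh).2].
have eD : 'D_v F (s *: v + x) = 'D_v f (s *: v + x + h *: w) - 'D_v f (s *: v + x).
  rewrite deriveB; last 2 first.
  - by apply: diff_derivable; exact: dshift.
  - by apply: diff_derivable; exact: (shw s sh).2.
  by congr (_ - _); exact: derive_shift.
have [t th|t th e'] := @mvt_line ('D_v f) (s *: v + x) w h h0.
  by rewrite addrCA addrA; exact: (df s t sh th).2.
exists s, t; split; [exact: sh|exact: th|].
transitivity (F (h *: v + x) - F x).
  by rewrite /F [h *: v + h *: w + x]addrAC [h *: w + x]addrC; ring.
rewrite e eD -mulrA; congr (h * _); rewrite [s *: v + x + _]addrC e'.
by congr (h * 'D_w _ _); rewrite addrA [t *: w + _]addrC.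
Qed.

Lemma dist_lt_add (a b c c' e : R) : `|a - c| < e -> `|b - c'| < e -> c = c' ->
  `|a - b| < e + e.
Proof.
move=> h h' ecc; rewrite (_ : a - b = (a - c) - (b - c')); last by rewrite ecc; ring.
exact: le_lt_trans (ler_normB _ _) (ltrD h h').
Qed.

(** The second difference is symmetric in [v] and [w], so near [x] the two mixed derivatives take a
    common value, at possibly different points; continuity at [x] then excludes a gap. *)
Lemma derive_comm (f : V -> R) (U : set V) (x v w : V) : open U -> U x ->
  (forall y, U y -> [/\ differentiable f y, differentiable ('D_v f) y
    & differentiable ('D_w f) y]) ->
  {for x, continuous ('D_w ('D_v f))} -> {for x, continuous ('D_v ('D_w f))} ->
  'D_w ('D_v f) x = 'D_v ('D_w f) x.
Proof.
move=> oU Ux df cwv cvw; apply/eqP; apply: contraT => ne.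
pose e := `|'D_w ('D_v f) x - 'D_v ('D_w f) x| / 2.
have e0 : 0 < e by rewrite divr_gt0// normr_gt0 subr_eq0.
have n1 : \forall y \near x, `|'D_w ('D_v f) x - 'D_w ('D_v f) y| < e.
  by apply: cvgr_dist_lt; [exact: cwv|].
have n2 : \forall y \near x, `|'D_v ('D_w f) x - 'D_v ('D_w f) y| < e.
  by apply: cvgr_dist_lt; [exact: cvw|].
have n3 : \forall y \near x, U y by exact: open_nbhs_nbhs.
have n : nbhs x [set y | `|'D_w ('D_v f) x - 'D_w ('D_v f) y| < e /\
    (`|'D_v ('D_w f) x - 'D_v ('D_w f) y| < e /\ U y)].
  exact: filterI n1 (filterI n2 n3).
have [d /= d0 hd] := (nbhs_ballP _ _).1 n.
(* The summand 1 makes [K] positive and keeps the parallelogram of side parameter [d / K] strictly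
   inside the ball of radius [d]. *)
pose K := `|v| + `|w| + 1; have K0 : 0 < K by rewrite ltr_wpDl// addr_ge0.
pose h := d / K; have h0 : 0 < h by rewrite divr_gt0.
have near_x s t (v' w' : V) : `|v'| + `|w'| + 1 = K -> 0 <= s <= h -> 0 <= t <= h ->
    ball x d (s *: v' + t *: w' + x).
  move=> eK /andP[s0 sh] /andP[t0 th].
  rewrite -ball_normE /= opprD addrCA subrr addr0 normrN.
  rewrite (le_lt_trans (ler_normD _ _))// !normrZ !ger0_norm//.
  have -> : d = h * (`|v'| + `|w'|) + h.
    by rewrite -[X in _ + X]mulr1 -mulrDr eK /h divfK// gt_eqF.
  by rewrite mulrDr ltr_pwDr// lerD// ler_wpM2r.
have sq v' w' : `|v'| + `|w'| + 1 = K -> (forall y, U y -> differentiable f y /\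
    differentiable ('D_v' f) y) -> exists2 y, ball x d y &
   f (h *: v' + h *: w' + x) - f (h *: v' + x) - f (h *: w' + x) + f x
     = h * h * 'D_w' ('D_v' f) y.
  move=> eK df'; have [s t sh th|s [t [sh th e1]]] := @mvt_square f x v' w' h h0.
    by apply: df'; have [_ []] := hd _ (near_x s t v' w' eK sh th).
  by exists (s *: v' + t *: w' + x) => //; exact: near_x.
have dv p : U p -> differentiable f p /\ differentiable ('D_v f) p.
  by case/df.
have dw p : U p -> differentiable f p /\ differentiable ('D_w f) p.
  by case/df.
have eK : `|w| + `|v| + 1 = K by rewrite [`|w| + _]addrC.
have [y yd ey] := sq v w erefl dv.
have [z zd ez] := sq w v eK dw.
have eyz : 'D_w ('D_v f) y = 'D_v ('D_w f) z.
  have hh : h * h != 0 by rewrite mulf_neq0// gt_eqF.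
  apply: (mulfI hh); rewrite -[LHS]ey -[RHS]ez.
  by rewrite [h *: w + h *: v]addrC; ring.
have [hy _] := hd _ yd; have [_ [hz _]] := hd _ zd.
have : `|'D_w ('D_v f) x - 'D_v ('D_w f) x| < e + e.
  exact: (dist_lt_add hy hz eyz).
by rewrite /e -splitr ltxx.
Qed.

End MixedPartials.

Lemma near_eq_differentiable (R : realType) (V : normedModType R) (f h : V -> R) x :
  (\near x, f x = h x) -> differentiable f x -> differentiable h x.
Proof.
move=> fh df.
have hx : f x = h x by exact: nbhs_singleton fh.
have dh : continuous ('d f x) /\ h \o shift x = cst (h x) + 'd f x +o_ 0 id.
  split; first exact: diff_continuous.
  have /eqaddoP fo := diff_locally df.
  apply/eqaddoP => eps e0; have fe := fo eps e0.
  have sh : \forall y \near (0 : V), f (y + x) = h (y + x).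
    by move: fh; rewrite (near_shift 0 x) subr0.
  near=> y; have yh : f (y + x) = h (y + x) by near: y.
  have : `|(f \o shift x - (cst (f x) + 'd f x)) y| <= eps * `|y| by near: y.
  by rewrite /cst /= !fctE /= yh hx.
apply/diff_locallyP; suff -> : 'd h x = 'd f x :> (V -> R) by [].
by apply: diff_unique; case: dh.
Unshelve. all: by end_near.
Qed.

(** * Closure of smooth functions and rules for partial derivatives *)

Section SmoothFunctions.
Variables (R : realType) (U : set 'rV[R]_4).
Hypothesis oU : open U.
Notation pt := 'rV[R]_4.
Notation C := (R[i]).

(* The closure of the smooth functions under the field operations: it is
   stable under partial derivatives, hence consists of smooth functions. *)
Inductive smooth_alg : (pt -> R) -> Prop :=
| smooth_alg_base f : smooth U f -> smooth_alg f
| smooth_alg_cst c : smooth_alg (fun=> c)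
| smooth_alg_add f h : smooth_alg f -> smooth_alg h -> smooth_alg (f + h)
| smooth_alg_mul f h : smooth_alg f -> smooth_alg h -> smooth_alg (f * h)
| smooth_alg_inv f : smooth_alg f -> (forall x, U x -> f x != 0) ->
    smooth_alg (fun x => (f x)^-1)
| smooth_alg_ext f h : smooth_alg f -> (forall x, U x -> f x = h x) ->
    smooth_alg h.

Lemma near_U (f h : pt -> R) x : (forall x, U x -> f x = h x) -> U x ->
  \near x, f x = h x.
Proof.
move=> fh Ux; have : \near x, U x by exact: open_nbhs_nbhs.
by apply: filterS => y; exact: fh.
Qed.

Lemma partial_ext i (f h : pt -> R) : (forall x, U x -> f x = h x) ->
  forall x, U x -> partial i f x = partial i h x.
Proof. by move=> fh x Ux; apply: near_eq_derive; exact: near_U. Qed.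

Lemma smooth_alg_diff f : smooth_alg f -> forall x, U x -> differentiable f x.
Proof.
elim=> {f} [f sf x Ux|c x Ux|f h _ df _ dh x Ux|f h _ df _ dh x Ux|f _ df f0 x Ux
  |f h _ df fh x Ux].
- exact: (sf [::]).
- exact: differentiable_cst.
- by apply: differentiableD; [exact: df|exact: dh].
- by apply: differentiableM; [exact: df|exact: dh].
- by apply: differentiableV; [exact: df|exact: f0].
- by apply: near_eq_differentiable (df x Ux); exact: near_U.
Qed.

Lemma smooth_alg_derivable f i : smooth_alg f ->
  forall x, U x -> derivable f x (delta_mx 0 i).
Proof. by move=> sf x Ux; apply: diff_derivable; exact: smooth_alg_diff. Qed.

Lemma smooth_alg_partial i f : smooth_alg f -> smooth_alg (partial i f).
Proof.
elim=> {f} [f sf|c|f h sf pf sh ph|f h sf pf sh ph|f sf pf f0|f h sf pf fh].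
- apply: smooth_alg_base => s x Ux; have := sf (rcons s i) x Ux.
  by rewrite foldr_rcons.
- apply: (smooth_alg_ext (smooth_alg_cst 0)) => x Ux.
  by rewrite /partial derive_cst.
- apply: (smooth_alg_ext (smooth_alg_add pf ph)) => x Ux.
  by rewrite /partial deriveD //; exact: smooth_alg_derivable.
- apply: (smooth_alg_ext (smooth_alg_add (smooth_alg_mul sf ph)
    (smooth_alg_mul sh pf))) => x Ux.
  by rewrite /partial deriveM //; exact: smooth_alg_derivable.
- have si := smooth_alg_inv sf f0.
  apply: (smooth_alg_ext (smooth_alg_mul (smooth_alg_mul (smooth_alg_cst (-1))
    (smooth_alg_mul si si)) pf)) => x Ux.
  rewrite /partial deriveV ?f0 //; last exact: smooth_alg_derivable.
  by rewrite -exprVn expr2 /GRing.mul /= mulN1r.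
- by apply: (smooth_alg_ext pf); exact: partial_ext.
Qed.

Lemma smooth_algP f : smooth_alg f <-> smooth U f.
Proof.
split=> [sf s|]; last exact: smooth_alg_base.
apply: smooth_alg_diff; elim: s => //= i s ih; exact: smooth_alg_partial.
Qed.

Lemma smooth_partial i f : smooth U f -> smooth U (partial i f).
Proof. by rewrite -!smooth_algP; exact: smooth_alg_partial. Qed.

Lemma smooth_add f h : smooth U f -> smooth U h -> smooth U (fun x => f x + h x).
Proof. by rewrite -!smooth_algP; exact: smooth_alg_add. Qed.

Lemma smooth_mul f h : smooth U f -> smooth U h -> smooth U (fun x => f x * h x).
Proof. by rewrite -!smooth_algP; exact: smooth_alg_mul. Qed.

Lemma smooth_cst c : smooth U (fun=> c).
Proof. by rewrite -smooth_algP; exact: smooth_alg_cst. Qed.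

Lemma smooth_inv f : smooth U f -> (forall x, U x -> f x != 0) ->
  smooth U (fun x => (f x)^-1).
Proof. by rewrite -!smooth_algP; exact: smooth_alg_inv. Qed.

Lemma smooth_ext f h : smooth U f -> (forall x, U x -> f x = h x) -> smooth U h.
Proof. by rewrite -!smooth_algP; exact: smooth_alg_ext. Qed.

Lemma smooth_opp f : smooth U f -> smooth U (fun x => - f x).
Proof.
move=> sf; apply: (smooth_ext (smooth_mul (smooth_cst (-1)) sf)) => x _.
by rewrite mulN1r.
Qed.

Lemma smooth_derivable f i x : smooth U f -> U x -> derivable f x (delta_mx 0 i).
Proof. by move=> /smooth_algP sf; exact: smooth_alg_derivable. Qed.

Lemma partialD i f h x : smooth U f -> smooth U h -> U x ->
  partial i (fun y => f y + h y) x = partial i f x + partial i h x.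
Proof. by move=> sf sh Ux; rewrite /partial deriveD //; exact: smooth_derivable. Qed.

Lemma partialN i f x : smooth U f -> U x ->
  partial i (fun y => - f y) x = - partial i f x.
Proof. by move=> sf Ux; rewrite /partial deriveN //; exact: smooth_derivable. Qed.

Lemma partialM i f h x : smooth U f -> smooth U h -> U x ->
  partial i (fun y => f y * h y) x = f x * partial i h x + h x * partial i f x.
Proof. by move=> sf sh Ux; rewrite /partial deriveM //; exact: smooth_derivable. Qed.

Lemma partial_cst i (c : R) x : partial i (fun=> c) x = 0.
Proof. by rewrite /partial derive_cst. Qed.

Lemma partialC i j f x : smooth U f -> U x ->
  partial i (partial j f) x = partial j (partial i f) x.
Proof.
move=> sf Ux; apply: (@derive_comm _ _ f U) => //.
- by move=> y Uy; split; [exact: (sf [::])|exact: (sf [:: j])|exact: (sf [:: i])].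
- exact: differentiable_continuous (sf [:: i; j] x Ux).
- exact: differentiable_continuous (sf [:: j; i] x Ux).
Qed.

Lemma csmooth_ext (f h : pt -> C) : csmooth U f ->
  (forall x, U x -> f x = h x) -> csmooth U h.
Proof.
move=> [s1 s2] fh; split; [apply: smooth_ext s1 _|apply: smooth_ext s2 _];
  by move=> x Ux; rewrite fh.
Qed.

Lemma csmooth_cst (c : C) : csmooth U (fun=> c).
Proof. by split; exact: smooth_cst. Qed.

Lemma csmooth_real (f : pt -> R) : smooth U f -> csmooth U (fun x => (f x)%:C%C).
Proof. by split => //=; exact: smooth_cst. Qed.

Lemma csmooth_add (f h : pt -> C) : csmooth U f -> csmooth U h ->
  csmooth U (fun x => f x + h x).
Proof.
move=> [f1 f2] [h1 h2]; split.
  by apply: smooth_ext (smooth_add f1 h1) _ => x _; case: (f x) (h x) => ? ? [].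
by apply: smooth_ext (smooth_add f2 h2) _ => x _; case: (f x) (h x) => ? ? [].
Qed.

Lemma csmooth_opp (f : pt -> C) : csmooth U f -> csmooth U (fun x => - f x).
Proof.
move=> [f1 f2]; split.
  by apply: smooth_ext (smooth_opp f1) _ => x _; case: (f x).
by apply: smooth_ext (smooth_opp f2) _ => x _; case: (f x).
Qed.

Lemma csmooth_conj (f : pt -> C) : csmooth U f -> csmooth U (fun x => (f x)^*).
Proof.
move=> [f1 f2]; split; first by apply: smooth_ext f1 _ => x _; case: (f x).
by apply: smooth_ext (smooth_opp f2) _ => x _; case: (f x).
Qed.

Lemma csmooth_mul (f h : pt -> C) : csmooth U f -> csmooth U h ->
  csmooth U (fun x => f x * h x).
Proof.
move=> [f1 f2] [h1 h2]; split.
  apply: smooth_ext (smooth_add (smooth_mul f1 h1) (smooth_opp (smooth_mul f2 h2))) _.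
  by move=> x _; case: (f x) (h x) => ? ? [].
apply: smooth_ext (smooth_add (smooth_mul f1 h2) (smooth_mul f2 h1)) _.
by move=> x _; case: (f x) (h x) => ? ? [].
Qed.

(** The inverse is the conjugate divided by the squared modulus, which reduces the claim to a real
    reciprocal. *)
Lemma csmooth_inv (f : pt -> C) : csmooth U f -> (forall x, U x -> f x != 0) ->
  csmooth U (fun x => (f x)^-1).
Proof.
move=> sf f0; have [s1 s2] := sf.
have s3 := smooth_add (smooth_mul s1 s1) (smooth_mul s2 s2).
have n0 x : U x -> complex.Re (f x) * complex.Re (f x)
    + complex.Im (f x) * complex.Im (f x) != 0.
  move=> /f0; case: (f x) => a b /=; rewrite eq_complex negb_and /= => h.
  by rewrite -!expr2 paddr_eq0 ?sqr_ge0 // !sqrf_eq0 negb_and.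
apply: (csmooth_ext (csmooth_mul (csmooth_conj sf) (csmooth_real (smooth_inv s3 n0)))).
move=> x Ux; have fx := f0 x Ux; apply: (mulfI fx); rewrite divff //.
have := n0 x Ux; case: (f x) => a b /= nab; simpc.
by congr (_ +i* _)%C; [rewrite -[RHS](divff nab); ring|ring].
Qed.

Lemma csmooth_cpartial i (f : pt -> C) : csmooth U f -> csmooth U (cpartial i f).
Proof. by move=> [s1 s2]; split; exact: smooth_partial. Qed.

Lemma cpartial_ext i (f h : pt -> C) : (forall x, U x -> f x = h x) ->
  forall x, U x -> cpartial i f x = cpartial i h x.
Proof.
by move=> fh x Ux; congr (_ +i* _)%C; apply: partial_ext => // y Uy; rewrite fh.
Qed.

Lemma ReD (a b : C) : complex.Re (a + b) = complex.Re a + complex.Re b.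
Proof. by case: a b => ? ? []. Qed.
Lemma ImD (a b : C) : complex.Im (a + b) = complex.Im a + complex.Im b.
Proof. by case: a b => ? ? []. Qed.
Lemma ReM (a b : C) : complex.Re (a * b)
  = complex.Re a * complex.Re b - complex.Im a * complex.Im b.
Proof. by case: a b => ? ? []. Qed.
Lemma ImM (a b : C) : complex.Im (a * b)
  = complex.Re a * complex.Im b + complex.Im a * complex.Re b.
Proof. by case: a b => ? ? []. Qed.

Lemma cpartialD i f h x : csmooth U f -> csmooth U h -> U x ->
  cpartial i (fun y => f y + h y) x = cpartial i f x + cpartial i h x.
Proof.
move=> [f1 f2] [h1 h2] Ux; rewrite /cpartial; simpc.
under [X in partial i X]funext do rewrite ReD.
under [X in (_ +i* partial i X x)%C]funext do rewrite ImD.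
by rewrite !partialD.
Qed.

Lemma cpartialN i f x : csmooth U f -> U x ->
  cpartial i (fun y => - f y) x = - cpartial i f x.
Proof.
move=> [f1 f2] Ux; rewrite /cpartial; simpc; rewrite -!partialN //.
by congr (_ +i* _)%C; apply: partial_ext => // y _; case: (f y).
Qed.

Lemma cpartialM i f h x : csmooth U f -> csmooth U h -> U x ->
  cpartial i (fun y => f y * h y) x = cpartial i f x * h x + f x * cpartial i h x.
Proof.
move=> [f1 f2] [h1 h2] Ux; rewrite /cpartial.
under [X in partial i X]funext do rewrite ReM.
under [X in (_ +i* partial i X x)%C]funext do rewrite ImM.
rewrite !partialD ?partialN ?partialM //; try exact: smooth_opp; try exact: smooth_mul;
  try by apply: smooth_opp; exact: smooth_mul.
by case: (f x) (h x) => ? ? [? ?] /=; simpc; congr (_ +i* _)%C; ring.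
Qed.

Lemma cpartialC i j f x : csmooth U f -> U x ->
  cpartial i (cpartial j f) x = cpartial j (cpartial i f) x.
Proof.
move=> [f1 f2] Ux.
have eRe k : (fun y => complex.Re (cpartial k f y))
    = partial k (fun y => complex.Re (f y)) by apply/funext.
have eIm k : (fun y => complex.Im (cpartial k f y))
    = partial k (fun y => complex.Im (f y)) by apply/funext.
rewrite [LHS]/cpartial [RHS]/cpartial !eRe !eIm.
by rewrite (partialC i j f1 Ux) (partialC i j f2 Ux).
Qed.

Lemma cpartial_conj i f x : csmooth U f -> U x ->
  cpartial i (fun y => (f y)^*) x = (cpartial i f x)^*.
Proof.
move=> [f1 f2] Ux; rewrite /cpartial; simpc; rewrite -!partialN //.
by congr (_ +i* _)%C; apply: partial_ext => // y _; case: (f y).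
Qed.

Lemma cpartial_real i (f : pt -> R) x :
  cpartial i (fun y => (f y)%:C%C) x = (partial i f x)%:C%C.
Proof. by rewrite /cpartial /= partial_cst. Qed.

End SmoothFunctions.

(** * The ring of smooth functions *)

(** The base point makes the ring of functions nonzero and supplies the constant value taken outside
    of the domain. *)
Record pointed_open (R : realType) := PointedOpen {
  dom : set 'rV[R]_4; dom_open : open dom; base : 'rV[R]_4; dom_base : dom base }.

(* Smooth complex functions on [D], extended by a constant outside of [D]:
   equality on [D] is then equality, and evaluation at any point is a ring
   morphism. *)
Record sfield (R : realType) (D : pointed_open R) := SField {
  sfun :> 'rV[R]_4 -> R[i];
  sfunP : csmooth (dom D) sfun /\ forall x, ~ dom D x -> sfun x = sfun (base D) }.

Section SField.
Variables (R : realType) (D : pointed_open R).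
Notation pt := 'rV[R]_4.
Notation C := (R[i]).
Notation S := (sfield D).

Let oD : open (dom D) := @dom_open R D.

Lemma sfield_ext (f h : S) : (forall x, dom D x -> f x = h x) -> f = h.
Proof.
move=> fh; have e : sfun f = sfun h.
  apply/funext => x; have [Dx|nDx] := pselect (dom D x); first exact: fh.
  by rewrite (sfunP f).2 // (sfunP h).2 // fh //; exact: dom_base.
case: f h e {fh} => [f hf] [h hh] /= e; subst h; congr SField; exact: Prop_irrelevance.
Qed.

Lemma sfield_extT (f h : S) : (forall x, f x = h x) -> f = h.
Proof. by move=> fh; apply: sfield_ext => x _. Qed.

HB.instance Definition _ := gen_eqMixin S.
HB.instance Definition _ := gen_choiceMixin S.

Definition scst (c : C) : S.
Proof. by exists (fun=> c); split=> //; exact: csmooth_cst. Defined.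

Definition sadd (f h : S) : S.
Proof.
exists (fun x => f x + h x); split; first exact: csmooth_add (sfunP f).1 (sfunP h).1.
by move=> x Dx; rewrite (sfunP f).2 // (sfunP h).2.
Defined.

Definition sopp (f : S) : S.
Proof.
exists (fun x => - f x); split; first exact: csmooth_opp (sfunP f).1.
by move=> x Dx; rewrite (sfunP f).2.
Defined.

Definition smul (f h : S) : S.
Proof.
exists (fun x => f x * h x); split; first exact: csmooth_mul (sfunP f).1 (sfunP h).1.
by move=> x Dx; rewrite (sfunP f).2 // (sfunP h).2.
Defined.

Definition sconj (f : S) : S.
Proof.
exists (fun x => (f x)^*); split; first exact: csmooth_conj (sfunP f).1.
by move=> x Dx; rewrite (sfunP f).2.
Defined.

Definition extend (f : pt -> C) (x : pt) : C :=
  if pselect (dom D x) is left _ then f x else f (base D).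

Lemma extendE f x : dom D x -> extend f x = f x.
Proof. by move=> Dx; rewrite /extend; case: pselect. Qed.

(* Opaque existence proofs keep unification from unfolding derivatives. *)
Lemma sof_exists (f : pt -> C) : csmooth (dom D) f ->
  {s : S | forall x, dom D x -> s x = f x}.
Proof.
move=> sf; have eP : csmooth (dom D) (extend f) /\
    forall x, ~ dom D x -> extend f x = extend f (base D).
  split; first by apply: csmooth_ext oD _ _ sf _ => x Dx; rewrite extendE.
  move=> x Dx; rewrite [RHS]extendE; last exact: dom_base.
  by rewrite /extend; case: pselect.
by exists (SField eP) => x Dx; rewrite /= extendE.
Qed.

Definition sof f (sf : csmooth (dom D) f) : S := sval (sof_exists sf).

Lemma sofE f (sf : csmooth (dom D) f) x : dom D x -> sof sf x = f x.
Proof. exact: (svalP (sof_exists sf)). Qed.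

Definition sd (i : 'I_4) (f : S) : S := sof (csmooth_cpartial oD i (sfunP f).1).

Lemma saddA : associative sadd.
Proof. by move=> f h k; apply: sfield_extT => x /=; rewrite addrA. Qed.
Lemma saddC : commutative sadd.
Proof. by move=> f h; apply: sfield_extT => x /=; rewrite addrC. Qed.
Lemma sadd0 : left_id (scst 0) sadd.
Proof. by move=> f; apply: sfield_extT => x /=; rewrite add0r. Qed.
Lemma saddN : left_inverse (scst 0) sopp sadd.
Proof. by move=> f; apply: sfield_extT => x /=; rewrite addNr. Qed.
HB.instance Definition _ := GRing.isZmodule.Build S saddA saddC sadd0 saddN.

Lemma smulA : associative smul.
Proof. by move=> f h k; apply: sfield_extT => x /=; rewrite mulrA. Qed.
Lemma smulC : commutative smul.
Proof. by move=> f h; apply: sfield_extT => x /=; rewrite mulrC. Qed.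
Lemma smul1 : left_id (scst 1) smul.
Proof. by move=> f; apply: sfield_extT => x /=; rewrite mul1r. Qed.
Lemma smulD : left_distributive smul sadd.
Proof. by move=> f h k; apply: sfield_extT => x /=; rewrite mulrDl. Qed.
Lemma sone_neq0 : scst 1 != scst 0.
Proof.
apply/eqP => /(congr1 (fun f : S => f (base D))) /= /eqP.
by rewrite oner_eq0.
Qed.
HB.instance Definition _ :=
  GRing.Zmodule_isComNzRing.Build S smulA smulC smul1 smulD sone_neq0.

Definition ev (x : pt) (f : S) : C := f x.
Lemma ev_zmod x : GRing.zmod_morphism (ev x). Proof. by []. Qed.
Lemma ev_monoid x : GRing.monoid_morphism (ev x). Proof. by []. Qed.
HB.instance Definition _ x := GRing.isZmodMorphism.Build S C (ev x) (ev_zmod x).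
HB.instance Definition _ x := GRing.isMonoidMorphism.Build S C (ev x) (ev_monoid x).

Lemma sconj_zmod : GRing.zmod_morphism sconj.
Proof. by move=> f h; apply: sfield_extT => x /=; rewrite -rmorphB. Qed.
Lemma sconj_monoid : GRing.monoid_morphism sconj.
Proof.
split; first by apply: sfield_extT => x /=; rewrite rmorph1.
by move=> f h; apply: sfield_extT => x /=; rewrite -rmorphM.
Qed.
HB.instance Definition _ := GRing.isZmodMorphism.Build S S sconj sconj_zmod.
HB.instance Definition _ := GRing.isMonoidMorphism.Build S S sconj sconj_monoid.

Lemma sdE i f x : dom D x -> sd i f x = cpartial i f x.
Proof. exact: sofE. Qed.

Lemma sd_zmod i : GRing.zmod_morphism (sd i).
Proof.
move=> f h; apply: sfield_ext => x Dx; rewrite sdE // [RHS]/= !sdE //.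
have cf := (sfunP f).1; have ch := (sfunP h).1.
by rewrite (cpartialD oD i cf (csmooth_opp oD ch) Dx) (cpartialN oD i ch Dx).
Qed.
HB.instance Definition _ i := GRing.isZmodMorphism.Build S S (sd i) (sd_zmod i).

Lemma sdM i f h : sd i (f * h) = sd i f * h + f * sd i h.
Proof.
apply: sfield_ext => x Dx; rewrite /= !sdE //.
by rewrite (cpartialM oD) //; [exact: (sfunP f).1|exact: (sfunP h).1].
Qed.

Lemma sd_rep i (f : S) (h : pt -> C) x : (forall y, dom D y -> h y = f y) ->
  dom D x -> sd i f x = cpartial i h x.
Proof.
by move=> hf Dx; rewrite sdE // (cpartial_ext oD i hf Dx).
Qed.

Lemma sdC i j f : sd i (sd j f) = sd j (sd i f).
Proof.
have cf := (sfunP f).1.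
have e k y : dom D y -> cpartial k f y = sd k f y by move=> Dy; rewrite sdE.
apply: sfield_ext => x Dx; apply: etrans (sd_rep i (e j) Dx) _.
exact: etrans (cpartialC oD i j cf Dx) (esym (sd_rep j (e i) Dx)).
Qed.

Lemma sd_conj i f : sd i (sconj f) = sconj (sd i f).
Proof.
have cf := (sfunP f).1.
apply: sfield_ext => x Dx; rewrite sdE // (cpartial_conj oD i cf Dx).
by congr (_^*); rewrite sdE.
Qed.

(** The bridge between total functions, arbitrary outside of the domain, and ring elements. As the
    domain is open, partial derivatives respect it. *)
Definition rep (f : pt -> C) (s : S) : Prop := forall x, dom D x -> f x = s x.

Lemma rep_sof f (sf : csmooth (dom D) f) : rep f (sof sf).
Proof. by move=> x Dx; rewrite sofE. Qed.

Lemma rep_add f h s t : rep f s -> rep h t -> rep (fun x => f x + h x) (s + t).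
Proof. by move=> hf hh x Dx; rewrite hf // hh. Qed.

Lemma rep_opp f s : rep f s -> rep (fun x => - f x) (- s).
Proof. by move=> hf x Dx; rewrite hf. Qed.

Lemma rep_mul f h s t : rep f s -> rep h t -> rep (fun x => f x * h x) (s * t).
Proof. by move=> hf hh x Dx; rewrite hf // hh. Qed.

Lemma rep_cst c : rep (fun=> c) (scst c). Proof. by []. Qed.

Lemma rep_conj f s : rep f s -> rep (fun x => (f x)^*) (sconj s).
Proof. by move=> hf x Dx; rewrite hf. Qed.

Lemma rep_sum (I : finType) (f : I -> pt -> C) (s : I -> S) :
  (forall i, rep (f i) (s i)) -> rep (fun x => \sum_i f i x) (\sum_i s i).
Proof.
move=> hf x Dx; rewrite -[RHS]/(ev x _) rmorph_sum /=.
by apply: eq_bigr => i _; exact: hf.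
Qed.

Lemma rep_cpartial i f s : rep f s -> rep (cpartial i f) (sd i s).
Proof. by move=> hf x Dx; rewrite sdE //; exact: cpartial_ext oD _ _ _ hf _ Dx. Qed.

Lemma rep_partial i f s : rep (fun x => (f x)%:C%C) s ->
  rep (fun x => (partial i f x)%:C%C) (sd i s).
Proof. by move=> hf x Dx; rewrite -(rep_cpartial i hf Dx) cpartial_real. Qed.

Lemma rep_eq f s t : rep f s -> rep f t -> s = t.
Proof. by move=> hs ht; apply: sfield_ext => x Dx; rewrite -hs // ht. Qed.

Lemma sfield_inv (s : S) : (forall x, dom D x -> s x != 0) -> exists t, s * t = 1.
Proof.
move=> s0; exists (sof (csmooth_inv oD (sfunP s).1 s0)).
by apply: sfield_ext => x Dx; rewrite /= sofE // divff // s0.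
Qed.

Lemma sfield_mx_inv n (F : 'M[S]_n) : (forall x, dom D x -> map_mx (ev x) F \in unitmx) ->
  exists G : 'M[S]_n, F *m G = 1%:M /\ G *m F = 1%:M.
Proof.
move=> Fu; have [|t dt] := @sfield_inv (\det F).
  by move=> x Dx; have := Fu x Dx; rewrite unitmxE det_map_mx unitfE.
exists (t *: \adj F); rewrite -scalemxAr -scalemxAl mul_mx_adj mul_adj_mx.
by rewrite !scale_scalar_mx mulrC dt.
Qed.

Lemma sfield_mx_ext m n (F G : 'M[S]_(m, n)) :
  (forall x, dom D x -> map_mx (ev x) F = map_mx (ev x) G) -> F = G.
Proof.
move=> h; apply/matrixP => i j; apply: sfield_ext => x Dx.
by have /matrixP/(_ i j) := h x Dx; rewrite !mxE.
Qed.

End SField.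

(** * Matrix-valued fields as matrices over the ring *)

Section MatrixFields.
Variables (R : realType) (D : pointed_open R).
Notation pt := 'rV[R]_4.
Notation C := (R[i]).
Notation S := (sfield D).

Definition sda (i : 'I_4) : {additive S -> S} := sd i.

Definition repmx m n (F : pt -> 'M[C]_(m, n)) (G : 'M[S]_(m, n)) :=
  forall x, dom D x -> F x = map_mx (ev x) G.

Lemma repmxP m n (F : pt -> 'M[C]_(m, n)) (G : 'M[S]_(m, n)) :
  repmx F G <-> forall i j, rep (fun x => F x i j) (G i j).
Proof.
split=> h; first by move=> i j x Dx; rewrite h // mxE.
by move=> x Dx; apply/matrixP => i j; rewrite mxE; exact: h.
Qed.

Lemma repmx_exists m n (F : pt -> 'M[C]_(m, n)) : cmxsmooth (dom D) F ->
  exists G : 'M[S]_(m, n), repmx F G.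
Proof.
move=> sF; exists (\matrix_(i, j) sof (sF i j)); apply/repmxP => i j x Dx.
by rewrite mxE sofE.
Qed.

Lemma repmx_mul m n p (F1 : pt -> 'M[C]_(m, n)) (F2 : pt -> 'M[C]_(n, p)) G1 G2 :
  repmx F1 G1 -> repmx F2 G2 -> repmx (fun x => F1 x *m F2 x) (G1 *m G2).
Proof. by move=> h1 h2 x Dx; rewrite map_mxM h1 // h2. Qed.

Lemma repmx_scale m n f (F : pt -> 'M[C]_(m, n)) s G :
  rep f s -> repmx F G -> repmx (fun x => f x *: F x) (s *: G).
Proof. by move=> h1 h2 x Dx; rewrite map_mxZ h1 // h2. Qed.

Lemma repmx_tr m n (F : pt -> 'M[C]_(m, n)) G :
  repmx F G -> repmx (fun x => (F x)^T) G^T.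
Proof. by move=> h x Dx; rewrite h // map_trmx. Qed.

Lemma repmx_sum (I : finType) m n (F : I -> pt -> 'M[C]_(m, n)) G :
  (forall i, repmx (F i) (G i)) -> repmx (fun x => \sum_i F i x) (\sum_i G i).
Proof.
by move=> h x Dx; rewrite raddf_sum; apply: eq_bigr => i _; exact: h.
Qed.

Lemma repmx_opp m n (F : pt -> 'M[C]_(m, n)) G :
  repmx F G -> repmx (fun x => - F x) (- G).
Proof. by move=> h x Dx; rewrite h // map_mxN. Qed.

Lemma repmx_add m n (F1 F2 : pt -> 'M[C]_(m, n)) G1 G2 :
  repmx F1 G1 -> repmx F2 G2 -> repmx (fun x => F1 x + F2 x) (G1 + G2).
Proof. by move=> h1 h2 x Dx; rewrite map_mxD h1 // h2. Qed.

Lemma repmx_inv n (F : pt -> 'M[C]_n) G Gi : repmx F G -> G *m Gi = 1%:M ->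
  repmx (fun x => invmx (F x)) Gi.
Proof.
move=> h e x Dx; rewrite h //; have : map_mx (ev x) G *m map_mx (ev x) Gi = 1%:M.
  by rewrite -map_mxM e map_mx1.
move=> e'; have u := (mulmx1_unit e').1.
by rewrite -[LHS]mulmx1 -e' mulmxA mulVmx // mul1mx.
Qed.

Lemma repmx_unit n (F : pt -> 'M[C]_n) G : repmx F G ->
  (forall x, dom D x -> F x \in unitmx) ->
  exists Gi : 'M[S]_n, G *m Gi = 1%:M /\ Gi *m G = 1%:M.
Proof. by move=> h u; apply: sfield_mx_inv => x Dx; rewrite -h //; exact: u. Qed.

Lemma repmx_partial m n i (F : pt -> 'M[C]_(m, n)) G : repmx F G ->
  repmx (mxcpartial i F) (map_mx (sd i) G).
Proof.
move=> /repmxP h x Dx; apply/matrixP => a b; rewrite !mxE.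
exact: (rep_cpartial i (h a b) Dx).
Qed.

Lemma repmx_ext m n (F : pt -> 'M[C]_(m, n)) G G' : repmx F G -> repmx F G' -> G = G'.
Proof. by move=> h h'; apply: sfield_mx_ext => x Dx; rewrite -h // h'. Qed.

Lemma repmx_der m n (v : pt -> 'cV[C]_4) vS (F : pt -> 'M[C]_(m, n)) G :
  repmx v vS -> repmx F G ->
  repmx (fun x => \sum_i v x i 0 *: mxcpartial i F x) (map_mx (der sda vS) G).
Proof.
move=> hv hF; rewrite derE; apply: repmx_sum => i.
apply: repmx_scale; first by move/repmxP: hv; apply.
exact: repmx_partial.
Qed.

Lemma rep_der (v : pt -> 'cV[C]_4) vS f s : repmx v vS -> rep f s ->
  rep (fun x => \sum_i v x i 0 * cpartial i f x) (der sda vS s).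
Proof.
move=> hv hf; apply: rep_sum => i; apply: rep_mul; last exact: rep_cpartial.
by move/repmxP: hv; apply.
Qed.

End MatrixFields.

(** * Connection and curvature of the metric as ring elements *)

Section Geometry.
Variables (R : realType) (D : pointed_open R).
Notation pt := 'rV[R]_4.
Notation C := (R[i]).
Notation S := (sfield D).
Variables (g : pt -> 'M[R]_4) (e : frame R).
Variables (gS giS : 'M[S]_4) (eS : 'I_2 -> 'I_2 -> 'cV[S]_4).
Hypotheses (gSP : repmx (fun x => map_mx (real_complex R) (g x)) gS)
  (gSV : gS *m giS = 1%:M)
  (eSP : forall A A', repmx (e A A') (eS A A'))
  (gsym : forall x, dom D x -> (g x)^T = g x).

Definition shalf : S := scst D 2^-1.
Notation half := shalf.
Notation nabS := (nab (@sda R D) half gS giS).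
Notation ipS := (ip gS).
Notation derS := (der (@sda R D)).

Lemma shalf2 : half + half = 1.
Proof. by apply: sfield_extT => x /=; rewrite [RHS]splitr !div1r. Qed.

Lemma gS_sym : gS^T = gS.
Proof.
apply: repmx_ext (repmx_tr gSP) _ => x Dx.
by rewrite map_trmx gsym // gSP.
Qed.

Lemma gS_rep i j : rep (fun x => (g x i j)%:C%C) (gS i j).
Proof. by move=> x Dx; have /matrixP/(_ i j) := gSP Dx; rewrite !mxE. Qed.

Lemma giS_rep i j : rep (fun x => (invmx (g x) i j)%:C%C) (giS i j).
Proof.
move=> x Dx; have /matrixP/(_ i j) := repmx_inv gSP gSV Dx.
by rewrite -map_invmx !mxE.
Qed.

Lemma chr_rep k i j : rep (fun x => (christoffel g k i j x)%:C%C)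
  (chr (@sda R D) half gS giS k i j).
Proof.
have h : rep (fun x => 2^-1 * \sum_l (invmx (g x) k l)%:C%C *
    ((partial i (fun y => g y j l) x)%:C%C + (partial j (fun y => g y i l) x)%:C%C
     - (partial l (fun y => g y i j) x)%:C%C)) (chr (@sda R D) half gS giS k i j).
  apply: rep_mul; first exact: rep_cst.
  apply: rep_sum => l; apply: rep_mul; first exact: giS_rep.
  apply: rep_add; [apply: rep_add|apply: rep_opp]; exact: rep_partial (gS_rep _ _).
move=> x Dx; rewrite -h // /christoffel rmorphM rmorph_sum /= fmorphV rmorph_nat.
congr (_ * _); apply: eq_bigr => l _.
by rewrite rmorphM rmorphB rmorphD.
Qed.

Lemma nab_rep (u w : pt -> 'cV[C]_4) uS wS : repmx u uS -> repmx w wS ->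
  repmx (fun x => \col_k \sum_i u x i 0 * (cpartial i (fun y => w y k 0) x
     + \sum_j (christoffel g k i j x)%:C%C * w x j 0)) (nabS uS wS).
Proof.
move=> /repmxP hu /repmxP hw; apply/repmxP => k z; rewrite ord1.
have -> : nabS uS wS k 0 = \sum_i uS i 0 * (sd i (wS k 0)
   + \sum_j chr (@sda R D) half gS giS k i j * wS j 0).
  rewrite /nab summxE; apply: eq_bigr => i _; rewrite !mxE; congr (_ * (_ + _)).
  by apply: eq_bigr => j _; rewrite mxE.
have h : rep (fun x => \sum_i u x i 0 * (cpartial i (fun y => w y k 0) x
     + \sum_j (christoffel g k i j x)%:C%C * w x j 0)) (\sum_i uS i 0 * (sd i (wS k 0)
   + \sum_j chr (@sda R D) half gS giS k i j * wS j 0)).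
  apply: rep_sum => i; apply: rep_mul => //; apply: rep_add; first exact: rep_cpartial.
  by apply: rep_sum => j; apply: rep_mul => //; exact: chr_rep.
by move=> x Dx; rewrite mxE h.
Qed.

Lemma nabla_frame_rep A A' B B' :
  repmx (nabla_frame g e A A' B B') (nabS (eS A A') (eS B B')).
Proof. exact: (nab_rep (eSP A A') (eSP B B')). Qed.

Lemma gdot_rep (u v : pt -> 'cV[C]_4) uS vS : repmx u uS -> repmx v vS ->
  rep (fun x => gdot g x (u x) (v x)) (ipS uS vS).
Proof.
move=> hu hv.
have /repmxP := repmx_mul (repmx_mul (repmx_tr hu) gSP) hv.
by move/(_ 0 0).
Qed.

Definition seps (A B : 'I_2) : S := scst D (eps R A B).

Lemma gamma_rep A A' B E : rep (gamma g e A A' B E) (half * \sum_B' \sum_D'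
  seps B' D' * ipS (nabS (eS A A') (eS B B')) (eS E D')).
Proof.
apply: rep_mul; first exact: rep_cst.
apply: rep_sum => B'; apply: rep_sum => D'; apply: rep_mul; first exact: rep_cst.
exact: gdot_rep (nabla_frame_rep _ _ _ _) (eSP _ _).
Qed.

Lemma gamma'_rep A A' B' E' : rep (gamma' g e A A' B' E') (half * \sum_B \sum_E
  seps B E * ipS (nabS (eS A A') (eS B B')) (eS E E')).
Proof.
apply: rep_mul; first exact: rep_cst.
apply: rep_sum => B; apply: rep_sum => E; apply: rep_mul; first exact: rep_cst.
exact: gdot_rep (nabla_frame_rep _ _ _ _) (eSP _ _).
Qed.

Lemma riemann_rep a b c f : rep (fun x => (riemann g a b c f x)%:C%C)
  (\sum_k rm (@sda R D) half gS giS a b c k * gS k f).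
Proof.
have h : rep (fun x => \sum_k ((partial a (christoffel g k b c) x)%:C%C
    - (partial b (christoffel g k a c) x)%:C%C
    + \sum_l ((christoffel g k a l x)%:C%C * (christoffel g l b c x)%:C%C
       - (christoffel g k b l x)%:C%C * (christoffel g l a c x)%:C%C)) * (g x k f)%:C%C)
  (\sum_k rm (@sda R D) half gS giS a b c k * gS k f).
  apply: rep_sum => k; apply: rep_mul; last exact: gS_rep.
  apply: rep_add.
    apply: rep_add; last apply: rep_opp; exact: rep_partial (chr_rep _ _ _).
  apply: rep_sum => l; apply: rep_add; last apply: rep_opp; apply: rep_mul;
    exact: chr_rep.
move=> x Dx; rewrite -h // /riemann rmorph_sum; apply: eq_bigr => k _.
rewrite rmorphM rmorphD rmorphB rmorph_sum; congr ((_ + _) * _).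
by apply: eq_bigr => l _; rewrite rmorphB !rmorphM.
Qed.

Lemma eS_rep A A' i : rep (fun x => e A A' x i 0) (eS A A' i 0).
Proof. by move/repmxP: (eSP A A'); apply. Qed.

Lemma curvature_spinor_rep A B E F : rep (curvature_spinor g e A B E F)
  (scst D 4^-1 * \sum_A' \sum_B' \sum_E' \sum_F' seps A' B' * seps E' F' *
   ipS (curv (@sda R D) half gS giS (eS A A') (eS B B') (eS E E')) (eS F F')).
Proof.
apply: rep_mul; first exact: rep_cst.
do 4![apply: rep_sum => ?]; apply: rep_mul; first by apply: rep_mul; exact: rep_cst.
rewrite (ip_curv (@sdM R D) (@sdC R D) half giS gS_sym).
do 4![apply: rep_sum => ?].
by do 4![apply: rep_mul; last exact: eS_rep]; exact: riemann_rep.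
Qed.

End Geometry.

Lemma sum2 (V : nmodType) (F : 'I_2 -> V) : \sum_i F i = F 0 + F 1.
Proof.
rewrite !big_ord_recl big_ord0 addr0; congr (_ + F _); exact: val_inj.
Qed.

Lemma ord2P (P : 'I_2 -> Prop) : P 0 -> P 1 -> forall i, P i.
Proof.
move=> h0 h1 [[|[|n]] h] //; first by rewrite (_ : Ordinal h = 0) //; exact: val_inj.
by rewrite (_ : Ordinal h = 1) //; exact: val_inj.
Qed.

(** * Spin frames *)

Section ClosedForm.
Variables (S : comNzRingType) (d : 'I_4 -> {additive S -> S}).
Hypothesis dM : forall i x y, d i (x * y) = d i x * y + x * d i y.
Variables (half : S) (g gi : 'M[S]_4).
Hypothesis g_sym : g^T = g.
Variable ka : 'M[S]_4.
Hypotheses (ka_alt : ka^T = - ka)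
  (ka_closed : forall i j k, d i (ka j k) + d j (ka k i) + d k (ka i j) = 0).

Let kf (u v : 'cV[S]_4) : S := (u^T *m ka *m v) 0 0.

Lemma form_alt u v : kf u v = - kf v u.
Proof.
have -> : kf u v = (u^T *m ka *m v)^T 0 0 by rewrite mxE.
by rewrite !trmx_mul trmxK ka_alt mulmxA mulmxN mulNmx mxE.
Qed.

Lemma form_der u v w : der d u (kf v w) = kf (map_mx (der d u) v) w
  + kf v (map_mx (der d u) w)
  + \sum_i \sum_j \sum_k u i 0 * v j 0 * w k 0 * d i (ka j k).
Proof.
have dP : derivation (der d u) by split; [exact: derD|exact: derM].
have -> : der d u (kf v w) = map_mx (der d u) (v^T *m ka *m w) 0 0 by rewrite mxE.
have h : (v^T *m map_mx (der d u) ka *m w) 0 0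
    = \sum_i \sum_j \sum_k u i 0 * v j 0 * w k 0 * d i (ka j k).
  rewrite exchange_big; under eq_bigr => j _ do rewrite exchange_big /=.
  rewrite exchange_big mxE; apply: eq_bigr => k _ /=; rewrite mxE mulr_suml.
  apply: eq_bigr => j _; rewrite !mxE /der mulr_sumr mulr_suml.
  by apply: eq_bigr => i _; ring.
rewrite !(mapdM dP) -map_trmx mulmxDl mxE [X in X + _]mxE h /kf; ring.
Qed.

Lemma formDl u u' v : kf (u + u') v = kf u v + kf u' v.
Proof. by rewrite /kf linearD /= !mulmxDl mxE. Qed.
Lemma formNl u v : kf (- u) v = - kf u v.
Proof. by rewrite /kf linearN /= !mulNmx mxE. Qed.

(** Cartan's formula: the derivatives of the vector fields cancel against the brackets by skew
    symmetry, and the cyclic coordinate derivative remains. *)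
Lemma closed_brk u v w :
  der d u (kf v w) + der d v (kf w u) + der d w (kf u v)
  - kf (brk d half g gi u v) w - kf (brk d half g gi v w) u
  - kf (brk d half g gi w u) v = 0.
Proof.
rewrite !(brkE d half gi g_sym) !form_der !formDl !formNl.
rewrite (form_alt v (map_mx _ w)) (form_alt w (map_mx _ u)) (form_alt u (map_mx _ v)).
set s1 := \sum_i _; set s2 := \sum_i _; set s3 := \sum_i _.
suff h : s1 + s2 + s3 = 0 by rewrite -h; ring.
have -> : s2 = \sum_i \sum_j \sum_k u i 0 * v j 0 * w k 0 * d j (ka k i).
  rewrite /s2; under eq_bigr => i _ do rewrite exchange_big /=.
  rewrite exchange_big /=; apply: eq_bigr => i _; apply: eq_bigr => j _.
  by apply: eq_bigr => k _; ring.
have -> : s3 = \sum_i \sum_j \sum_k u i 0 * v j 0 * w k 0 * d k (ka i j).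
  rewrite /s3 exchange_big /=; apply: eq_bigr => i _; rewrite exchange_big /=.
  by apply: eq_bigr => j _; apply: eq_bigr => k _; ring.
rewrite -!big_split big1 // => i _; rewrite -!big_split big1 // => j _.
by rewrite -!big_split big1 // => k _ /=; rewrite -!mulrDr ka_closed mulr0.
Qed.

End ClosedForm.

Section Conjugate.
Variables (S : comNzRingType) (d : 'I_4 -> {additive S -> S}).
Variables (half : S) (g gi : 'M[S]_4) (cs : {rmorphism S -> S}).
Hypotheses (cs_d : forall i f, cs (d i f) = d i (cs f))
  (cs_g : map_mx cs g = g)
  (cs_chr : forall k i j, cs (chr d half g gi k i j) = chr d half g gi k i j).

Lemma ip_conj u v : cs (ip g u v) = ip g (map_mx cs u) (map_mx cs v).
Proof. by rewrite /ip -[in RHS]cs_g map_trmx -!map_mxM [RHS]mxE. Qed.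

Lemma nab_conj u w :
  map_mx cs (nab d half g gi u w) = nab d half g gi (map_mx cs u) (map_mx cs w).
Proof.
apply/matrixP => k z; rewrite ord1 mxE /nab !summxE rmorph_sum; apply: eq_bigr => i _.
rewrite !mxE rmorphM rmorphD /= cs_d rmorph_sum; congr (_ * (_ + _)).
by apply: eq_bigr => j _; rewrite rmorphM !mxE cs_chr.
Qed.

End Conjugate.

Definition sg (S : comNzRingType) (A B : 'I_2) : S := ((A < B)%N)%:R - ((B < A)%N)%:R.
Arguments sg {S}.

Section Signs.
Variable S : comNzRingType.
Lemma sg00 : sg 0 0 = 0 :> S. Proof. by rewrite /sg subrr. Qed.
Lemma sg11 : sg 1 1 = 0 :> S. Proof. by rewrite /sg subrr. Qed.
Lemma sg01 : sg 0 1 = 1 :> S. Proof. by rewrite /sg subr0. Qed.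
Lemma sg10 : sg 1 0 = - 1 :> S. Proof. by rewrite /sg sub0r. Qed.

Lemma spin_div_expand m n (io : 'I_2 -> S) (W : 'I_2 -> 'M[S]_(m, n))
    (G : 'I_2 -> 'I_2 -> 'I_2 -> 'I_2 -> S) (Dd : 'I_2 -> 'I_2 -> S -> S) :
  \sum_A' \sum_B' sg A' B' *: \sum_A io A *: (map_mx (Dd A B') (W A')
    - \sum_D' \sum_E' (sg D' E' * G A B' A' E') *: W D')
  = (io 0 *: map_mx (Dd 0 1) (W 0) + io 1 *: map_mx (Dd 1 1) (W 0))
    - (io 0 *: map_mx (Dd 0 0) (W 1) + io 1 *: map_mx (Dd 1 0) (W 1))
    + (io 0 * G 0 0 1 1 + io 1 * G 1 0 1 1 - (io 0 * G 0 1 0 1 + io 1 * G 1 1 0 1)) *: W 0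
    + (io 0 * G 0 1 0 0 + io 1 * G 1 1 0 0 - (io 0 * G 0 0 1 0 + io 1 * G 1 0 1 0)) *: W 1.
Proof.
rewrite !sum2 sg00 sg01 sg10 sg11.
apply/matrixP => i j; rewrite !mxE; ring.
Qed.

Lemma spin_contract (F : 'I_2 -> 'I_2 -> 'I_2 -> 'I_2 -> S) :
  \sum_A' \sum_B' \sum_E' \sum_F' sg A' B' * sg E' F' * F A' B' E' F'
  = F 0 1 0 1 - F 0 1 1 0 - F 1 0 0 1 + F 1 0 1 0.
Proof. rewrite !sum2 sg00 sg01 sg10 sg11; ring. Qed.

Lemma sum_der (d : 'I_4 -> {additive S -> S}) (p : 'I_2 -> S) (v : 'I_2 -> 'cV[S]_4)
    m n (F : 'M[S]_(m, n)) :
  \sum_A p A *: map_mx (der d (v A)) F = map_mx (der d (\sum_A p A *: v A)) F.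
Proof.
by rewrite !sum2; apply/matrixP => i j; rewrite [RHS]mxE derDl !derZl !mxE.
Qed.
End Signs.

(** * The adapted spinor supplies the hypotheses of the null frame *)

Section SpinGeometry.
Variables (S : comNzRingType) (d : 'I_4 -> {additive S -> S}).
Hypotheses (dM : forall i x y, d i (x * y) = d i x * y + x * d i y)
  (dC : forall i j x, d i (d j x) = d j (d i x)).
Variables (half : S) (g gi : 'M[S]_4).
Hypotheses (half2 : half + half = 1) (g_sym : g^T = g)
  (ggi : g *m gi = 1%:M).
Notation V := 'cV[S]_4.
Let D := der d.
Let N := nab d half g gi.
Let ipg := ip g.

Let sgE := (sg00 S, sg01 S, sg10 S, sg11 S).

Variables (e : 'I_2 -> 'I_2 -> V) (o io : 'I_2 -> S) (cs : {rmorphism S -> S}).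
Hypotheses (e_gram : forall A A' B B', ipg (e A A') (e B B') = sg A B * sg A' B')
  (e_conj : forall A A', map_mx cs (e A A')
     = \sum_B \sum_B' (sg A B * sg A' B') *: e B B')
  (cs_d : forall i f, cs (d i f) = d i (cs f)) (cs_g : map_mx cs g = g)
  (cs_chr : forall k i j, cs (chr d half g gi k i j) = chr d half g gi k i j)
  (cs_half : cs half = half) (csK : involutive cs)
  (io0 : io 0 = - cs (o 1)) (io1 : io 1 = cs (o 0)).

Definition low (p : 'I_2 -> S) (B : 'I_2) : S := \sum_A p A * sg A B.
Definition vX (A' : 'I_2) : V := \sum_A o A *: e A A'.
Definition vY (A' : 'I_2) : V := \sum_A io A *: e A A'.

Variables (chi chii phi phii I : S) (J : 'M[S]_4).
Hypotheses (chiE : chi = \sum_A low o A * io A) (chiV : chi * chii = 1)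
  (phiV : phi * phii = 1) (I2 : I * I = - 1) (dI : forall i, d i I = 0)
  (JJ : J *m J = - 1%:M) (Jg : J^T *m g *m J = g)
  (Je : forall B B', J *m e B B' = \sum_A (I * chii *
     (o A * low io B + io A * low o B)) *: e A B').
Let ka := (phi * phi) *: (J^T *m g).
Hypothesis ka_closed : forall i j k,
  d i (ka j k) + d j (ka k i) + d k (ka i j) = 0.

Definition ga (u : V) (B E : 'I_2) : S :=
  half * \sum_B' \sum_D' sg B' D' * ipg (N u (e B B')) (e E D').
Definition ga' (u : V) (B' D' : 'I_2) : S :=
  half * \sum_B \sum_E sg B E * ipg (N u (e B B')) (e E D').
Hypothesis parallel : forall A' B,
  \sum_A o A * (D (e A A') (low o B)
    - \sum_F \sum_E sg F E * ga (e A A') B E * low o F) = 0.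

Let X0 := vX 0. Let X1 := vX 1. Let Y0 := vY 0. Let Y1 := vY 1.

Let DD u f h : D u (f + h) = D u f + D u h. Proof. exact: derD. Qed.
Let DM u f h : D u (f * h) = D u f * h + f * D u h. Proof. exact: derM. Qed.
Let DN u f : D u (- f) = - D u f. Proof. exact: derN. Qed.
Let DDl u v f : D (u + v) f = D u f + D v f. Proof. exact: derDl. Qed.
Let DZl a u f : D (a *: u) f = a * D u f. Proof. exact: derZl. Qed.
Let ipgDl u v w : ipg (u + v) w = ipg u w + ipg v w. Proof. exact: ipDl. Qed.
Let ipgZl a u w : ipg (a *: u) w = a * ipg u w. Proof. exact: ipZl. Qed.
Let ipgC u v : ipg u v = ipg v u. Proof. exact: ipC. Qed.
Let NDr u v w : N u (v + w) = N u v + N u w. Proof. exact: nabDr. Qed.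
Let NZr u a w : N u (a *: w) = D u a *: w + a *: N u w. Proof. exact: nabZr. Qed.
Let NDl u v w : N (u + v) w = N u w + N v w. Proof. exact: nabDl. Qed.
Let NZl a u w : N (a *: u) w = a *: N u w. Proof. exact: nabZl. Qed.
Let D_ip u v w : D u (ipg v w) = ipg (N u v) w + ipg v (N u w).
Proof. exact: der_ip. Qed.
Let D_brk u v f : D ((fun u v => N u v - N v u) u v) f = D u (D v f) - D v (D u f).
Proof. exact: der_brk. Qed.

Let X0E : X0 = o 0 *: e 0 0 + o 1 *: e 1 0. Proof. exact: sum2. Qed.
Let X1E : X1 = o 0 *: e 0 1 + o 1 *: e 1 1. Proof. exact: sum2. Qed.
Let Y0E : Y0 = io 0 *: e 0 0 + io 1 *: e 1 0. Proof. exact: sum2. Qed.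
Let Y1E : Y1 = io 0 *: e 0 1 + io 1 *: e 1 1. Proof. exact: sum2. Qed.

Let g00_00 : ipg (e 0 0) (e 0 0) = 0. Proof. by rewrite e_gram !sgE; ring. Qed.
Let g00_01 : ipg (e 0 0) (e 0 1) = 0. Proof. by rewrite e_gram !sgE; ring. Qed.
Let g00_10 : ipg (e 0 0) (e 1 0) = 0. Proof. by rewrite e_gram !sgE; ring. Qed.
Let g00_11 : ipg (e 0 0) (e 1 1) = 1. Proof. by rewrite e_gram !sgE; ring. Qed.
Let g01_01 : ipg (e 0 1) (e 0 1) = 0. Proof. by rewrite e_gram !sgE; ring. Qed.
Let g01_10 : ipg (e 0 1) (e 1 0) = - 1. Proof. by rewrite e_gram !sgE; ring. Qed.
Let g01_11 : ipg (e 0 1) (e 1 1) = 0. Proof. by rewrite e_gram !sgE; ring. Qed.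
Let g10_10 : ipg (e 1 0) (e 1 0) = 0. Proof. by rewrite e_gram !sgE; ring. Qed.
Let g10_11 : ipg (e 1 0) (e 1 1) = 0. Proof. by rewrite e_gram !sgE; ring. Qed.
Let g11_11 : ipg (e 1 1) (e 1 1) = 0. Proof. by rewrite e_gram !sgE; ring. Qed.

Let chiE' : chi = o 0 * io 1 - o 1 * io 0.
Proof. by rewrite chiE sum2 /low !sum2 !sgE; ring. Qed.

Let ipgDr w u v : ipg w (u + v) = ipg w u + ipg w v. Proof. exact: ipDr. Qed.
Let ipgZr w a u : ipg w (a *: u) = a * ipg w u. Proof. exact: ipZr. Qed.

Ltac gram_calc := rewrite ?X0E ?X1E ?Y0E ?Y1E ?chiE'
  !(ipgDl, ipgDr, ipgZl, ipgZr) !e_gram !sgE; ring.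

Let x00 : ipg X0 X0 = 0. Proof. by gram_calc. Qed.
Let x01 : ipg X0 X1 = 0. Proof. by gram_calc. Qed.
Let x11 : ipg X1 X1 = 0. Proof. by gram_calc. Qed.
Let y00 : ipg Y0 Y0 = 0. Proof. by gram_calc. Qed.
Let y01 : ipg Y0 Y1 = 0. Proof. by gram_calc. Qed.
Let y11 : ipg Y1 Y1 = 0. Proof. by gram_calc. Qed.
Let xy00 : ipg X0 Y0 = 0. Proof. by gram_calc. Qed.
Let xy11 : ipg X1 Y1 = 0. Proof. by gram_calc. Qed.
Let xy01 : ipg X0 Y1 = chi. Proof. by gram_calc. Qed.
Let xy10 : ipg X1 Y0 = - chi. Proof. by gram_calc. Qed.

(** Cramer's rule, [chi] being the determinant of [o] and [iota]. *)
Lemma e_chi A' : chi *: e 0 A' = io 1 *: vX A' - o 1 *: vY A' /\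
  chi *: e 1 A' = o 0 *: vY A' - io 0 *: vX A'.
Proof.
by rewrite /vX /vY !sum2 chiE'; split; apply/matrixP => i j; rewrite !mxE; ring.
Qed.

(* The dual frame inverts the frame on one side, hence on both. *)
Lemma e_nondeg w : (forall A A', ipg w (e A A') = 0) -> w = 0.
Proof.
move=> h; pose f (j : 'I_4) := nth 0 [:: e 0 0; e 0 1; e 1 0; e 1 1] j.
pose f' (j : 'I_4) := nth 0 [:: e 1 1; - e 1 0; - e 0 1; e 0 0] j.
have ipN u v : ipg (- u) v = - ipg u v by rewrite -scaleN1r ipgZl mulN1r.
have dual i j : ipg (f' i) (f j) = (i == j)%:R.
  case: i => -[|[|[|[|i]]]] hi //; case: j => -[|[|[|[|j]]]] hj //;
    rewrite /f /f' /= ?ipN e_gram !sgE /=; ring.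
pose E : 'M[S]_4 := \matrix_(k, j) f j k 0; pose F : 'M[S]_4 := \matrix_(i, k) f' i k 0.
have FE : F *m g *m E = 1%:M.
  apply/matrixP => i j; rewrite [RHS]mxE -dual [LHS]mxE [RHS]mxE; apply: eq_bigr => l _.
  have -> : E l j = f j l 0 by rewrite mxE.
  congr (_ * _); rewrite [LHS]mxE [RHS]mxE; apply: eq_bigr => k _.
  by congr (_ * _); rewrite [LHS]mxE [RHS]mxE.
have EF := mulmx1C FE.
have wE : w^T *m g *m E = 0.
  apply/matrixP => z j; rewrite ord1 [RHS]mxE.
  have <- : ipg w (f j) = 0 by case: j => -[|[|[|[|j]]]] hj //; rewrite /f /= h.
  rewrite [LHS]mxE [RHS]mxE; apply: eq_bigr => l _; congr (_ * _).
  by rewrite [LHS]mxE.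
have wg : w^T *m g = 0 by rewrite -[LHS]mulmx1 -EF mulmxA wE mul0mx.
by apply: trmx_inj; rewrite -[w^T]mulmx1 -ggi mulmxA wg mul0mx trmx0.
Qed.

Let nondeg w : ipg w X0 = 0 -> ipg w X1 = 0 -> ipg w Y0 = 0 -> ipg w Y1 = 0 -> w = 0.
Proof.
move=> h0 h1 h2 h3; apply: e_nondeg => A A'.
have c x : chi * x = 0 -> x = 0.
  by move=> hx; rewrite -[x]mul1r -chiV mulrAC hx mul0r.
have hX : ipg w (vX A') = 0.
  by move: A' {A}; apply: ord2P.
have hY : ipg w (vY A') = 0.
  by move: A' {A hX}; apply: ord2P.
apply: c; rewrite -ipgZr; move: A; apply: ord2P.
  by rewrite (e_chi A').1 -scaleNr ipgDr !ipgZr hX hY; ring.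
by rewrite (e_chi A').2 -scaleNr ipgDr !ipgZr hX hY; ring.
Qed.

Notation ca := (co_a N ipg half X0 X1 Y0 Y1 chii).
Notation cmu := (co_mu N ipg X0 X1 chii).
Notation cb := (co_b N ipg half X0 X1 Y0 Y1 chii).
Notation clam := (co_lam N ipg Y0 Y1 chii).

Let parallel_u A' : ca (vX A') = 0 /\ cmu (vX A') = 0.
Proof.
have low0 : low o 0 = - o 1 by rewrite /low sum2 !sgE; ring.
have low1 : low o 1 = o 0 by rewrite /low sum2 !sgE; ring.
have nX B B' : N (vX A') (e B B') = o 0 *: N (e 0 A') (e B B') + o 1 *: N (e 1 A') (e B B').
  by rewrite /vX sum2 NDl !NZl.
have DX f : D (vX A') f = o 0 * D (e 0 A') f + o 1 * D (e 1 A') f.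
  by rewrite /vX sum2 DDl !DZl.
apply: (spin_parallel half2 DD DM ipgDl ipgZl ipgC NDr NZr D_ip chii X0E X1E Y0E Y1E
  g00_01 g00_11 g01_10 g10_11).
  have := parallel A' 0; rewrite /ga !(sum2, sgE) low0 low1 => h.
  by rewrite !nX !DX !ipgDl !ipgZl -[RHS]h !DN; ring.
have := parallel A' 1; rewrite /ga !(sum2, sgE) low0 low1 => h.
by rewrite !nX !DX !ipgDl !ipgZl -[RHS]h; ring.
Qed.

Let aX0 : ca X0 = 0. Proof. by case: (parallel_u 0). Qed.
Let aX1 : ca X1 = 0. Proof. by case: (parallel_u 1). Qed.
Let muX0 : cmu X0 = 0. Proof. by case: (parallel_u 0). Qed.
Let muX1 : cmu X1 = 0. Proof. by case: (parallel_u 1). Qed.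

Let cjv : V -> V := map_mx cs.

Let cjX0 : cjv X0 = Y1.
Proof.
rewrite /cjv X0E Y1E map_mxD !map_mxZ !e_conj !sum2 !sgE io0 io1.
by apply/matrixP => i j; rewrite !mxE; ring.
Qed.
Let cjX1 : cjv X1 = - Y0.
Proof.
rewrite /cjv X1E Y0E map_mxD !map_mxZ !e_conj !sum2 !sgE io0 io1.
by apply/matrixP => i j; rewrite !mxE; ring.
Qed.
Let cjK v : cjv (cjv v) = v.
Proof. by apply/matrixP => i j; rewrite !mxE csK. Qed.
Let cjY1 : cjv Y1 = X0. Proof. by rewrite -cjX0 cjK. Qed.
Let cjY0 : cjv Y0 = - X1. Proof. by rewrite -[Y0]opprK -cjX1 /cjv map_mxN -/cjv cjK. Qed.

(** With [iota] the conjugate spinor, [chi] is the sum of the squared moduli of the components of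
    [o], hence real. *)
Let cs_chii : cs chii = chii.
Proof.
have h : cs chi = chi by rewrite chiE' io0 io1 rmorphB !rmorphM rmorphN /= !csK; ring.
rewrite -[LHS]mul1r -chiV mulrAC -{1}h -rmorphM chiV rmorph1; ring.
Qed.

Let conjS : [/\ cb Y0 = 0, cb Y1 = 0, clam Y0 = 0 & clam Y1 = 0].
Proof.
apply: (conj_scaling DD ipgZl ipgC NDr NZl D_ip y01 (cs := cs) (cj := cjv)) => //.
- exact: rmorphB.
- exact: rmorphM.
- exact: ip_conj.
- exact: nab_conj.
Qed.

Let bY0 : cb Y0 = 0. Proof. by case: conjS. Qed.
Let bY1 : cb Y1 = 0. Proof. by case: conjS. Qed.
Let lamY0 : clam Y0 = 0. Proof. by case: conjS. Qed.
Let lamY1 : clam Y1 = 0. Proof. by case: conjS. Qed.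

Let gJ : g *m J = - (J^T *m g).
Proof. by rewrite -{1}Jg -mulmxA JJ mulmxN mulmx1. Qed.

Let ka_alt : ka^T = - ka.
Proof. by rewrite /ka linearZ /= trmx_mul trmxK g_sym gJ scalerN. Qed.

(** The relation [chi * chii = 1] solved for one monomial, as [ring] needs it. *)
Let chi_rule : o 0 * io 1 * chii = 1 + o 1 * io 0 * chii.
Proof. by rewrite -chiV chiE'; ring. Qed.

(** Contracting with [o^B] kills [o_B] and turns [iota_B] into [- chi]. So the [X] are eigenvectors
    of [J] for [-i], and likewise the [Y] for [i]. *)
Let JX B' : J *m vX B' = - I *: vX B'.
Proof.
rewrite /vX !sum2 mulmxDr -!scalemxAr !Je !sum2 /low !sum2 !sgE.
by apply/matrixP => i j; rewrite !mxE; ring: chi_rule.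
Qed.
Let JY B' : J *m vY B' = I *: vY B'.
Proof.
rewrite /vY !sum2 mulmxDr -!scalemxAr !Je !sum2 /low !sum2 !sgE.
by apply/matrixP => i j; rewrite !mxE; ring: chi_rule.
Qed.

Let kf (u v : V) : S := (u^T *m ka *m v) 0 0.

Let kfJ u w : kf u w = phi * phi * ipg (J *m u) w.
Proof.
by rewrite /kf /ka /ipg /ip trmx_mul -scalemxAr -scalemxAl [LHS]mxE !mulmxA.
Qed.

Let kX B' w : kf (vX B') w = - (I * phi * phi * ipg (vX B') w).
Proof. by rewrite kfJ JX ipgZl; ring. Qed.
Let kY B' w : kf (vY B') w = I * phi * phi * ipg (vY B') w.
Proof. by rewrite kfJ JY ipgZl; ring. Qed.

Let DI u : D u I = 0.
Proof. by apply: big1 => i _; rewrite dI mulr0. Qed.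

Let kfC u v : kf u v = - kf v u. Proof. exact: form_alt. Qed.
Let kclosed u v w : D u (kf v w) + D v (kf w u) + D w (kf u v)
  - kf (brk d half g gi u v) w - kf (brk d half g gi v w) u
  - kf (brk d half g gi w u) v = 0.
Proof. exact: closed_brk. Qed.

Let muY : cmu Y0 = - phii * D X0 phi /\ cmu Y1 = - phii * D X1 phi.
Proof.
exact: (kaehler_mu half2 DD DM ipgDl ipgZl ipgC D_ip chiV x00 x01 x11 y00 y01 y11
  xy00 xy11 xy01 xy10 nondeg I2 DI phiV kfC (kX 0) (kX 1) (kY 0) (kY 1) kclosed
  aX0 aX1 muX0 muX1).
Qed.
Let lamX : clam X0 = - phii * D Y0 phi /\ clam X1 = - phii * D Y1 phi.
Proof.
exact: (kaehler_lam half2 DD DM ipgDl ipgZl ipgC D_ip chiV x00 x01 x11 y00 y01 y11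
  xy00 xy11 xy01 xy10 nondeg I2 DI phiV kfC (kX 0) (kX 1) (kY 0) (kY 1) kclosed
  bY0 bY1 lamY0 lamY1).
Qed.

Definition cc0 := divc0 N ipg half X0 X1 Y0 Y1 chii.
Definition cc1 := divc1 N ipg half X0 X1 Y0 Y1 chii.
Definition dd0 := divd0 N ipg half X0 X1 Y0 Y1 chii.
Definition dd1 := divd1 N ipg half X0 X1 Y0 Y1 chii.

Lemma spin_comm_x f :
  D X0 (D X1 f) - D X1 (D X0 f) = dd0 * D X0 f + dd1 * D X1 f.
Proof.
exact: (D_X01 half2 DD DDl DZl ipgDl ipgZl ipgC D_ip D_brk chiV x00 x01 x11 y00 y01
  y11 xy00 xy11 xy01 xy10 nondeg).
Qed.

Lemma spin_comm_y f :
  D Y0 (D Y1 f) - D Y1 (D Y0 f) = cc0 * D Y0 f + cc1 * D Y1 f.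
Proof.
exact: (D_Y01 half2 DD DDl DZl ipgDl ipgZl ipgC D_ip D_brk chiV x00 x01 x11 y00 y01
  y11 xy00 xy11 xy01 xy10 nondeg).
Qed.

Let r := chii * phi.

Lemma spin_exch f :
  D Y1 (r * D X0 f) - D Y0 (r * D X1 f) + cc0 * (r * D X0 f) + cc1 * (r * D X1 f)
  + (D X1 (r * D Y0 f) - D X0 (r * D Y1 f)
  + dd0 * (r * D Y0 f) + dd1 * (r * D Y1 f)) = 0.
Proof.
exact: (div_exchange half2 DD DM DDl DZl ipgDl ipgZl ipgC D_ip D_brk chiV x00 x01 x11
  y00 y01 y11 xy00 xy11 xy01 xy10 nondeg phiV aX0 aX1 bY0 bY1 muY.1 muY.2
  lamX.1 lamX.2).
Qed.

Let ga'Y B' C' E' : ga' (vY B') C' E' = io 0 * ga' (e 0 B') C' E' + io 1 * ga' (e 1 B') C' E'.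
Proof.
rewrite /ga' /vY !sum2 !NDl !NZl !ipgDl !ipgZl; ring.
Qed.

Lemma spin_div m n (W : 'I_2 -> 'M[S]_(m, n)) :
  \sum_A' \sum_B' sg A' B' *: \sum_A io A *: (map_mx (D (e A B')) (W A')
    - \sum_D' \sum_E' (sg D' E' * ga' (e A B') A' E') *: W D')
  = ydiv (D Y0) (D Y1) cc0 cc1 (W 0) (W 1).
Proof.
have h00 u : co_h00 N ipg X0 Y0 chii u = ga' u 0 0.
  rewrite -(h00_spin half2 DD ipgDl ipgZl ipgC NDr NZr D_ip chiV xy01 X0E Y0E Y1E
    g00_00 g00_01 g00_10 g00_11 g01_10 g10_10 g10_11) /ga' !sum2 !sgE; ring.
have h11 u : co_h11 N ipg X1 Y1 chii u = ga' u 1 1.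
  rewrite -(h11_spin half2 DD ipgDl ipgZl ipgC NDr NZr D_ip chiV xy01 X0E X1E Y1E)
    // /ga' !sum2 !sgE; ring.
have h01 u : co_h01 N ipg half X0 X1 Y0 Y1 chii u = ga' u 0 1.
  rewrite -(h01_spin half DD DM ipgDl ipgZl ipgC NDr NZr D_ip chiV xy01 X0E X1E Y0E
    Y1E) // /ga' !sum2 !sgE; ring.
have h10 u : co_h01 N ipg half X0 X1 Y0 Y1 chii u = ga' u 1 0.
  rewrite -(h10_spin half DD DM ipgDl ipgZl ipgC NDr NZr D_ip chiV xy01 X0E X1E Y0E
    Y1E) // /ga' !sum2 !sgE; ring.
have DY B' f : D (vY B') f = io 0 * D (e 0 B') f + io 1 * D (e 1 B') f.
  by rewrite /vY sum2 DDl !DZl.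
have -> : cc0 = ga' Y0 1 1 - ga' Y1 0 1 by rewrite /cc0 /divc0 h11 h01.
have -> : cc1 = ga' Y1 0 0 - ga' Y0 1 0 by rewrite /cc1 /divc1 h00 h10.
rewrite (spin_div_expand io W (fun A B' A' E' => ga' (e A B') A' E')
  (fun A B' => D (e A B'))).
have g1 := ga'Y 0 1 1; have g2 := ga'Y 1 0 1.
have g3 := ga'Y 1 0 0; have g4 := ga'Y 0 1 0.
have mY B' (F : 'M[S]_(m, n)) :
    map_mx (D (vY B')) F = io 0 *: map_mx (D (e 0 B')) F + io 1 *: map_mx (D (e 1 B')) F.
  by apply/matrixP => i j; rewrite [LHS]mxE DY !mxE.
rewrite /ydiv (mY 0) (mY 1); congr (_ - _ + _ *: _ + _ *: _).
  by rewrite g1 g2; ring.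
by rewrite g3 g4; ring.
Qed.

(** Taken without the factor 1/4 of the curvature spinor, to match [curv_spinor]. *)
Definition cspin A B E F : S := \sum_A' \sum_B' \sum_E' \sum_F' sg A' B' * sg E' F' *
  ipg (curv d half g gi (e A A') (e B B') (e E E')) (e F F').
Definition csym A B E F : S := cspin A B E F + cspin A E B F + cspin A F B E
  + cspin B E A F + cspin B F A E + cspin E F A B.

Let sp A := (e A 0, e A 1).
Lemma cspinE A B E F :
  cspin A B E F = curv_spinor N ipg (sp A) (sp B) (sp E) (sp F).
Proof.
exact: (spin_contract (fun A' B' E' F' =>
  ipg (curv d half g gi (e A A') (e B B') (e E E')) (e F F'))).
Qed.

Lemma cspin12 A B E F : cspin B A E F = cspin A B E F.
Proof. by rewrite !cspinE; apply: curv_spinorC. Qed.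

Lemma cspin34 A B E F : cspin A B F E = cspin A B E F.
Proof. by rewrite !cspinE; apply: (curv_spinorC' DD (ip := ipg) (D := D)). Qed.

Lemma spin_weyl : (forall A B E F, csym A B E F = 0) <->
  box (D X0) (D X1) (D Y0) (D Y1) cc0 cc1 r = 0.
Proof.
have sE A B E F : csym A B E F = sym_spinor N ipg (sp A) (sp B) (sp E) (sp F).
  by rewrite /csym /sym_spinor !cspinE.
have span := sym_spinor_span DD ipgDl ipgZl ipgC NDr NZr NDl NZl D_ip D_brk.
have XY := sym_spinor_XY half2 DD DM DDl DZl ipgDl ipgZl ipgC NDr NZr NDl NZl D_ip D_brk
  chiV x00 x01 x11 y00 y01 y11 xy00 xy11 xy01 xy10 nondeg phiV aX0 aX1 muX0 muX1
  bY0 bY1 lamY0 lamY1 muY.1 muY.2 lamX.1 lamX.2.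
pose xy (i : 'I_2) : V * V := if i == 0 then (X0, X1) else (Y0, Y1).
apply: iff_trans XY; split=> h.
  have h' i j k l : sym_spinor N ipg (xy i) (xy j) (xy k) (xy l) = 0.
    move: i j k l; apply: (span sp); last by move=> *; rewrite -sE.
    apply: ord2P; [exists (o 0), (o 1)|exists (io 0), (io 1)].
      by rewrite /xy /lin_comb /= X0E X1E.
    by rewrite /xy /lin_comb /= Y0E Y1E.
  move=> P Q T W hP hQ hT hW.
  have ex Z : Z = (X0, X1) \/ Z = (Y0, Y1) -> exists i, Z = xy i.
    by case=> ->; [exists 0|exists 1].
  have [i ->] := ex _ hP; have [j ->] := ex _ hQ; have [k ->] := ex _ hT.
  by have [l ->] := ex _ hW.
have xyP i : xy i = (X0, X1) \/ xy i = (Y0, Y1).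
  by rewrite /xy; case: ifP; [left|right].
move=> A B E F; rewrite sE; move: A B E F; apply: (span xy); last by move=> *; exact: h.
have ce (v u : V) : chi *: v = u -> v = chii *: u.
  by move=> <-; rewrite scalerA mulrC chiV scale1r.
(* The coefficients of [e] in the null frame, from [e_chi] divided by [chi]. *)
apply: ord2P; [exists (chii * io 1), (- (chii * o 1))|exists (- (chii * io 0)), (chii * o 0)];
  rewrite /lin_comb /xy /sp /=; congr pair.
- by rewrite (ce _ _ (e_chi 0).1); apply/matrixP => i j; rewrite !mxE; ring.
- by rewrite (ce _ _ (e_chi 1).1); apply/matrixP => i j; rewrite !mxE; ring.
- by rewrite (ce _ _ (e_chi 0).2); apply/matrixP => i j; rewrite !mxE; ring.
- by rewrite (ce _ _ (e_chi 1).2); apply/matrixP => i j; rewrite !mxE; ring.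
Qed.

End SpinGeometry.

(** * Symmetrization over four indices *)

Section PermutationSums.
Variable V : comNzRingType.

(** A permutation amounts to the image of 0 and a permutation of the rest; injectivity and the count
    [(n+1)!] give the bijection. *)
Lemma sum_lift_perm n (F : 'S_n.+1 -> V) :
  \sum_s F s = \sum_j \sum_(s : 'S_n) F (lift_perm ord0 j s).
Proof.
rewrite pair_big /= (reindex (fun p : 'I_n.+1 * 'S_n => lift_perm ord0 p.1 p.2)) //.
apply: onW_bij; apply: inj_card_bij.
  move=> [i s] [j t] /= e.
  have eij : i = j by have := congr1 (fun u : 'S_n.+1 => u ord0) e; rewrite !lift_perm_id.
  congr pair => //; apply/permP => k; apply: (@lift_inj _ j).
  by rewrite -(lift_perm_lift ord0 j t) -e eij lift_perm_lift.
by rewrite card_prod card_ord !card_Sn factS.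
Qed.

Lemma sum_perm4 (f : 'I_4 -> 'I_4 -> 'I_4 -> 'I_4 -> V) :
  \sum_(s : 'S_4) f (s 0) (s 1) (s 2%:R) (s 3%:R) =
  \sum_(i < 4) \sum_(j < 3) \sum_(k < 2) \sum_(l < 1)
    f i (lift i j) (lift i (lift j k)) (lift i (lift j (lift k l))).
Proof.
have e1 : (1 : 'I_4) = lift ord0 ord0 by exact: val_inj.
have e2 : (2%:R : 'I_4) = lift ord0 (lift ord0 ord0) by exact: val_inj.
have e3 : (3%:R : 'I_4) = lift ord0 (lift ord0 (lift ord0 ord0)) by exact: val_inj.
have e0 : (0 : 'I_4) = ord0 by exact: val_inj.
rewrite e3 e2 e1 e0 sum_lift_perm; apply: eq_bigr => i _.
rewrite sum_lift_perm; apply: eq_bigr => j _.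
rewrite sum_lift_perm; apply: eq_bigr => k _.
rewrite sum_lift_perm; apply: eq_bigr => l _.
rewrite (eq_bigr (fun=> f i (lift i j) (lift i (lift j k)) (lift i (lift j (lift k l))))).
  by rewrite sumr_const card_Sn.
by move=> s _; rewrite !(lift_perm_lift, lift_perm_id).
Qed.

Lemma sym_sum_perm4 T (c : T -> T -> T -> T -> V) (A B E F : T) :
  (forall p q r s, c q p r s = c p q r s) -> (forall p q r s, c p q s r = c p q r s) ->
  let a := tnth [tuple A; B; E; F] in
  \sum_(s : 'S_4) c (a (s 0)) (a (s 1)) (a (s 2%:R)) (a (s 3%:R)) =
  4%:R * (c A B E F + c A E B F + c A F B E + c B E A F + c B F A E + c E F A B).
Proof.
move=> c12 c34 a.
rewrite (sum_perm4 (fun i j k l => c (a i) (a j) (a k) (a l))).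
rewrite !big_ord_recl !big_ord0 /a !(tnth_nth A) /= /bump /=.
rewrite !(c12 A B) !(c12 A E) !(c12 A F) !(c12 B E) !(c12 B F) !(c12 E F).
rewrite !(c34 _ _ A B) !(c34 _ _ A E) !(c34 _ _ A F) !(c34 _ _ B E) !(c34 _ _ B F)
  !(c34 _ _ E F); ring.
Qed.
End PermutationSums.

(** * The geometry over the ring of smooth functions *)

Section SmoothGeometry.
Variables (R : realType) (D : pointed_open R).
Notation pt := 'rV[R]_4.
Notation C := (R[i]).
Notation S := (sfield D).

Lemma rep_real (f : pt -> R) (s : S) : rep (fun x => (f x)%:C%C) s -> sconj s = s.
Proof.
move=> h; apply: rep_eq (rep_conj h) _ => x Dx; rewrite -h //.
by apply/eqP; rewrite eq_complex /= oppr0 !eqxx.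
Qed.

Lemma rep_inv f (s t : S) : rep f s -> s * t = 1 -> rep (fun x => (f x)^-1) t.
Proof.
move=> h st x Dx; have e : s x * t x = 1 by rewrite -[LHS]/(ev x (s * t)) st.
have s0 : s x != 0 by apply/eqP => s0; move/eqP: e; rewrite s0 mul0r eq_sym oner_eq0.
by rewrite h //; apply: (mulfI s0); rewrite divff.
Qed.

Lemma sd_cst i c : sd i (scst D c) = 0.
Proof.
apply: sfield_ext => x Dx; rewrite -(rep_cpartial i (@rep_cst R D c) Dx).
by rewrite /cpartial /= !partial_cst.
Qed.

Lemma sepsE : @seps R D = @sg S.
Proof.
apply/funext => A; apply/funext => B; apply: sfield_extT => x.
by rewrite -[RHS]/(ev x (sg A B)) /sg rmorphB !rmorph_nat.
Qed.

Lemma rep_eq0 m n (F : pt -> 'M[C]_(m, n)) (G : 'M[S]_(m, n)) : repmx F G ->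
  (forall x, dom D x -> F x = 0) <-> G = 0.
Proof.
move=> h; split=> [h0|G0 x Dx]; last by rewrite h // G0 map_mx0.
by apply: repmx_ext h _ => x Dx; rewrite h0 // map_mx0.
Qed.

Variables (g J : pt -> 'M[R]_4) (phi : pt -> R) (e : frame R) (o : 'I_2 -> pt -> C).
Hypotheses (hK : conformally_kahler (dom D) g J phi) (he : spin_frame (dom D) g e)
  (ho : adapted_spinor (dom D) g J e o).
Variables (gS giS JS : 'M[S]_4) (eS : 'I_2 -> 'I_2 -> 'cV[S]_4) (oS : 'I_2 -> S)
  (phiS phii chii : S).
Hypotheses (gSP : repmx (fun x => map_mx (real_complex R) (g x)) gS)
  (gSV : gS *m giS = 1%:M)
  (eSP : forall A A', repmx (e A A') (eS A A'))
  (oSP : forall A, rep (o A) (oS A))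
  (phiSP : rep (fun x => (phi x)%:C%C) phiS) (phiV : phiS * phii = 1)
  (JSP : repmx (fun x => map_mx (real_complex R) (J x)) JS).

Definition ioS (A : 'I_2) : S := if A == 0 then - sconj (oS 1) else sconj (oS 0).
Definition chiS : S := \sum_A low oS A * ioS A.
Hypothesis chiV : chiS * chii = 1.

Notation half := (shalf D).
Notation nabS := (nab (@sda R D) half gS giS).
Notation ipS := (ip gS).
Notation derS := (der (@sda R D)).

Let g_sym : gS^T = gS.
Proof. by apply: gS_sym gSP _ => x Dx; case: hK => -[_ h _] _ _ _ _; exact: h. Qed.

Let e_gram A A' B B' : ipS (eS A A') (eS B B') = sg A B * sg A' B'.
Proof.
rewrite -sepsE; apply: rep_eq (gdot_rep gSP (eSP A A') (eSP B B')) _ => x Dx.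
by case: he => _ h _ _; rewrite h.
Qed.

Let e_conj A A' : map_mx (@sconj R D) (eS A A')
  = \sum_B \sum_B' (sg A B * sg A' B') *: eS B B'.
Proof.
have h1 : repmx (fun x => map_mx Num.conj (e A A' x)) (map_mx (@sconj R D) (eS A A')).
  apply/repmxP => i j x Dx; rewrite !mxE; exact: rep_conj ((repmxP _ _).1 (eSP A A') i j) _ Dx.
have h2 : repmx (fun x => \sum_B \sum_B' (eps R A B * eps R A' B') *: e B B' x)
    (\sum_B \sum_B' (seps D A B * seps D A' B') *: eS B B').
  apply: repmx_sum => B; apply: repmx_sum => B'; apply: repmx_scale; last exact: eSP.
  exact: rep_cst.
apply: repmx_ext h1 _; rewrite -sepsE => x Dx.
by case: he => _ _ h _; rewrite h //; exact: h2.
Qed.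

Let cs_d i (f : S) : sconj (@sda R D i f) = @sda R D i (sconj f).
Proof. exact: esym (sd_conj i f). Qed.
Let cs_g : map_mx (@sconj R D) gS = gS.
Proof. by apply/matrixP => i j; rewrite mxE; exact: rep_real (gS_rep gSP i j). Qed.
Let cs_chr k i j : sconj (chr (@sda R D) half gS giS k i j) = chr (@sda R D) half gS giS k i j.
Proof. exact: rep_real (chr_rep gSP gSV k i j). Qed.
Let cs_half : sconj half = half.
Proof.
apply: (rep_real (f := fun=> 2^-1)) => x Dx /=.
by rewrite fmorphV rmorph_nat.
Qed.
Let csK : involutive (@sconj R D).
Proof. by move=> f; apply: sfield_extT => x /=; rewrite conjCK. Qed.
Let io0 : ioS 0 = - sconj (oS 1). Proof. by []. Qed.
Let io1 : ioS 1 = sconj (oS 0). Proof. by []. Qed.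

Let I : S := scst D 'i%C.
Let I2 : I * I = - 1.
Proof. by apply: sfield_extT => x /=; rewrite -expr2 sqr_i. Qed.
Let dI i : @sda R D i I = 0. Proof. exact: sd_cst. Qed.

Let JJ : JS *m JS = - 1%:M.
Proof.
apply: repmx_ext (repmx_mul JSP JSP) _ => x Dx.
by case: hK => _ [_ h _ _] _ _ _; rewrite -map_mxM h // !map_mxN !map_mx1.
Qed.
Let Jg : JS^T *m gS *m JS = gS.
Proof.
apply: repmx_ext (repmx_mul (repmx_mul (repmx_tr JSP) gSP) JSP) _ => x Dx.
case: hK => _ [_ _ h _] _ _ _; rewrite map_trmx -!map_mxM h //; exact: gSP.
Qed.

Lemma lower_rep (p : 'I_2 -> pt -> C) (pS : 'I_2 -> S) :
  (forall A, rep (p A) (pS A)) -> forall B, rep (lower p B) (low pS B).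
Proof.
move=> hp B; rewrite /low -sepsE; apply: rep_sum => A.
by apply: rep_mul; [exact: hp|exact: rep_cst].
Qed.

Lemma iota_rep A : rep (iota_of o A) (ioS A).
Proof.
move: A; apply: ord2P; rewrite /iota_of /dagger /ioS /=.
  by apply: rep_opp; apply: rep_conj; exact: oSP.
by apply: rep_conj; exact: oSP.
Qed.

Lemma chi_rep : rep (chi_of o) chiS.
Proof.
by apply: rep_sum => A; apply: rep_mul; [exact: (lower_rep oSP)|exact: iota_rep].
Qed.

Let Je B B' : JS *m eS B B' = \sum_A (I * chii *
   (oS A * low ioS B + ioS A * low oS B)) *: eS A B'.
Proof.
have h2 : repmx (fun x => \sum_A ('i%C / chi_of o x *
    (o A x * lower (iota_of o) B x + iota_of o A x * lower o B x)) *: e A B' x)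
    (\sum_A (I * chii * (oS A * low ioS B + ioS A * low oS B)) *: eS A B').
  apply: repmx_sum => A; apply: repmx_scale; last exact: eSP.
  apply: rep_mul; first by apply: rep_mul; [exact: rep_cst|exact: rep_inv chi_rep chiV].
  apply: rep_add; apply: rep_mul.
  - exact: oSP.
  - exact: (lower_rep iota_rep).
  - exact: iota_rep.
  - exact: (lower_rep oSP).
apply: repmx_ext (repmx_mul JSP (eSP B B')) _ => x Dx.
by case: ho => _ h _; rewrite h //; exact: h2.
Qed.

Let ka := (phiS * phiS) *: (JS^T *m gS).
Let ka_closed i j k : @sda R D i (ka j k) + @sda R D j (ka k i) + @sda R D k (ka i j) = 0.
Proof.
pose w y := phi y ^+ 2 *: fundamental_form g J y.
have hw : repmx (fun x => map_mx (real_complex R) (w x)) ka.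
  move=> x Dx; rewrite -(repmx_scale (rep_mul phiSP phiSP)
    (repmx_mul (repmx_tr JSP) gSP) Dx).
  by rewrite /w /fundamental_form map_mxZ map_mxM map_trmx rmorphXn expr2.
have hij a b : rep (fun x => (w x a b)%:C%C) (ka a b).
  by move=> x Dx; have /matrixP/(_ a b) := hw x Dx; rewrite !mxE.
apply: rep_eq (rep_add (rep_add (rep_partial i (hij j k)) (rep_partial j (hij k i)))
  (rep_partial k (hij i j))) _ => x Dx.
case: hK => _ _ _ _ h; have /= := h x Dx i j k; rewrite -/w => hx.
by rewrite -!rmorphD /= hx.
Qed.

Lemma gamma_ga A A' B E : rep (gamma g e A A' B E)
  (ga (@sda R D) half gS giS eS (eS A A') B E).
Proof. by have := gamma_rep gSP gSV eSP A A' B E; rewrite sepsE. Qed.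

Lemma gamma'_ga' A A' B E : rep (gamma' g e A A' B E)
  (ga' (@sda R D) half gS giS eS (eS A A') B E).
Proof. by have := gamma'_rep gSP gSV eSP A A' B E; rewrite sepsE. Qed.

Let parallel A' B : \sum_A oS A * (derS (eS A A') (low oS B)
    - \sum_F \sum_E sg F E * ga (@sda R D) half gS giS eS (eS A A') B E * low oS F) = 0.
Proof.
have h : rep (fun x => \sum_A o A x * nabla_unprimed g e A A' (lower o) B x)
  (\sum_A oS A * (derS (eS A A') (low oS B)
    - \sum_F \sum_E sg F E * ga (@sda R D) half gS giS eS (eS A A') B E * low oS F)).
  apply: rep_sum => A; apply: rep_mul; first exact: oSP.
  apply: rep_add; first by apply: rep_der; [exact: eSP|exact: (lower_rep oSP)].
  apply: rep_opp; apply: rep_sum => F; apply: rep_sum => E; apply: rep_mul; last exact: (lower_rep oSP).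
  by apply: rep_mul; [rewrite -sepsE; exact: rep_cst|exact: gamma_ga].
apply: rep_eq h _ => x Dx; case: ho => _ _ hp; exact: hp.
Qed.

Notation r := (chii * phiS).

Lemma r_rep : rep (r_of phi o) r.
Proof. exact: rep_mul (rep_inv chi_rep chiV) phiSP. Qed.

Notation dX A' := (derS (vX eS oS A')).
Notation dY A' := (derS (vY eS ioS A')).
Notation c0 := (cc0 (@sda R D) half gS giS eS oS ioS chii).
Notation c1 := (cc1 (@sda R D) half gS giS eS oS ioS chii).

Lemma nablat_rep A' m n (F : pt -> 'M[C]_(m, n)) FS : repmx F FS ->
  repmx (nablat e o A' F) (map_mx (dX A') FS).
Proof.
move=> hF; rewrite /vX -(sum_der (@sda R D)); apply: repmx_sum => A.
by apply: repmx_scale; [exact: oSP|exact: repmx_der (eSP A A') hF].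
Qed.

Lemma nabla_rep A' m n (F : pt -> 'M[C]_(m, n)) FS : repmx F FS ->
  repmx (nabla e o A' F) (map_mx (dY A') FS).
Proof.
move=> hF; rewrite /vY -(sum_der (@sda R D)); apply: repmx_sum => A.
by apply: repmx_scale; [exact: iota_rep|exact: repmx_der (eSP A A') hF].
Qed.

Lemma div_rep m n (W : 'I_2 -> pt -> 'M[C]_(m, n)) WS :
  (forall A', repmx (W A') (WS A')) ->
  repmx (nabla_div g e o W) (ydiv (dY 0) (dY 1) c0 c1 (WS 0) (WS 1)).
Proof.
move=> hW.
have div := spin_div (@sdM R D) (shalf2 D) g_sym gSV e_gram (erefl chiS) chiV WS.
rewrite -div -sepsE.
apply: repmx_sum => A'; apply: repmx_sum => B'; apply: repmx_scale; first exact: rep_cst.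
apply: repmx_sum => A; apply: repmx_scale; first exact: iota_rep.
apply: repmx_add; first exact: repmx_der (eSP A B') (hW A').
apply: repmx_opp; apply: repmx_sum => D'; apply: repmx_sum => E'.
apply: repmx_scale; last exact: hW.
by apply: rep_mul; [exact: rep_cst|exact: gamma'_ga'].
Qed.

Lemma yang_rep n (F : pt -> 'M[C]_n) FS FiS : repmx F FS -> FiS *m FS = 1%:M ->
  generalized_yang (dom D) g e phi o F <->
  ydiv (dY 0) (dY 1) c0 c1 (r *: (FiS *m map_mx (dX 0) FS))
    (r *: (FiS *m map_mx (dX 1) FS)) = 0.
Proof.
move=> hF h1; apply: rep_eq0.
apply: (div_rep (WS := fun A' => r *: (FiS *m map_mx (dX A') FS))) => A'.
apply: repmx_scale; first exact: r_rep.
apply: repmx_mul; last exact: nablat_rep.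
exact: repmx_inv hF (mulmx1C h1).
Qed.

Lemma cspin_rep A B E F : rep (curvature_spinor g e A B E F)
  (scst D 4^-1 * cspin (@sda R D) half gS giS eS A B E F).
Proof.
have := curvature_spinor_rep gSP gSV eSP _ A B E F; rewrite sepsE; apply.
by move=> x Dx; case: hK => -[_ h _] _ _ _ _; exact: h.
Qed.

Lemma weyl_rep : conformally_half_flat (dom D) g e <->
  (forall A B E F, csym (@sda R D) half gS giS eS A B E F = 0).
Proof.
have hsym A B E F : rep (weyl_spinor g e A B E F)
    (scst D 24^-1 * csym (@sda R D) half gS giS eS A B E F).
  move=> x Dx; pose c p q t u := curvature_spinor g e p q t u x.
  have cE p q t u : c p q t u = 4^-1 * ev x (cspin (@sda R D) half gS giS eS p q t u).
    exact: cspin_rep.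
  have c12 p q t u : c q p t u = c p q t u.
    by rewrite !cE cspin12.
  have c34 p q t u : c p q u t = c p q t u.
    by rewrite !cE (cspin34 (@sdM R D) (@sdC R D) (shalf2 D) g_sym gSV).
  (* Each of the six terms occurs in four of the 24 permutations; this 4 cancels the 1/4 of the
     curvature spinor. *)
  rewrite -[RHS]/(24^-1 * ev x _) /weyl_spinor (sym_sum_perm4 A B E F c12 c34).
  congr (_ * _); rewrite !cE /csym !rmorphD -!mulrDr mulrA divff ?mul1r //.
split=> [h A B E F|h x Dx A B E F].
  have e0 : scst D 24^-1 * csym (@sda R D) half gS giS eS A B E F = 0.
    by apply: rep_eq (hsym A B E F) _ => x Dx; rewrite h.
  have e24 : scst D 24 * scst D 24^-1 = 1.
    by apply: sfield_extT => x; rewrite /= divff // pnatr_eq0.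
  by rewrite -[LHS]mul1r -e24 -mulrA e0 mulr0.
by rewrite (hsym A B E F x Dx) h mulr0.
Qed.

Lemma flat_box : conformally_half_flat (dom D) g e <->
  box (dX 0) (dX 1) (dY 0) (dY 1) c0 c1 r = 0.
Proof.
rewrite weyl_rep.
exact: (spin_weyl (@sdM R D) (@sdC R D) (shalf2 D) g_sym gSV e_gram e_conj cs_d cs_g
  cs_chr cs_half csK io0 io1 (erefl chiS) chiV phiV I2 dI JJ Jg Je ka_closed parallel).
Qed.

Let dP u : derivation (derS u).
Proof. by split=> *; [exact: derD|exact: (derM (@sdM R D))]. Qed.

Lemma yblock_rep k l (A : pt -> 'M[C]_k) (At : pt -> 'M[C]_l) (B : pt -> 'M[C]_(l, k))
    (Bt : pt -> 'M[C]_(k, l)) (AS AiS : 'M[S]_k) (AtS : 'M[S]_l)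
    (BS : 'M[S]_(l, k)) (BtS : 'M[S]_(k, l)) :
  repmx A AS -> AS *m AiS = 1%:M -> repmx At AtS -> repmx B BS -> repmx Bt BtS ->
  repmx (fun x => yang_block (A x) (At x) (B x) (Bt x)) (yblock AiS AtS BS BtS).
Proof.
move=> hA AAi hAt hB hBt x Dx; rewrite /yang_block /yblock map_block_mx.
rewrite !(map_mxD, map_mxN, map_mxM) hAt // hB // hBt //.
by rewrite (repmx_inv hA AAi Dx).
Qed.

Lemma backlund_box (k l : nat) (kl : (0 < k + l)%N)
    (JJ0 : pt -> 'M[C]_(k + l)) (A : pt -> 'M[C]_k) (At : pt -> 'M[C]_l)
    (B : pt -> 'M[C]_(l, k)) (Bt : pt -> 'M[C]_(k, l)) (JJ1 : pt -> 'M[C]_(l + k)) :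
  generalized_yang (dom D) g e phi o JJ0 -> block_form (dom D) JJ0 A At B Bt ->
  backlund (dom D) e phi o A At B Bt JJ1 ->
  generalized_yang (dom D) g e phi o JJ1 <->
  box (dX 0) (dX 1) (dY 0) (dY 1) c0 c1 r = 0.
Proof.
move=> hY [[sA uA] [sAt uAt] sB sBt hJ] [B1 [B1t [sB1 sB1t hB1 hB1t hJ1]]].
have [AS hA] := repmx_exists sA; have [AtS hAt] := repmx_exists sAt.
have [BS hB] := repmx_exists sB; have [BtS hBt] := repmx_exists sBt.
have [B1S hB1S] := repmx_exists sB1; have [B1tS hB1tS] := repmx_exists sB1t.
have [AiS [AAi AiA]] := repmx_unit hA uA; have [AtiS [AAti AtiA]] := repmx_unit hAt uAt.
pose ri : S := chiS * phii.
have rV : r * ri = 1 by rewrite /ri mulrACA [chii * _]mulrC chiV phiV mulr1.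
have hJ0S : repmx JJ0 (yblock AiS AtS BS BtS).
  by move=> x Dx; rewrite hJ // (yblock_rep hA AAi hAt hB hBt Dx).
have cx := spin_comm_x (@sdM R D) (@sdC R D) (shalf2 D) g_sym gSV e_gram (erefl chiS) chiV
  parallel.
have cy := spin_comm_y (@sdM R D) (@sdC R D) (shalf2 D) g_sym gSV e_gram e_conj cs_d cs_g
  cs_chr cs_half csK io0 io1 (erefl chiS) chiV parallel.
have ex := spin_exch (@sdM R D) (@sdC R D) (shalf2 D) g_sym gSV e_gram e_conj cs_d cs_g
  cs_chr cs_half csK io0 io1 (erefl chiS) chiV phiV I2 dI JJ Jg Je ka_closed parallel.
have inv0 := yblock_invl BS BtS AAi AtiA.
have E0 := (yangP c0 c1 r (dP _) (dP _) (dP _) (dP _) AiA AAti inv0).1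
  ((yang_rep hJ0S inv0).1 hY).
have b1 A' : r *: (AS *m map_mx (dX A') BtS *m AtS) = map_mx (dY A') B1S.
  apply: repmx_ext (repmx_scale r_rep (repmx_mul (repmx_mul hA (nablat_rep A' hBt)) hAt)) _.
  by move=> x Dx; rewrite hB1 // (nabla_rep A' hB1S Dx).
have b2 A' : r *: (AtS *m map_mx (dY A') BS *m AS) = map_mx (dX A') B1tS.
  apply: repmx_ext (repmx_scale r_rep (repmx_mul (repmx_mul hAt (nabla_rep A' hB)) hA)) _.
  by move=> x Dx; rewrite hB1t // (nablat_rep A' hB1tS Dx).
have [i1 i2 i3 i4] := bk_inv rV AAi AiA AAti AtiA.
have inv1 := yblock_invl B1S B1tS i1 i4.
have rri := rep_inv r_rep rV.
have hJ1S : repmx JJ1 (yblock (r *: AtS) (ri *: AiS) B1S B1tS).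
  move=> x Dx; rewrite hJ1 //.
  have h1 := repmx_scale rri (repmx_inv hAt AAti).
  have h2 := repmx_scale rri (repmx_inv hA AAi).
  by rewrite (yblock_rep h1 i1 h2 hB1S hB1tS Dx).
rewrite (yang_rep hJ1S inv1).
apply: (backlund_yang (dP _) (dP _) (dP _) (dP _) rV cx cy ex AAi AiA AAti AtiA
  (b1 0) (b1 1) (b2 0) (b2 1) E0 _ inv1).
by rewrite addnC.
Qed.

End SmoothGeometry.

(** A nonzero kernel vector would have vanishing norm. *)
Lemma posdef_unitmx (F : realFieldType) n (M : 'M[F]_n) :
  (forall v : 'rV[F]_n, v != 0 -> 0 < (v *m M *m v^T) 0 0) -> M \in unitmx.
Proof.
move=> h; rewrite -row_free_unit -kermx_eq0; apply: contraT => /rowV0Pn[v vM v0].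
by have := h v v0; rewrite (sub_kermxP vM) mul0mx mxE ltxx.
Qed.

Unset Implicit Arguments.

Theorem mainTheorem3 (R : realType) (U : set 'rV[R]_4) (hU : open U)
    (g J : 'rV[R]_4 -> 'M[R]_4) (phi : 'rV[R]_4 -> R)
    (hK : conformally_kahler U g J phi)
    (e : frame R) (he : spin_frame U g e)
    (o : 'I_2 -> 'rV[R]_4 -> R[i]) (ho : adapted_spinor U g J e o)
    (k kt : nat) (hn : (0 < k + kt)%N)
    (JJ : 'rV[R]_4 -> 'M[R[i]]_(k + kt))
    (hJJ : GL_valued U JJ) (hY : generalized_yang U g e phi o JJ)
    (A : 'rV[R]_4 -> 'M[R[i]]_k) (At : 'rV[R]_4 -> 'M[R[i]]_kt)
    (B : 'rV[R]_4 -> 'M[R[i]]_(kt, k)) (Bt : 'rV[R]_4 -> 'M[R[i]]_(k, kt))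
    (hblock : block_form U JJ A At B Bt)
    (JJ' : 'rV[R]_4 -> 'M[R[i]]_(kt + k))
    (hJJ' : backlund U e phi o A At B Bt JJ') :
  generalized_yang U g e phi o JJ' <-> conformally_half_flat U g e.
Proof.
(* On an empty domain both sides hold vacuously; otherwise a point of [U] serves as the base point
   of the ring. *)
have [[x0 Ux0]|nU] := pselect (exists x, U x); last first.
  by split=> _ x Ux; case: nU; exists x.
pose D : pointed_open R := PointedOpen hU Ux0.
have [[smg gsym gpos] [smJ _ _ _] _ [smphi phi0] _] := hK.
have [sme egram _ _] := he; have [smo oJ _] := ho.
have smgC : cmxsmooth (dom D) (fun x => map_mx (real_complex R) (g x)).
  by move=> i j; apply: (csmooth_ext hU (csmooth_real hU (smg i j))) => x _; rewrite mxE.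
have smJC : cmxsmooth (dom D) (fun x => map_mx (real_complex R) (J x)).
  by move=> i j; apply: (csmooth_ext hU (csmooth_real hU (smJ i j))) => x _; rewrite mxE.
have [gS gSP] := repmx_exists smgC; have [JS JSP] := repmx_exists smJC.
have gu x : dom D x -> map_mx (real_complex R) (g x) \in unitmx.
  by move=> Dx; rewrite map_unitmx; apply: posdef_unitmx; exact: gpos.
have [giS [gSV _]] := repmx_unit gSP gu.
pose eS a b := projT1 (cid (@repmx_exists R D _ _ _ (sme a b))).
have eSP a b : repmx (e a b) (eS a b).
  exact: projT2 (cid (@repmx_exists R D _ _ _ (sme a b))).
pose oS a : sfield D := @sof R D _ (smo a).
have oSP a : rep (o a) (oS a) by exact: rep_sof.
pose phiS : sfield D := sof (csmooth_real (dom_open (p := D)) smphi).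
have phiSP : rep (fun x => (phi x)%:C%C) phiS by exact: rep_sof.
have [phii phiV] : exists t, phiS * t = 1.
  apply: sfield_inv => x Dx; rewrite -(phiSP x Dx) eq_complex /= negb_and.
  by rewrite gt_eqF ?phi0.
(* Division by zero yields zero, so [chi = 0] would give [J e_00 = 0]. As [J] squares to minus the
   identity, [e_00] would vanish, against its product 1 with [e_11]. *)
have chi0 x : U x -> chi_of o x != 0.
  move=> Ux; apply/eqP => c0.
  have Je0 : map_mx (real_complex R) (J x) *m e 0 0 x = 0.
    by rewrite oJ // big1 // => a _; rewrite c0 invr0 mulr0 mul0r scale0r.
  have e0 : e 0 0 x = 0.
    case: hK => _ [_ JJ1 _ _] _ _ _; have := congr1 (mulmx (map_mx (real_complex R) (J x))) Je0.
    rewrite mulmxA -map_mxM JJ1 // map_mxN map_mx1 mulNmx mul1mx mulmx0 => /eqP.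
    by rewrite oppr_eq0 => /eqP.
  have := egram x Ux 0 0 1 1; rewrite /gdot e0 trmx0 !mul0mx mxE /eps /= subr0 mulr1.
  by move/eqP; rewrite eq_sym oner_eq0.
have [chii chiV] : exists t, chiS oS * t = 1.
  by apply: sfield_inv => x Dx; rewrite -(chi_rep oSP Dx); exact: chi0.
have flat := @flat_box R D g J phi e o hK he ho _ _ _ _ _ _ _ _ gSP gSV eSP oSP phiSP phiV JSP chiV.
have bk := @backlund_box R D g J phi e o hK he ho _ _ _ _ _ _ _ _ gSP gSV eSP oSP phiSP phiV JSP chiV
  k kt hn JJ A At B Bt JJ' hY hblock hJJ'.
exact: iff_trans bk (iff_sym flat).
Qed.
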